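(* Let $k$ be a field of characteristic $0$, $\widetilde{W}$ a finite reflection group on a graded finite-dimensional $k$-vector space $\widetilde V$, $G$ a good normal subgroup of $\widetilde W$, $W=\widetilde W/G$, $V$ the tangent space to $\widetilde V/G$ at $0$, and $p:\widetilde V\to\widetilde V/G\hookrightarrow V$. Let $L$ be a subspace of $\widetilde V$, and let $\widetilde W_L$, $G_L$ be the pointwise stabilizers of $L$ in $\widetilde W$ and $G$. Then $G_L$ is a good normal subgroup of $\widetilde W_L$, and the canonical map $\widetilde W_L/G_L\to W_{p(L)}$ is an isomorphism of reflection groups, where $W_{p(L)}$ is the pointwise stabilizer of $p(L)$ in $W$.
   Context: A grading on a finite-dimensional $k$-vector space is an algebraic action of $k^\times$ with strictly positive weights; $GL_{grad}(\widetilde V)$ is the group of elements of $GL(\widetilde V)$ commuting with this action, and $\widetilde W\subset GL_{grad}(\widetilde V)$. A reflection is an automorphism $g$ of finite order with $\ker(g-1)$ a hyperplane; a finite linear group is a reflection group if generated by its reflections. For a vector space $V$, $k[V]$ is the symmetric algebra of $V^*$. Put $B=k[\widetilde V]$, $\widetilde V/G=\operatorname{Spec}B^G$, $B^G_+$ the ideal of $B^G$ spanned by homogeneous elements of positive degree, and $V=(B^G_+/(B^G_+)^2)^*$. Let $N(G)$ be the normalizer of $G$ in $GL_{grad}(\widetilde V)$. Fix a graded $N(G)$-equivariant splitting $V^*\to B^G_+$; it induces a surjection $A=k[V]\to B^G$ with kernel $I$, i.e. a closed immersion $\widetilde V/G\hookrightarrow V$. $A_+$ is the ideal of positive-degree elements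 of $A$. The normal subgroup $G$ is called good in $\widetilde W$ if $G$ is of complete intersection (the minimal number of generators of $I$ is $\dim V-\dim\widetilde V$) and $W$ acts trivially on $I/A_+I$; in that case $W$ is a reflection group on $V$. ''$G_L$ good in $\widetilde W_L$'' is the same notion for the reflection group $\widetilde W_L$ on $\widetilde V$ and its normal subgroup $G_L$; then $\widetilde W_L/G_L$ is viewed as a reflection group on the tangent space to $\widetilde V/G_L$ at $0$. A morphism of reflection groups is a group homomorphism sending each reflection to $1$ or to a reflection; an isomorphism is an invertible such morphism. *)

(* Defs.v *)
From mathcomp Require Import all_boot all_fingroup all_order all_algebra.
From mathcomp Require Import all_character.
From mathcomp Require Import boolp.
From mathcomp Require Import mpoly.
From Stdlib Require Import ClassicalEpsilon.

Set Implicit Arguments.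
Unset Strict Implicit.
Unset Printing Implicit Defensive.

Import GRing.Theory.
Local Open Scope ring_scope.

(* Conventions.  A graded space is k^n, seen as the row vectors 'rV[k]_n, with
   a positive weight d i on the i-th coordinate: this is the choice of a basis
   of weight vectors for an algebraic action of k^* with positive weights.
   Linear groups are matrix representations acting on row vectors on the right,
   as in mxrepresentation.  Its algebra of functions is {mpoly k[n]}, the
   polynomials in the coordinate functions 'X_i. *)

Definition grading_action (k : fieldType) n (d : 'I_n -> nat) (t : k) : 'M[k]_n :=
  diag_mx (\row_i t ^+ d i).

Definition graded_mx (k : fieldType) n (d : 'I_n -> nat) (A : 'M[k]_n) : Prop :=
  forall t : k, t != 0 -> comm_mx A (grading_action d t).

Definition graded_repr (k : fieldType) n (d : 'I_n -> nat) (gT : finGroupType)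
    (G : {group gT}) (rG : mx_representation k G n) : Prop :=
  forall g, g \in G -> graded_mx d (rG g).

(* Finiteness of the order is automatic: g belongs to a finite group. *)
Definition is_reflection (k : fieldType) n (gT : finGroupType) (G : {group gT})
    (rG : mx_representation k G n) (g : gT) : bool :=
  (g \in G) && ((\rank (kermx (rG g - 1%:M))).+1 == n).

(* A finite linear group is a faithful representation of a finite group. *)
Definition reflection_group (k : fieldType) n (gT : finGroupType)
    (G : {group gT}) (rG : mx_representation k G n) : Prop :=
  mx_faithful rG /\ <<[set g | is_reflection rG g]>>%g = G.

Definition refl_morphism (k : fieldType) (aT rT : finGroupType) n m
    (G : {group aT}) (H : {group rT})
    (rG : mx_representation k G n) (rH : mx_representation k H m)
    (f : aT -> rT) : Prop :=
  [/\ {in G, forall x, f x \in H},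
      {in G &, {morph f : x y / (x * y)%g}} &
      forall x, is_reflection rG x -> f x = 1%g \/ is_reflection rH (f x)].

Definition refl_isomorphism (k : fieldType) (aT rT : finGroupType) n m
    (G : {group aT}) (H : {group rT})
    (rG : mx_representation k G n) (rH : mx_representation k H m)
    (f : aT -> rT) : Prop :=
  refl_morphism rG rH f /\
  exists f' : rT -> aT,
    [/\ refl_morphism rH rG f', {in G, cancel f f'} & {in H, cancel f' f}].

(* (mx_act A p)(v) = p (v *m A). *)
Definition mx_act (k : fieldType) n (A : 'M[k]_n) (p : {mpoly k[n]}) :
    {mpoly k[n]} :=
  p \mPo [tuple \sum_j A j i *: 'X_j | i < n].

Definition weight n (d : 'I_n -> nat) (m : 'X_{1..n}) : nat :=
  (\sum_i d i * m i)%N.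

Definition homogeneous (k : fieldType) n (d : 'I_n -> nat) (e : nat)
    (p : {mpoly k[n]}) : Prop :=
  forall m, m \in msupp p -> weight d m = e.

(* The span of the homogeneous elements of positive degree. *)
Definition positive_part (k : fieldType) n (d : 'I_n -> nat)
    (p : {mpoly k[n]}) : Prop :=
  forall m, m \in msupp p -> (0 < weight d m)%N.

(* B^G_+ *)
Definition positive_invariant (k : fieldType) n (d : 'I_n -> nat)
    (gT : finGroupType) (G : {group gT}) (rG : mx_representation k G n)
    (p : {mpoly k[n]}) : Prop :=
  (forall g, g \in G -> mx_act (rG g) p = p) /\ positive_part d p.

(* The product of P and Q when these are ideals of a subring of R. *)
Definition product_span (R : nzRingType) (P Q : R -> Prop) (b : R) : Prop :=
  exists s : seq (R * R),
    (forall x, x \in s -> P x.1 /\ Q x.2) /\ b = \sum_(x <- s) x.1 * x.2.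

(* N(G), the normalizer of the image of G in GL_grad. *)
Definition graded_normalizer (k : fieldType) n (d : 'I_n -> nat)
    (gT : finGroupType) (G : {group gT}) (rG : mx_representation k G n)
    (A : 'M[k]_n) : Prop :=
  [/\ A \in unitmx, graded_mx d A &
      forall M : 'M[k]_n, (exists2 g, g \in G & M = rG g) <->
        (exists2 g, g \in G & invmx A *m M *m A = rG g)].

(* A graded N(G)-equivariant splitting V^* -> B^G_+ of the projection onto
   V^* = B^G_+/(B^G_+)^2, read in a homogeneous basis of V^*: the classes of the
   sp_gen i form the basis (sp_basis), the splitting sends the class of sp_gen i
   to sp_gen i, and it is equivariant exactly when the span of the sp_gen i is
   stable under N(G).  Thus V = 'rV[k]_sp_dim, graded by sp_wt. *)
Record splitting (k : fieldType) n (d : 'I_n -> nat) (gT : finGroupType)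
    (G : {group gT}) (rG : mx_representation k G n) := Splitting {
  sp_dim : nat;
  sp_wt : 'I_sp_dim -> nat;
  sp_gen : 'I_sp_dim -> {mpoly k[n]};
  sp_homogeneous : forall i, homogeneous d (sp_wt i) (sp_gen i);
  sp_invariant : forall i, positive_invariant d rG (sp_gen i);
  sp_basis : forall b, positive_invariant d rG b ->
    exists! c : 'rV[k]_sp_dim,
      product_span (positive_invariant d rG) (positive_invariant d rG)
        (b - \sum_i c 0 i *: sp_gen i);
  sp_equivariant : forall A, graded_normalizer d rG A ->
    forall i, exists c : 'rV[k]_sp_dim,
      mx_act A (sp_gen i) = \sum_j c 0 j *: sp_gen j
}.
Arguments sp_wt {k n d gT G rG} S i : rename.
Arguments sp_gen {k n d gT G rG} S i : rename.
Arguments sp_invariant {k n d gT G rG} S i : rename.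
Arguments sp_basis {k n d gT G rG} S [b] : rename.
Arguments sp_equivariant {k n d gT G rG} S [A] : rename.

(* The composite p of the quotient map and the closed immersion into V. *)
Definition quotient_pt (k : fieldType) n (d : 'I_n -> nat) (gT : finGroupType)
    (G : {group gT}) (rG : mx_representation k G n) (S : splitting d rG)
    (v : 'rV[k]_n) : 'rV[k]_(sp_dim S) :=
  \row_i (sp_gen S i).@[v 0].

(* I, the kernel of A = k[V] -> B^G. *)
Definition relation_ideal (k : fieldType) n (d : 'I_n -> nat)
    (gT : finGroupType) (G : {group gT}) (rG : mx_representation k G n)
    (S : splitting d rG) (a : {mpoly k[sp_dim S]}) : Prop :=
  a \mPo [tuple sp_gen S i | i < sp_dim S] = 0.
Arguments relation_ideal {k n d gT G rG} S a.

Definition generates_ideal (R : comNzRingType) (I : R -> Prop) r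
    (u : 'I_r -> R) : Prop :=
  forall a, I a <-> exists c : 'I_r -> R, a = \sum_i c i * u i.

Definition min_generators (R : comNzRingType) (I : R -> Prop) (r : nat) : Prop :=
  (exists u : 'I_r -> R, generates_ideal I u) /\
  (forall r' (u : 'I_r' -> R), generates_ideal I u -> (r <= r')%N).

Definition complete_intersection (k : fieldType) n (d : 'I_n -> nat)
    (gT : finGroupType) (G : {group gT}) (rG : mx_representation k G n)
    (S : splitting d rG) : Prop :=
  exists r, min_generators (relation_ideal S) r /\
            (n + r)%N = sp_dim S.

(* The matrix of the action of A in N(G) on V; it is characterized by
   tangent_mxE and tangent_mxP, and makes quotient_pt equivariant
   (quotient_pt_mx). *)
Definition tangent_mx (k : fieldType) n (d : 'I_n -> nat) (gT : finGroupType)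
    (G : {group gT}) (rG : mx_representation k G n) (S : splitting d rG)
    (A : 'M[k]_n) : 'M[k]_(sp_dim S) :=
  epsilon (inhabits 1%:M) (fun M : 'M[k]_(sp_dim S) =>
    forall i, mx_act A (sp_gen S i) = \sum_j M j i *: sp_gen S j).

Section TangentTheory.
Context (k : fieldType) (n : nat) (d : 'I_n -> nat).

Lemma meval_mx_act (A : 'M[k]_n) p (v : 'rV[k]_n) :
  (mx_act A p).@[v 0] = p.@[(v *m A) 0].
Proof.
rewrite /mx_act comp_mpoly_meval; apply: meval_eq => i.
rewrite tnth_mktuple mxE raddf_sum /=; apply: eq_bigr => j _.
by rewrite mevalZ mevalXU mulrC.
Qed.

Lemma mx_act1 (p : {mpoly k[n]}) : mx_act 1%:M p = p.
Proof.
rewrite -[RHS]comp_mpoly_id /mx_act; congr (_ \mPo _).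
apply: eq_from_tnth => i; rewrite !tnth_mktuple (bigD1 i) //= mxE eqxx scale1r.
by rewrite big1 ?addr0 // => j /negbTE nji; rewrite mxE nji scale0r.
Qed.

Lemma mx_act_sum (A : 'M[k]_n) I (r : seq I) (c : I -> k) f :
  mx_act A (\sum_(i <- r) c i *: f i) = \sum_(i <- r) c i *: mx_act A (f i).
Proof.
by rewrite /mx_act raddf_sum; apply: eq_bigr => i _; rewrite /= comp_mpolyZ.
Qed.

Lemma mx_actM (A B : 'M[k]_n) p : mx_act (A *m B) p = mx_act A (mx_act B p).
Proof.
rewrite /mx_act !(comp_mpolyEX p) [RHS]raddf_sum; apply: eq_bigr => m _; rewrite /= comp_mpolyZ; congr (_ *: _).
rewrite !comp_mpolyX rmorph_prod /=; apply: eq_bigr => i _.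
rewrite rmorphXn /= !tnth_mktuple; congr (_ ^+ _).
rewrite raddf_sum /=; under [RHS]eq_bigr => j _.
  rewrite comp_mpolyZ comp_mpolyXU -tnth_nth tnth_mktuple scaler_sumr.
  over.
rewrite exchange_big /=; apply: eq_bigr => l _; rewrite mxE scaler_suml.
by apply: eq_bigr => j _; rewrite scalerA mulrC.
Qed.

Context (gT : finGroupType) (G : {group gT}) (rG : mx_representation k G n).
Context (S : splitting d rG).

Lemma sp_free (c c' : 'rV[k]_(sp_dim S)) :
  \sum_i c 0 i *: sp_gen S i = \sum_i c' 0 i *: sp_gen S i -> c = c'.
Proof.
move=> eq_cc'; suff E: c - c' = 0 by apply/eqP; rewrite -subr_eq0 E.
have inv0 : positive_invariant d rG (0 : {mpoly k[n]}).
  split=> [g _|m]; first by rewrite /mx_act raddf0.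
  by rewrite msupp0.
have [c0 [_ uniq0]] := sp_basis S inv0.
have nul (c1 : 'rV_(sp_dim S)) : \sum_i c1 0 i *: sp_gen S i = 0 -> c0 = c1.
  move=> E; apply: uniq0; rewrite E subr0.
  by exists [::]; split=> //; rewrite big_nil.
have <- : c0 = 0 by apply: nul; rewrite big1 // => i _; rewrite mxE scale0r.
symmetry; apply: nul.
under eq_bigr do rewrite !mxE scalerBl.
by rewrite sumrB eq_cc' subrr.
Qed.

Lemma tangent_mxP (A : 'M[k]_n) (M : 'M[k]_(sp_dim S)) :
    (forall i, mx_act A (sp_gen S i) = \sum_j M j i *: sp_gen S j) ->
  tangent_mx S A = M.
Proof.
move=> AM; apply: trmx_inj; apply/row_matrixP => i; apply: sp_free.
transitivity (mx_act A (sp_gen S i)); last first.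
  by rewrite AM; apply: eq_bigr => j _; rewrite !mxE.
rewrite (epsilon_spec (inhabits 1%:M) (fun M : 'M[k]_(sp_dim S) =>
  forall i, mx_act A (sp_gen S i) = \sum_j M j i *: sp_gen S j)); last by exists M.
by apply: eq_bigr => j _; rewrite !mxE.
Qed.

Lemma tangent_mxE A i : graded_normalizer d rG A ->
  mx_act A (sp_gen S i) = \sum_j tangent_mx S A j i *: sp_gen S j.
Proof.
move=> /(sp_equivariant S) => /(_ _)/cid ex_c.
pose M : 'M[k]_(sp_dim S) := \matrix_(j, i) sval (ex_c i) 0 j.
have AM l : mx_act A (sp_gen S l) = \sum_j M j l *: sp_gen S j.
  by rewrite (svalP (ex_c l)); apply: eq_bigr => j _; rewrite mxE.
by rewrite (tangent_mxP AM).
Qed.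

Lemma tangent_mxM A B :
    graded_normalizer d rG A -> graded_normalizer d rG B ->
  tangent_mx S (A *m B) = tangent_mx S A *m tangent_mx S B.
Proof.
move=> nA nB; apply: tangent_mxP => i.
rewrite mx_actM (tangent_mxE i nB) mx_act_sum.
under eq_bigr do rewrite (tangent_mxE _ nA) scaler_sumr.
rewrite exchange_big; apply: eq_bigr => l _; rewrite mxE scaler_suml.
by apply: eq_bigr => j _; rewrite scalerA mulrC.
Qed.

Lemma tangent_mx_id (A : 'M[k]_n) :
  (forall i, mx_act A (sp_gen S i) = sp_gen S i) -> tangent_mx S A = 1%:M.
Proof.
move=> Aid; apply: tangent_mxP => i; rewrite Aid (bigD1 i) //= mxE eqxx scale1r.
by rewrite big1 ?addr0 // => j /negbTE nji; rewrite mxE nji scale0r.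
Qed.

Lemma quotient_pt_mx A v : graded_normalizer d rG A ->
  quotient_pt S (v *m A) = quotient_pt S v *m tangent_mx S A.
Proof.
move=> nA; apply/rowP => i; rewrite !mxE -meval_mx_act (tangent_mxE i nA).
rewrite raddf_sum /=; apply: eq_bigr => j _.
by rewrite mevalZ !mxE mulrC.
Qed.

End TangentTheory.

Section QuotientRepresentation.
Context (k : fieldType) (n : nat) (d : 'I_n -> nat) (gT : finGroupType).
Context (W : {group gT}) (rW : mx_representation k W n).
Context (grW : graded_repr d rW) (G : {group gT}) (nGW : (G <| W)%g).
Let rG := subg_repr rW (normal_sub nGW).
Context (S : splitting d rG).

Lemma repr_graded_normalizer g : g \in W -> graded_normalizer d rG (rW g).
Proof.
move=> Wg; split; [exact: repr_mx_unit | exact: grW |] => M.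
have nGg : g \in 'N(G)%g by apply: subsetP Wg; apply: normal_norm.
have sGW := subsetP (normal_sub nGW).
split=> [[h Gh ->] | [h Gh E]].
  exists (h ^ g)%g; first by rewrite memJ_norm.
  have Wh := sGW _ Gh.
  by rewrite /= conjgE !repr_mxM ?groupM ?groupV // repr_mxV // mulmxA.
exists (h ^ g^-1)%g; first by rewrite memJ_norm ?groupV.
have Wh := sGW _ Gh.
rewrite /= conjgE invgK !repr_mxM ?groupM ?groupV // repr_mxV //.
rewrite -[rW h]E !mulmxA mulmxV ?repr_mx_unit // mul1mx.
by rewrite mulmxK ?repr_mx_unit.
Qed.

Lemma tangent_mx_repr : mx_repr W (fun g => tangent_mx S (rW g)).
Proof.
split=> [|g h Wg Wh]; last first.
  by rewrite repr_mxM // tangent_mxM //; apply: repr_graded_normalizer.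
by apply: tangent_mx_id => i; rewrite repr_mx1 mx_act1.
Qed.
Definition tangent_repr := MxRepresentation tangent_mx_repr.

Lemma tangent_rker : (G \subset rker tangent_repr)%g.
Proof.
apply/subsetP => g Gg; have Wg := subsetP (normal_sub nGW) _ Gg.
apply/rkerP; split=> //; apply: tangent_mx_id => i.
by case: (sp_invariant S i) => invS _; apply: invS.
Qed.

(* The action of W/G on V. *)
Definition quotient_repr : mx_representation k (W / G) (sp_dim S) :=
  quo_repr tangent_rker (normal_norm nGW).

(* G is good in the reflection group W. *)
Definition good : Prop :=
  [/\ reflection_group rW,
      complete_intersection S &
      forall x a, x \in (W / G)%g -> relation_ideal S a ->
        product_span (positive_part (sp_wt S))
          (relation_ideal S) (mx_act (quotient_repr x) a - a)].

End QuotientRepresentation.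

Section PointwiseStabilizer.
Context (k : fieldType) (n : nat) (gT : finGroupType) (G : {group gT}).
Context (rG : mx_representation k G n) (X : 'rV[k]_n -> Prop).

Definition point_stabilizer : {set gT} :=
  [set g in G | `[< forall v, X v -> v *m rG g = v >]].

Lemma point_stabilizer_group_set : group_set point_stabilizer.
Proof.
apply/group_setP; split=> [|g h].
  by rewrite inE group1; apply/asboolP => v _; rewrite repr_mx1 mulmx1.
rewrite !inE => /andP[Gg /asboolP Xg] /andP[Gh /asboolP Xh].
rewrite groupM //; apply/asboolP => v Xv.
by rewrite repr_mxM // mulmxA Xg ?Xh.
Qed.
Canonical point_stabilizer_group := Group point_stabilizer_group_set.

Lemma point_stabilizer_sub : point_stabilizer \subset G.
Proof. by apply/subsetP => g; rewrite inE => /andP[]. Qed.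

End PointwiseStabilizer.

Section LinearStabilizer.
Context (k : fieldType) (n : nat) (gT : finGroupType).
Context (W : {group gT}) (rW : mx_representation k W n).
Context (G : {group gT}) (nGW : (G <| W)%g) (l : nat) (L : 'M[k]_(l, n)).

(* The subspace L is the row space of a matrix. *)
Definition stab_repr : mx_representation k (rstab_group rW L) n :=
  subg_repr rW (rstab_sub rW L).

Lemma stab_graded d (grW : graded_repr d rW) : graded_repr d stab_repr.
Proof. by move=> g /(subsetP (rstab_sub rW L)); apply: grW. Qed.

Lemma stab_normal :
  (rstab_group (subg_repr rW (normal_sub nGW)) L <| rstab_group rW L)%g.
Proof.
rewrite /normal /= rstab_subg subsetIr /=; apply: normsI; last exact: normG.
exact: subset_trans (rstab_sub rW L) (normal_norm nGW).
Qed.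

End LinearStabilizer.
Arguments stab_graded {k n gT W rW l} L [d] grW : rename.

(* For H <= G, the map xH |-> xG; see canonical_mapE. *)
Definition canonical_map (gT : finGroupType) (H G : {group gT})
    (x : coset_of H) : coset_of G := coset G (repr x).

Lemma canonical_mapE (gT : finGroupType) (H G : {group gT}) (g : gT) :
    (H \subset G)%g -> g \in 'N(H)%g -> g \in 'N(G)%g ->
  canonical_map G (coset H g) = coset G g.
Proof.
move=> sHG nHg nGg; rewrite /canonical_map val_coset //.
case: repr_rcosetP => h Hh; have Gh := subsetP sHG _ Hh.
exact: coset_kerl.
Qed.

(* Main.v *)
Require Import Defs.
From HB Require Import structures.
From mathcomp Require Import all_boot all_fingroup all_order all_algebra.
From mathcomp Require Import all_character.
From mathcomp Require Import mpoly.
From mathcomp Require Import boolp ring cyclic.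

Set Implicit Arguments.
Unset Strict Implicit.
Unset Printing Implicit Defensive.

Import GRing.Theory.
Local Open Scope ring_scope.

(* A generic vector v of L has the same stabilizers as L, and near v the quotient
   by G looks like the quotient by G_L near 0.  This is made algebraic by a
   G_L-invariant e with e(v) = 1 which is idempotent modulo the ideal of B generated
   by the G-invariants vanishing at v.  Multiplying by e and averaging over G moves
   a G_L-invariant (or a relation between G_L-invariants) to one for G, with the
   same Taylor expansion to the needed order.  Hence the conormal module I_L/m I_L
   at 0 is a quotient of a subspace of the fibre of I/I^2 at p(v), on which W_L acts
   trivially; this bounds the number of generators of I_L from above, and dimension
   bounds it from below.  Modulo the trivial part given by the linear terms of I,
   the tangent spaces at p(v) and at 0 agree as representations of W_L, so that
   w - 1 has the same rank on both.
   That W_L is generated by reflections is Steinberg's theorem, deduced from the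
   freeness of B over B^W: the dual basis for the trace form has a common
   denominator N, a product of linear forms, and those factors of N which vanish
   at v can be cancelled after summation over the reflection subgroup fixing v.
   A reflection s of W acts on V with rank(s - 1) <= 1: at a generic point of its
   hyperplane, s moves an invariant by a multiple of l^e, where e is the
   ramification index of G along l = 0. *)

(** Everything is done with polynomials at k-rational points; no completion, localisation or
    quotient module is formed. The price is that local identities hold only after multiplication by
    e, which has to be removed afterwards: as e is 1 at v, this costs nothing modulo the maximal
    ideal. The delicate point is the transport of a relation. Averaging over G adds terms from the g
    outside G_L, and these are shown to have, modulo I_L, skew-symmetric coefficients on the gen_i -
    gen_i(v), so that like Koszul relations they contribute nothing to the fibre. With N = dim V and
    M the dimension of the tangent space for G_L, the count is: I has N - n generators, at least N -
    M are used up by linear terms at p(v), and at most M - n are left for I_L. The converse bound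
    compares growth of dimensions in bounded weight, in place of Krull dimension. Trivial action on
    the conormal fibre is given at 0 only and reaches p(v) by induction on the weight. Complete
    reducibility enters in the form: if w has finite order, (w - 1)^2 c = 0 implies (w - 1) c =
    0. *)

Definition mem_ideal (R : comNzRingType) (X : R -> Prop) : Prop :=
  [/\ X 0, forall a b, X a -> X b -> X (a + b) & forall c a, X a -> X (c * a)].

Definition span_ideal (R : comNzRingType) (X : R -> Prop) : R -> Prop :=
  product_span X (fun _ => True).

(** * Ideals and spans of products *)

Section Ideals.
Context (R : comNzRingType).
Implicit Types (X Y P Q : R -> Prop).

Lemma ps_ind P Q X : X 0 -> (forall a b, X a -> X b -> X (a + b)) ->
  (forall p q, P p -> Q q -> X (p * q)) -> forall b, product_span P Q b -> X b.
Proof.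
move=> X0 XD XM b [s [sP ->]]; elim: s sP => [|x s IH] sP; first by rewrite big_nil.
rewrite big_cons; apply: XD; last by apply: IH => y ys; apply: sP; rewrite inE ys orbT.
by case: (sP x (mem_head _ _)) => ? ?; apply: XM.
Qed.

Lemma ps0 P Q : product_span P Q 0.
Proof. by exists [::]; split=> //; rewrite big_nil. Qed.

Lemma psD P Q a b : product_span P Q a -> product_span P Q b -> product_span P Q (a + b).
Proof.
move=> [s [sP ->]] [t [tP ->]]; exists (s ++ t); split; last by rewrite big_cat.
by move=> x; rewrite mem_cat => /orP[/sP|/tP].
Qed.

Lemma psI P Q p q : P p -> Q q -> product_span P Q (p * q).
Proof.
by move=> Pp Qq; exists [:: (p, q)]; split=> [x|]; rewrite ?big_seq1 // inE => /eqP->.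
Qed.

Lemma ps_mono P Q P' Q' : (forall a, P a -> P' a) -> (forall a, Q a -> Q' a) ->
  forall b, product_span P Q b -> product_span P' Q' b.
Proof.
move=> PP QQ; apply: ps_ind; [exact: ps0 | exact: psD | ].
by move=> p q /PP ? /QQ ?; apply: psI.
Qed.

Lemma ps_ideal P Q : (forall c a, Q a -> Q (c * a)) -> mem_ideal (product_span P Q).
Proof.
move=> QM; split; [exact: ps0 | exact: psD | move=> c].
apply: ps_ind; first by rewrite mulr0; exact: ps0.
  by move=> a b ? ?; rewrite mulrDr; exact: psD.
by move=> p q ? ?; rewrite mulrCA; apply: psI => //; apply: QM.
Qed.

Lemma span_ideal_ideal P : mem_ideal (span_ideal P).
Proof. exact: ps_ideal. Qed.

Lemma span_ideal_in P a : P a -> span_ideal P a.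
Proof. by move=> Pa; rewrite -[a]mulr1; apply: psI. Qed.

Lemma ideal0 X : mem_ideal X -> X 0. Proof. by case. Qed.
Lemma idealD X a b : mem_ideal X -> X a -> X b -> X (a + b).
Proof. by case=> _ h _; apply: h. Qed.
Lemma idealMl X c a : mem_ideal X -> X a -> X (c * a).
Proof. by case=> _ _; apply. Qed.
Lemma idealMr X c a : mem_ideal X -> X a -> X (a * c).
Proof. by move=> ? ?; rewrite mulrC; apply: idealMl. Qed.
Lemma idealN X a : mem_ideal X -> X a -> X (- a).
Proof. by move=> ? ?; rewrite -mulN1r; apply: idealMl. Qed.
Lemma idealB X a b : mem_ideal X -> X a -> X b -> X (a - b).
Proof. by move=> iX ? ?; apply: idealD => //; apply: idealN. Qed.
Lemma ideal_sum X (iX : mem_ideal X) I (r : seq I) (P : pred I) (F : I -> R) :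
  (forall i, P i -> X (F i)) -> X (\sum_(i <- r | P i) F i).
Proof. by move=> XF; apply: big_ind => //; [exact: ideal0 | move=> *; exact: idealD]. Qed.

Lemma span_ideal_ind P X : mem_ideal X -> (forall p, P p -> X p) ->
  forall b, span_ideal P b -> X b.
Proof.
move=> iX PX; apply: ps_ind; [exact: ideal0 | by move=> *; exact: idealD | ].
by move=> p q /PX ? _; apply: idealMr.
Qed.

Lemma mem_ideal_sym X a b : mem_ideal X -> X (a - b) -> X (b - a).
Proof. by move=> iX ?; rewrite -opprB; apply: idealN. Qed.

Lemma mem_idealM X a b a' b' : mem_ideal X -> X (a - a') -> X (b - b') -> X (a * b - a' * b').
Proof.
move=> iX Xa Xb; have ->: a * b - a' * b' = b * (a - a') + a' * (b - b') by ring.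
by apply: idealD => //; apply: idealMl.
Qed.

Lemma span_finE r (u : 'I_r -> R) a :
  span_ideal (fun b => exists i, b = u i) a <-> exists c : 'I_r -> R, a = \sum_i c i * u i.
Proof.
split; last first.
  move=> [c ->]; apply: ideal_sum; first exact: span_ideal_ideal.
  by move=> i _; apply: idealMl; [exact: span_ideal_ideal | apply: span_ideal_in; exists i].
move: a; apply: ps_ind.
- by exists (fun=> 0); rewrite big1 // => i _; rewrite mul0r.
- move=> _ _ [c ->] [c' ->]; exists (fun i => c i + c' i).
  by rewrite -big_split; apply: eq_bigr => i _; rewrite mulrDl.
move=> _ q [i ->] _; exists (fun j => if j == i then q else 0).
rewrite (bigD1 i) //= eqxx big1 ?addr0 1?mulrC // => j /negbTE->.
by rewrite mul0r.
Qed.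

End Ideals.

(** * Morphisms out of polynomial rings *)

Section PolynomialMorphisms.
Context (k : fieldType) (n : nat).
Implicit Types p q : {mpoly k[n]}.

Lemma mpoly_ring_ind (X : {mpoly k[n]} -> Prop) :
  (forall c, X c%:MP) -> (forall i, X 'X_i) ->
  (forall p q, X p -> X q -> X (p + q)) -> (forall p q, X p -> X q -> X (p * q)) ->
  forall p, X p.
Proof.
move=> XC XV XD XM; have X1 : X 1 by rewrite -mpolyC1; exact: XC.
apply: mpolyind => [|c m p _ _ Xp]; first by rewrite -mpolyC0; exact: XC.
apply: XD => //; rewrite -mul_mpolyC; apply: (XM); first exact: XC.
rewrite mpolyXE_id; apply: (big_ind X) => [|p1 q1|i _]; [exact: X1 | exact: XM |].
by elim: (m i) => [|j IH]; rewrite ?expr0 // exprS; apply: XM.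
Qed.

(** Congruence modulo an ideal respects sums and products, so the variables are enough. First-order
    Taylor expansion and the divisibility of g p - p by a linear form are instances. *)
Lemma mpoly_rmorph_mod (S : comNzRingType) (f g : {rmorphism {mpoly k[n]} -> S})
    (X : S -> Prop) : mem_ideal X ->
  (forall c, f c%:MP = g c%:MP) -> (forall i, X (f 'X_i - g 'X_i)) ->
  forall p, X (f p - g p).
Proof.
move=> iX fgC fgX; apply: mpoly_ring_ind => // [c|p q Xp Xq|p q Xp Xq].
- by rewrite fgC subrr; exact: ideal0.
- by rewrite !rmorphD opprD addrACA; apply: idealD.
- by rewrite !rmorphM; apply: mem_idealM.
Qed.

Lemma mpoly_rmorph_eq (S : comNzRingType) (f g : {rmorphism {mpoly k[n]} -> S}) :
  (forall c, f c%:MP = g c%:MP) -> (forall i, f 'X_i = g 'X_i) -> f =1 g.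
Proof.
move=> fgC fgX p; apply/eqP; rewrite -subr_eq0; apply/eqP.
move: p; apply: (@mpoly_rmorph_mod _ f g (fun x => x = 0)) => //.
  by split=> // [a b -> ->|c a ->]; rewrite ?addr0 ?mulr0.
by move=> i; rewrite fgX subrr.
Qed.

Lemma mpoly_taylor p (a : 'I_n -> k) :
  exists F : 'I_n -> {mpoly k[n]}, p - (p.@[a])%:MP = \sum_i F i * ('X_i - (a i)%:MP).
Proof.
pose X := span_ideal (fun b : {mpoly k[n]} => exists i, b = 'X_i - (a i)%:MP).
suff: X (p - (p.@[a])%:MP) by move=> /(span_finE (fun i => 'X_i - (a i)%:MP)).
have iX : mem_ideal X by exact: span_ideal_ideal.
pose g : {rmorphism {mpoly k[n]} -> {mpoly k[n]}} := @mpolyC n k \o meval a.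
apply: (@mpoly_rmorph_mod _ idfun g _ iX) => [c|i] /=; rewrite ?mevalC //.
by rewrite mevalXU; apply: span_ideal_in; exists i.
Qed.

End PolynomialMorphisms.

HB.instance Definition _ (k : fieldType) (n : nat) (A : 'M[k]_n) :=
  GRing.LRMorphism.copy (@mx_act k n A)
    (comp_mpoly [tuple \sum_j A j i *: 'X_j | i < n]).

(** * Linear forms and divisibility by them *)

Section LinearForms.
Context (k : fieldType) (n : nat).
Implicit Types (p q : {mpoly k[n]}) (c : 'cV[k]_n).

(** Linear forms are columns: a point v pairs with c as [v *m c], and g acts by [rW g *m c]. *)
Definition lin c : {mpoly k[n]} := \sum_i c i 0 *: 'X_i.
Definition ldiv c p := exists q, p = q * lin c.

Lemma mx_actX (A : 'M[k]_n) i : mx_act A 'X_i = \sum_j A j i *: 'X_j.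
Proof. by rewrite /mx_act comp_mpolyXU -tnth_nth tnth_mktuple. Qed.

Lemma mx_actC (A : 'M[k]_n) a : mx_act A a%:MP = a%:MP.
Proof. by rewrite /mx_act comp_mpolyC. Qed.

Lemma mx_act_lin (A : 'M[k]_n) c : mx_act A (lin c) = lin (A *m c).
Proof.
rewrite /lin raddf_sum /=; under eq_bigr => i _ do rewrite linearZ /= mx_actX scaler_sumr.
rewrite exchange_big; apply: eq_bigr => j _; rewrite mxE scaler_suml.
by apply: eq_bigr => i _; rewrite scalerA mulrC.
Qed.

Lemma linB c c' : lin (c - c') = lin c - lin c'.
Proof. by rewrite /lin -sumrB; apply: eq_bigr => i _; rewrite !mxE scalerBl. Qed.

Lemma linZ x c : lin (x *: c) = x *: lin c.
Proof. by rewrite /lin scaler_sumr; apply: eq_bigr => i _; rewrite mxE scalerA. Qed.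

Lemma lin_lincomb m (x : 'I_m -> k) (f : 'I_m -> 'cV[k]_n) :
  lin (\sum_i x i *: f i) = \sum_i x i *: lin (f i).
Proof.
rewrite (big_morph lin (id1 := 0) (op1 := +%R)) => [|c c'|].
- by apply: eq_bigr => i _; rewrite linZ.
- by rewrite /lin -big_split; apply: eq_bigr => i _; rewrite mxE scalerDl.
by rewrite /lin big1 // => i _; rewrite mxE scale0r.
Qed.

Lemma mcoeff_lin c i : (lin c)@_U_(i) = c i 0.
Proof.
rewrite /lin raddf_sum (bigD1 i) //= mcoeffZ mcoeffXU eqxx mulr1 big1 ?addr0 // => j /negbTE ji.
by rewrite mcoeffZ mcoeffXU ji mulr0.
Qed.

Lemma lin_eq0 c : (lin c == 0) = (c == 0).
Proof.
apply/eqP/eqP=> [l0|->]; last by rewrite /lin big1 // => i _; rewrite mxE scale0r.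
by apply/colP => i; rewrite -mcoeff_lin l0 mcoeff0 mxE.
Qed.

Lemma meval_lin c (v : 'rV[k]_n) : (lin c).@[v 0] = (v *m c) 0 0.
Proof.
rewrite /lin raddf_sum mxE; apply: eq_bigr => i _.
by rewrite /= mevalZ mevalXU mulrC.
Qed.

Lemma ldiv_ideal c : mem_ideal (ldiv c).
Proof.
split=> [|_ _ [a ->] [b ->]|d _ [a ->]]; first by exists 0; rewrite mul0r.
  by exists (a + b); rewrite mulrDl.
by exists (d * a); rewrite mulrA.
Qed.

(* A nonzero linear form is prime: it generates the kernel of a substitution. *)
Lemma lin_reduction c : c != 0 ->
  exists sg : {lrmorphism {mpoly k[n]} -> {mpoly k[n]}}, forall p, ldiv c p <-> sg p = 0.
Proof.
move=> /matrix0Pn[j [z]]; rewrite (ord1 z) => {z} cj.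
(* Subtracting a multiple of [lin c] from the j-th variable, where c_j is nonzero, sends [lin c] to
   0 and changes no variable modulo [lin c]. *)
pose t := [tuple 'X_i - ((i == j)%:R / c j 0) *: lin c | i < n].
exists (comp_mpoly t) => p.
have tX i : 'X_i \mPo t = 'X_i - ((i == j)%:R / c j 0) *: lin c.
  by rewrite comp_mpolyXU -tnth_nth tnth_mktuple.
have tl : lin c \mPo t = 0.
  rewrite /lin raddf_sum /=; under eq_bigr do rewrite comp_mpolyZ tX scalerBr scalerA.
  rewrite sumrB -/(lin c) (bigD1 j) //= eqxx mul1r divff // scale1r.
  rewrite big1 ?addr0 ?subrr // => i /negbTE->; by rewrite mul0r mulr0 scale0r.
split=> [[q ->]|tp]; first by rewrite rmorphM /= tl mulr0.
suff: ldiv c (p - (p \mPo t)) by rewrite tp subr0.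
apply: (@mpoly_rmorph_mod k n _ idfun (comp_mpoly t) _ (ldiv_ideal c)) => [a|i] /=.
  by rewrite comp_mpolyC.
rewrite tX opprB addrC subrK; exists ((i == j)%:R / c j 0)%:MP.
by rewrite mul_mpolyC.
Qed.

Lemma lin_prime c p q : c != 0 -> ldiv c (p * q) -> ldiv c p \/ ldiv c q.
Proof.
move=> /lin_reduction[sg sgP] /sgP/eqP; rewrite rmorphM mulf_eq0.
by case/orP=> /eqP/sgP; [left | right].
Qed.

End LinearForms.

(** * General position over an infinite field *)

Section Avoidance.
Context (k : fieldType) (char0 : [pchar k] =i pred0).

Lemma char0_natr_eq0 m : (m%:R == 0 :> k) = (m == 0)%N.
Proof. by move/pcharf0P: char0. Qed.

Lemma char0_natr_inj : injective (fun m : nat => m%:R : k).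
Proof.
move=> a b; wlog le_ab : a b / (a <= b)%N => [H E|].
  by case/orP: (leq_total a b) => [|?]; [move/H; apply | apply/esym/H].
move/eqP; rewrite eq_sym -subr_eq0 -natrB // char0_natr_eq0 subn_eq0 => le_ba.
by apply/eqP; rewrite eqn_leq le_ab.
Qed.

Lemma poly_nonroot (p : {poly k}) : p != 0 -> exists m : nat, p.[m%:R] != 0.
Proof.
move=> p0; pose rs := [seq m%:R : k | m <- iota 0 (size p)].
have: ~~ all (root p) rs.
  apply/negP => rsP; have := max_poly_roots p0 rsP.
  by rewrite size_map size_iota ltnn map_inj_uniq ?iota_uniq //; [move/(_ isT) | exact: char0_natr_inj].
by case/allPn=> _ /mapP[m _ ->]; exists m.
Qed.

(* The points (1, t, t^2, ...) of the moment curve lie in a given hyperplane for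
   finitely many t only. *)
Lemma avoid_hyperplanes m (s : seq 'cV[k]_m) : (forall c, c \in s -> c != 0) ->
  exists u : 'rV[k]_m, forall c, c \in s -> (u *m c) 0 0 != 0.
Proof.
move=> s0; pose P (c : 'cV[k]_m) := \poly_(i < m) (if insub i is Some j then c j 0 else 0).
have [t Pt] : exists t : nat, (\prod_(c <- s) P c).[t%:R] != 0.
  apply: poly_nonroot; rewrite prodf_seq_neq0; apply/allP => c /s0 /matrix0Pn[i [z]].
  rewrite (ord1 z) /= => ci; apply/eqP => /polyP/(_ i); rewrite coef_poly ltn_ord valK coef0.
  by apply/eqP.
exists (\row_i t%:R ^+ i) => c cs; rewrite mxE; under eq_bigr do rewrite mxE.
move: Pt; rewrite horner_prod prodf_seq_neq0 => /allP/(_ c cs) /=.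
rewrite /P horner_poly; apply: contraNN => /eqP E; apply/eqP; rewrite -[RHS]E.
by apply: eq_bigr => i _; rewrite valK mulrC.
Qed.

(** For each t, fix a monomial occurring in some [p t j]; its coefficients in the [p t j] form a
    nonzero vector, and it suffices that u is not orthogonal to it. *)
Lemma avoid_mpoly n m (T : eqType) (s : seq T) (p : T -> 'I_m -> {mpoly k[n]}) :
  (forall t, t \in s -> exists j, p t j != 0) ->
  exists u : 'I_m -> k, forall t, t \in s -> \sum_j u j *: p t j != 0.
Proof.
move=> sP.
have ex t : exists mo, t \in s -> exists j, (p t j)@_mo != 0.
  have [/sP[j pj]|_] := boolP (t \in s); last by exists 0%MM.
  by exists (mlead (p t j)) => _; exists j; rewrite mleadc_eq0.
have [mo moP] := choice ex.
have [|u uP] := @avoid_hyperplanes m [seq \col_j (p t j)@_(mo t) | t <- s].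
  move=> _ /mapP[t ts ->]; have [j pj] := moP t ts.
  by apply: contraNneq pj => /colP/(_ j); rewrite !mxE => ->.
exists (fun j => u 0 j) => t ts; have := uP _ (map_f _ ts).
apply: contraNneq => E; rewrite mxE; apply/eqP.
transitivity ((\sum_j u 0 j *: p t j)@_(mo t)); last by rewrite E mcoeff0.
by rewrite raddf_sum; apply: eq_bigr => j _; rewrite /= mcoeffZ mxE.
Qed.

End Avoidance.

(** * The action on polynomials, traces and averages *)

HB.lock Definition act (k : fieldType) (n : nat) (gT : finGroupType) (W : {group gT})
    (rW : mx_representation k W n) (g : gT) (p : {mpoly k[n]}) : {mpoly k[n]} :=
  mx_act (rW g) p.

Section Action.
Context (k : fieldType) (n : nat) (gT : finGroupType) (W : {group gT}).
Context (rW : mx_representation k W n).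
Implicit Types (p q : {mpoly k[n]}) (H : {group gT}).

Local Notation act := (act rW).

Lemma actE g p : act g p = mx_act (rW g) p. Proof. by rewrite unlock. Qed.

Fact act_is_linear g : linear (act g).
Proof. by move=> a p q; rewrite !actE linearP. Qed.
Fact act_is_monoid_morphism g : monoid_morphism (act g).
Proof. by split=> [|p q]; rewrite !actE ?rmorph1 ?rmorphM. Qed.
HB.instance Definition _ (g : gT) :=
  GRing.isLinear.Build k {mpoly k[n]} {mpoly k[n]} _ (act g) (act_is_linear g).
HB.instance Definition _ (g : gT) :=
  GRing.isMonoidMorphism.Build {mpoly k[n]} {mpoly k[n]} (act g) (act_is_monoid_morphism g).

Definition invariant (H : {set gT}) p := forall g, g \in H -> act g p = p.
Definition trace (H : {set gT}) p := \sum_(g in H) act g p.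

Lemma actM g h p : g \in W -> h \in W -> act (g * h)%g p = act g (act h p).
Proof. by move=> gW hW; rewrite 3!actE repr_mxM ?mx_actM. Qed.

Lemma act1 p : act 1%g p = p.
Proof. by rewrite actE repr_mx1 mx_act1. Qed.

Lemma actK g : g \in W -> cancel (act g) (act g^-1%g).
Proof. by move=> gW p; rewrite -actM ?groupV // mulVg act1. Qed.

Lemma actC g a : act g a%:MP = a%:MP. Proof. by rewrite actE mx_actC. Qed.

Lemma meval_act g p (v : 'rV[k]_n) : (act g p).@[v 0] = p.@[(v *m rW g) 0].
Proof. by rewrite actE meval_mx_act. Qed.

Lemma act_eq0 g p : g \in W -> (act g p == 0) = (p == 0).
Proof.
move=> gW; apply/eqP/eqP=> [E|->]; last by rewrite raddf0.
by rewrite -[p](actK gW) E raddf0.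
Qed.

Section Invariants.
Context (H : {group gT}) (sHW : H \subset W).

Lemma invariantC a : invariant H a%:MP. Proof. by move=> g _; rewrite actC. Qed.
Lemma invariant0 : invariant H 0. Proof. by move=> g _; rewrite raddf0. Qed.
Lemma invariant1 : invariant H 1. Proof. by move=> g _; rewrite rmorph1. Qed.
Lemma invariantD p q : invariant H p -> invariant H q -> invariant H (p + q).
Proof. by move=> pI qI g gH; rewrite raddfD /= pI ?qI. Qed.
Lemma invariantN p : invariant H p -> invariant H (- p).
Proof. by move=> pI g gH; rewrite raddfN /= pI. Qed.
Lemma invariantB p q : invariant H p -> invariant H q -> invariant H (p - q).
Proof. by move=> pI qI; apply: invariantD => //; apply: invariantN. Qed.
Lemma invariantM p q : invariant H p -> invariant H q -> invariant H (p * q).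
Proof. by move=> pI qI g gH; rewrite rmorphM /= pI ?qI. Qed.
Lemma invariantZ a p : invariant H p -> invariant H (a *: p).
Proof. by move=> pI g gH; rewrite linearZ /= pI. Qed.
Lemma invariantX p m : invariant H p -> invariant H (p ^+ m).
Proof. by move=> pI g gH; rewrite rmorphXn /= pI. Qed.
Lemma invariant_sum I (r : seq I) (P : pred I) (F : I -> {mpoly k[n]}) :
  (forall i, P i -> invariant H (F i)) -> invariant H (\sum_(i <- r | P i) F i).
Proof. by move=> FI g gH; rewrite raddf_sum; apply: eq_bigr => i /FI/(_ g gH). Qed.

Lemma trace_actl g p : g \in H -> act g (trace H p) = trace H p.
Proof.
move=> gH; rewrite /trace raddf_sum [RHS](reindex_inj (mulgI g)) /=.
apply: eq_big => [h|h hH]; first by rewrite groupMl.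
by rewrite actM ?(subsetP sHW).
Qed.

Lemma trace_invariant p : invariant H (trace H p).
Proof. by move=> g; apply: trace_actl. Qed.

Lemma trace_actr g p : g \in H -> trace H (act g p) = trace H p.
Proof.
move=> gH; rewrite /trace [RHS](reindex_inj (mulIg g)) /=.
apply: eq_big => [h|h hH]; first by rewrite groupMr.
by rewrite actM ?(subsetP sHW).
Qed.

Lemma traceMl p q : invariant H p -> trace H (p * q) = p * trace H q.
Proof.
move=> pI; rewrite /trace mulr_sumr; apply: eq_bigr => g gH.
by rewrite rmorphM /= pI.
Qed.

Lemma traceD p q : trace H (p + q) = trace H p + trace H q.
Proof. by rewrite /trace -big_split; apply: eq_bigr => g _; rewrite /= raddfD. Qed.

Lemma trace_sum I (r : seq I) (P : pred I) (F : I -> {mpoly k[n]}) :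
  trace H (\sum_(i <- r | P i) F i) = \sum_(i <- r | P i) trace H (F i).
Proof.
rewrite /trace [RHS]exchange_big; apply: eq_bigr => g _; exact: raddf_sum.
Qed.

Lemma trace_id p : invariant H p -> trace H p = #|H|%:R *: p.
Proof.
move=> pI; rewrite /trace -sumr_const scaler_suml.
by apply: eq_bigr => g /pI ->; rewrite scale1r.
Qed.

(** The Reynolds operator of H. *)
Definition mean p := #|H|%:R^-1 *: trace H p.

Lemma mean_invariant p : invariant H (mean p).
Proof. by apply: invariantZ; apply: trace_invariant. Qed.

Lemma mean_sum I (r : seq I) (P : pred I) (F : I -> {mpoly k[n]}) :
  mean (\sum_(i <- r | P i) F i) = \sum_(i <- r | P i) mean (F i).
Proof. by rewrite /mean trace_sum scaler_sumr. Qed.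

Lemma meanB p q : mean (p - q) = mean p - mean q.
Proof.
by rewrite /mean -scalerBr /trace -sumrB; congr (_ *: _); apply: eq_bigr => g _; exact: raddfB.
Qed.

Lemma meanMl p q : invariant H p -> mean (p * q) = p * mean q.
Proof. by move=> pI; rewrite /mean traceMl // scalerAr. Qed.

Lemma mean_id p : [pchar k] =i pred0 -> invariant H p -> mean p = p.
Proof.
move=> char0 pI; rewrite /mean trace_id // scalerA mulVf ?scale1r //.
by rewrite char0_natr_eq0 // -lt0n cardG_gt0.
Qed.

Lemma mean_ideal X p : mem_ideal X -> (forall g, g \in H -> X (act g p)) -> X (mean p).
Proof.
move=> iX Xp; rewrite /mean -mul_mpolyC; apply: idealMl => //; exact: ideal_sum.
Qed.

End Invariants.

Lemma invariantS (H K : {set gT}) p : H \subset K -> invariant K p -> invariant H p.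
Proof. by move=> /subsetP sHK pI g /sHK/pI. Qed.

End Action.
Arguments mean {k n gT W} rW H p.
Arguments actK {k n gT W rW g} gW p : rename.
Arguments actM {k n gT W rW g h} p gW hW : rename.
Arguments act_eq0 {k n gT W rW g} p gW : rename.
Arguments trace_invariant {k n gT W rW H} sHW p : rename.
Arguments trace_actl {k n gT W rW H} sHW {g} p gH : rename.
Arguments trace_actr {k n gT W rW H} sHW {g} p gH : rename.
Arguments mean_invariant {k n gT W rW H} sHW p : rename.

(** * Polynomials over B modulo an ideal, and orbit polynomials *)

Lemma horner_prod_XsubC_eq0 (R : comNzRingType) (I : eqType) (r : seq I) (P : pred I)
    (f : I -> R) i : i \in r -> P i -> (\prod_(j <- r | P j) ('X - (f j)%:P)).[f i] = 0.
Proof.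
move=> ir Pi; rewrite (big_rem i) //= Pi hornerM hornerXsubC.
by rewrite [X in X * _]subrr mul0r.
Qed.

Section PolyIdeal.
Context (R : comNzRingType) (X : R -> Prop) (iX : mem_ideal X).

Definition coef_ideal (q : {poly R}) := forall i, X q`_i.

Lemma coef_ideal_ideal : mem_ideal coef_ideal.
Proof.
split=> [i|a b aX bX i|c a aX i]; first by rewrite coef0; apply: ideal0.
  by rewrite coefD; apply: idealD.
by rewrite coefM; apply: ideal_sum => // j _; apply: idealMl.
Qed.

Lemma coef_ideal_horner q a : coef_ideal q -> X q.[a].
Proof. by move=> qX; rewrite horner_coef; apply: ideal_sum => // i _; apply: idealMr. Qed.

(** Since 'X - a is monic, the coefficients of q are recovered from the top down, the i-th from the
    coefficient of index i + 1 of the product and from that of q. *)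
Lemma coef_ideal_divXsubC q a : coef_ideal (q * ('X - a%:P)) -> coef_ideal q.
Proof.
move=> qX i; have [j] := ubnP (size q - i)%N; elim: j i => // j IH i.
rewrite ltnS => ij; have [iq|qi] := ltnP i (size q); last by rewrite nth_default //; apply: ideal0.
have: X (q * ('X - a%:P))`_i.+1 by [].
rewrite mulrBr coefB coefMX coefMC /= => Xi; rewrite -[q`_i](subrK (q`_i.+1 * a)).
apply: idealD => //; apply: idealMr => //; apply: IH.
by rewrite (leq_trans _ ij) // subnS prednK // subn_gt0.
Qed.

(** Evaluation at x puts q(x)(x - a) in the ideal, so after multiplication by q(x) the two linear
    factors agree and can be cancelled: q(x)(q - p) is in the ideal. A root z of p then gives the
    claim. This is what makes e orthogonal to its conjugates. *)
Lemma coef_ideal_split (p q : {poly R}) x a z :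
  coef_ideal (q * ('X - a%:P) - p * ('X - x%:P)) -> p.[z] = 0 -> X (q.[x] * q.[z]).
Proof.
move=> pqX pz; have iXX := coef_ideal_ideal.
have qxX : X (q.[x] * (x - a)).
  have := coef_ideal_horner x pqX.
  by rewrite hornerD hornerN !hornerM !hornerXsubC subrr mulr0 subr0.
suff /(coef_ideal_horner z): coef_ideal (q.[x]%:P * (q - p)).
  by rewrite hornerM hornerC hornerD hornerN pz subr0.
apply: (coef_ideal_divXsubC (a := a)).
have ->: q.[x]%:P * (q - p) * ('X - a%:P) =
    q.[x]%:P * (q * ('X - a%:P) - p * ('X - x%:P)) - p * (q.[x] * (x - a))%:P.
  by rewrite polyCM polyCB; ring.
apply: (idealB iXX); first exact: (idealMl _ iXX).
by move=> i; rewrite coefMC; apply: idealMl.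
Qed.

End PolyIdeal.

Section OrbitPolynomial.
Context (k : fieldType) (n : nat) (gT : finGroupType) (W : {group gT}).
Context (rW : mx_representation k W n) (G : {group gT}) (sGW : G \subset W).
Local Notation act := (act rW).
Local Notation invariant := (invariant rW).

Lemma act_inj g : g \in W -> injective (act g).
Proof. by move=> gW; apply: can_inj (actK gW). Qed.

Lemma coef_prod_invariant (s : seq {mpoly k[n]}) :
  (forall g, g \in G -> perm_eq [seq act g z | z <- s] s) ->
  forall i, invariant G (\prod_(z <- s) ('X - z%:P))`_i.
Proof.
move=> sP i g gG; rewrite -coef_map; congr ((_ : {poly _})`_i).
rewrite rmorph_prod -[RHS](perm_big _ (sP g gG)) big_map /=.
by apply: eq_bigr => z _; rewrite rmorphB /= map_polyX map_polyC.
Qed.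

(** Repetitions are removed so that x is a simple root of the orbit polynomial; a repeated root
    would make the cofactor of 'X - x vanish at x. *)
Definition orbit_seq (x : {mpoly k[n]}) := undup [seq act g x | g <- enum G].

Lemma orbit_seqP x z : reflect (exists2 g, g \in G & z = act g x) (z \in orbit_seq x).
Proof.
rewrite mem_undup; apply: (iffP mapP) => [[g]|[g]].
  by rewrite mem_enum; exists g.
by move=> gG ->; exists g; rewrite ?mem_enum.
Qed.

Lemma orbit_seq_id x : x \in orbit_seq x.
Proof. by apply/orbit_seqP; exists 1%g; rewrite ?act1. Qed.

Lemma orbit_seq_perm x g : g \in G -> perm_eq [seq act g z | z <- orbit_seq x] (orbit_seq x).
Proof.
move=> gG; have gW := subsetP sGW _ gG.
apply: uniq_perm; rewrite ?undup_uniq ?(map_inj_uniq (act_inj gW)) ?undup_uniq // => z.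
apply/mapP/idP=> [[y /orbit_seqP[h hG ->] ->]|/orbit_seqP[h hG ->]].
  by apply/orbit_seqP; exists (g * h)%g; rewrite ?groupM // actM // (subsetP sGW).
exists (act (g^-1 * h)%g x); first by apply/orbit_seqP; exists (g^-1 * h)%g; rewrite ?groupM ?groupV.
by rewrite -actM ?mulKVg // (subsetP sGW) // ?groupM ?groupV.
Qed.

Lemma conj_seq_perm x g : g \in G ->
  perm_eq [seq act g z | z <- [seq act h x | h <- enum G]] [seq act h x | h <- enum G].
Proof.
move=> gG.
have ->: [seq act g z | z <- [seq act h x | h <- enum G]] =
    [seq act h x | h <- [seq (g * h)%g | h <- enum G]].
  rewrite -!map_comp; apply/eq_in_map => h; rewrite mem_enum => hG.
  by rewrite /= actM // (subsetP sGW).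
apply: perm_map; apply: uniq_perm; rewrite ?(map_inj_uniq (mulgI g)) ?enum_uniq // => h.
rewrite mem_enum; apply/mapP/idP=> [[f]|hG].
  by rewrite mem_enum => fG ->; rewrite groupM.
by exists (g^-1 * h)%g; rewrite ?mulKVg // mem_enum groupM ?groupV.
Qed.

Lemma orbit_prod x :
  \prod_(z <- orbit_seq x) ('X - z%:P) =
    (\prod_(z <- orbit_seq x | z != x) ('X - z%:P)) * ('X - x%:P).
Proof. by rewrite (bigD1_seq x) ?orbit_seq_id ?undup_uniq //= mulrC. Qed.

End OrbitPolynomial.

(** * Comparison of two quotients near a point *)

Section Etale.
Context (k : fieldType) (char0 : [pchar k] =i pred0).
Context (n : nat) (gT : finGroupType) (W : {group gT}).
Context (rW : mx_representation k W n) (G : {group gT}) (sGW : G \subset W).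
Context (v : 'rV[k]_n) (K : {group gT}) (sKG : K \subset G).
Context (stabP : forall g, g \in G -> (v *m rW g == v) = (g \in K)).
Local Notation act := (act rW).
Local Notation invariant := (invariant rW).
Local Notation trace := (trace rW).
Implicit Types (p q c e : {mpoly k[n]}).

Definition vanishing (H : {set gT}) p := invariant H p /\ p.@[v 0] = 0.
Local Notation Q := (span_ideal (vanishing G)).

Let iQ : mem_ideal Q := span_ideal_ideal _.
Let sKW : K \subset W := subset_trans sKG sGW.

Lemma span_vanishing_meval p : Q p -> p.@[v 0] = 0.
Proof.
move: p; apply: (@span_ideal_ind _ _ (fun p => p.@[v 0] = 0)) => [|p []//].
split=> [|a b Ea Eb|c a Ea]; first by rewrite meval0.
  by rewrite mevalD Ea Eb addr0.
by rewrite mevalM Ea mulr0.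
Qed.

Lemma vanishing_sub r : invariant G r -> Q (r - (r.@[v 0])%:MP).
Proof.
move=> rI; apply: span_ideal_in; split; last by rewrite mevalB mevalC subrr.
by apply: invariantB => //; apply: invariantC.
Qed.

Lemma meval_stab g p : g \in K -> (act g p).@[v 0] = p.@[v 0].
Proof.
by move=> gK; rewrite meval_act; move: (stabP (subsetP sKG _ gK)); rewrite gK => /eqP->.
Qed.

(** Each of the other points of the orbit of v is a zero of an affine coordinate that is nonzero at
    v. The product of these is made invariant by multiplying its translates under K, and it stays
    nonzero at v because K fixes v. *)
Lemma separating_invariant : exists2 x, invariant K x &
  forall g, g \in G -> g \notin K -> (act g x).@[v 0] != x.@[v 0].
Proof.
have ex_l g : exists l : {mpoly k[n]},
    g \in G :\: K -> l.@[v 0] != 0 /\ l.@[(v *m rW g) 0] = 0.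
  have [/setDP[gG]|_] := boolP (g \in G :\: K); last by exists 0.
  rewrite -stabP // => vg; have /rV0Pn[i] : v - v *m rW g != 0 by rewrite subr_eq0 eq_sym.
  rewrite !mxE => vi; exists ('X_i - ((v *m rW g) 0 i)%:MP) => _.
  by rewrite !mevalB !mevalXU !mevalC subrr [X in _ - X]mxE; split.
have [l lP] := choice ex_l.
pose y := \prod_(g in G :\: K) l g; pose x := \prod_(h in K) act h y.
have yv : y.@[v 0] != 0.
  by rewrite rmorph_prod; apply/prodf_neq0 => g gGK /=; case: (lP g gGK).
have yg g : g \in G :\: K -> y.@[(v *m rW g) 0] = 0.
  by move=> gGK; rewrite /y (bigD1 g) //= mevalM; case: (lP g gGK) => _ ->; rewrite mul0r.
exists x => [h hK|g gG gK].
  rewrite /x rmorph_prod [RHS](reindex_inj (mulgI h)) /=.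
  apply: eq_big => [f|f fK]; first by rewrite groupMl.
  by rewrite actM ?(subsetP sKW).
have ->: (act g x).@[v 0] = 0.
  rewrite meval_act /x (bigD1 1%g) //= act1 mevalM yg ?mul0r //.
  by rewrite inE gK.
rewrite eq_sym rmorph_prod; apply/prodf_neq0 => h hK /=.
by rewrite meval_stab.
Qed.

(* The quotient maps by K and by G agree near v: e is an idempotent modulo Q
   which isolates the point v in the fibre of the quotient by G. *)
Lemma etale_idempotent : exists e,
  [/\ invariant K e, e.@[v 0] = 1 & forall g, g \in G -> g \notin K -> Q (e * act g e)].
Proof.
have [x xK xsep] := separating_invariant.
have [P1 P1E] : exists P1 : {poly {mpoly k[n]}}, P1 = \prod_(z <- orbit_seq rW G x | z != x) ('X - z%:P) by eexists.
have PI i : invariant G (P1 * ('X - x%:P))`_i.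
  rewrite P1E -orbit_prod; apply: coef_prod_invariant => // g gG.
  exact: orbit_seq_perm.
pose ev : {rmorphism {mpoly k[n]} -> {mpoly k[n]}} := @mpolyC n k \o meval (v 0).
have [p1 p1E] : exists p1 : {poly {mpoly k[n]}}, p1 = map_poly ev P1 by eexists.
(* The orbit polynomial of x has G-invariant coefficients, and an invariant equals its value at v
   modulo Q. Splitting off the root x on one side and x(v) on the other gives the hypothesis of
   [coef_ideal_split]. *)
have PpQ : coef_ideal Q (p1 * ('X - (x.@[v 0])%:MP%:P) - P1 * ('X - x%:P)).
  have ->: p1 * ('X - (x.@[v 0])%:MP%:P) = map_poly ev (P1 * ('X - x%:P)).
    by rewrite rmorphM rmorphB /= map_polyX map_polyC p1E.
  move=> i; rewrite coefB coef_map; apply: mem_ideal_sym => //; exact: vanishing_sub.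
have [e0 e0E] : exists e0, e0 = p1.[x] by eexists.
(* The coefficients of p1 are constants, so g acts on e0 = p1(x) through x alone. *)
have acte0 g : act g e0 = p1.[act g x].
  rewrite e0E -horner_map; congr (_.[_]).
  by apply/polyP => i; rewrite p1E !coef_map /= actC.
have P1x z : z \in orbit_seq rW G x -> z != x -> P1.[z] = 0.
  by move=> zx zNx; rewrite P1E; exact: (horner_prod_XsubC_eq0 id zx).
have e0v : e0.@[v 0] != 0.
  have ->: e0.@[v 0] = (P1.[(x.@[v 0])%:MP]).@[v 0].
    rewrite e0E -!(horner_map (meval (v 0))) /= mevalC; congr (_.[_]).
    by apply/polyP => i; rewrite p1E !coef_map /= mevalC.
  rewrite P1E horner_prod rmorph_prod /= prodf_seq_neq0; apply/allP => z.
  move=> /orbit_seqP[g gG ->]; apply/implyP => zx.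
  rewrite hornerXsubC mevalB mevalC subr_eq0 eq_sym; apply: xsep => //.
  by apply: contra zx => gK; rewrite xK.
have e0act g : g \in G -> g \notin K -> Q (e0 * act g e0).
  move=> gG gK; rewrite acte0 e0E; apply: (coef_ideal_split iQ PpQ); apply: P1x.
    by apply/orbit_seqP; exists g.
  by apply: contraNneq (xsep g gG gK) => ->.
exists ((e0.@[v 0])^-1 *: e0); split.
- by apply: invariantZ => g gK; rewrite acte0 xK.
- by rewrite mevalZ mulVf.
move=> g gG gK; rewrite linearZ /= -!mul_mpolyC mulrACA; apply: idealMl => //; exact: e0act.
Qed.

Lemma natr_card_neq0 (H : {group gT}) : #|H|%:R != 0 :> k.
Proof. by rewrite char0_natr_eq0 // -lt0n cardG_gt0. Qed.

Section Idempotent.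
Context e (eK : invariant K e) (ev : e.@[v 0] = 1).
Context (eQ : forall g, g \in G -> g \notin K -> Q (e * act g e)).

Lemma etale_vanish g : g \in G -> g \notin K -> (act g e).@[v 0] = 0.
Proof.
by move=> gG gK; have := span_vanishing_meval (eQ gG gK); rewrite mevalM ev mul1r.
Qed.

Lemma trace_split p : trace G p = trace K p + \sum_(g in G :\: K) act g p.
Proof.
rewrite /trace (bigID (mem K)) /=; congr (_ + _); apply: eq_bigl => g.
  by rewrite andb_idl // => /(subsetP sKG).
by rewrite inE andbC.
Qed.

(** At v, only the terms of the trace with g in K survive, since e vanishes at the other points of
    the orbit. *)
Lemma etale_transfer c : invariant K c -> (trace G (e * c)).@[v 0] = #|K|%:R * c.@[v 0].
Proof.
move=> cK; rewrite trace_split trace_id; last exact: invariantM.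
rewrite mevalD mevalZ mevalM ev mul1r raddf_sum big1 ?addr0 //= => g /setDP[gG gK].
by rewrite rmorphM /= mevalM etale_vanish ?mul0r.
Qed.

(** The trace of e c is congruent modulo Q to its value at v. After multiplication by e its terms
    outside K fall into Q, and those in K give [#|K|] times e e c. *)
Lemma etale_local2 c : invariant K c -> Q (e * (e * c) - c.@[v 0] *: e).
Proof.
move=> cK; pose T := trace G (e * c).
have TQ := vanishing_sub (trace_invariant sGW (e * c)).
rewrite -/T etale_transfer // in TQ.
have E : #|K|%:R%:MP * (e * (e * c) - c.@[v 0] *: e) =
   e * (T - (#|K|%:R * c.@[v 0])%:MP) - \sum_(g in G :\: K) (e * act g e) * act g c.
  have <- : e * \sum_(g in G :\: K) act g (e * c) =
      \sum_(g in G :\: K) (e * act g e) * act g c.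
    by rewrite mulr_sumr; apply: eq_bigr => g _; rewrite rmorphM mulrA.
  rewrite /T trace_split trace_id; last exact: invariantM.
  by rewrite -!mul_mpolyC mpolyCM; ring.
have ->: e * (e * c) - c.@[v 0] *: e =
   (#|K|%:R^-1)%:MP * (#|K|%:R%:MP * (e * (e * c) - c.@[v 0] *: e)).
  by rewrite [RHS]mulrA -mpolyCM mulVf ?natr_card_neq0 // mpolyC1 mul1r.
apply: idealMl => //; rewrite E; apply: idealB => //; first exact: idealMl.
apply: ideal_sum => // g /setDP[gG gK]; apply: idealMr => //; exact: eQ.
Qed.

(** The case c = 1 of [etale_local2] says that e is idempotent modulo Q, which removes one of the
    two factors e. In particular, e carries the K-invariants vanishing at v into Q. *)
Lemma etale_local c : invariant K c -> Q (e * c - c.@[v 0] *: e).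
Proof.
move=> cK; have ->: e * c - c.@[v 0] *: e =
    (e * (e * c) - c.@[v 0] *: e) - c * (e * (e * 1) - 1 *: e) by rewrite scale1r; ring.
apply: idealB (etale_local2 cK) _ => //; apply: idealMl => //.
have := etale_local2 (@invariant1 _ _ _ _ rW K).
by rewrite rmorph1.
Qed.

End Idempotent.

(** Averaging over K leaves the G-invariant factors alone and makes their coefficients
    K-invariant. *)
Lemma mean_span p : Q p -> product_span (vanishing G) (invariant K) (mean rW K p).
Proof.
move: p; apply: ps_ind => [|a b|p q [pI pv] _].
- by rewrite /mean /trace big1 ?scaler0; [exact: ps0 | move=> g _; rewrite raddf0].
- by rewrite /mean traceD scalerDr; exact: psD.
rewrite meanMl; last exact: invariantS pI.
by apply: psI; [split | exact: mean_invariant].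
Qed.

Lemma span_vanishing_mean p : invariant K p -> Q p ->
  product_span (vanishing G) (invariant K) p.
Proof. by move=> pK /mean_span; rewrite mean_id. Qed.

(** Injectivity of the cotangent map at v. Write m_G and m_K for the invariants vanishing at v.
    Multiplication by e moves each factor of a product in m_K^2 into m_G B^K, so e^2 b is in m_G^2
    B^K. Its trace is b t, with t the trace of e^2, and lies in m_G^2; as t(v) is nonzero, b - b t /
    t(v) is a product of two elements of m_G. *)
Lemma etale_square b : invariant G b ->
  product_span (vanishing K) (vanishing K) b -> product_span (vanishing G) (vanishing G) b.
Proof.
move=> bG bK2; have [e [eK ev eQ]] := etale_idempotent.
pose M2 := product_span (vanishing G) (vanishing G).
have e2b : product_span M2 (invariant K) (e * (e * b)).
  move: b bK2 {bG}; apply: ps_ind => [|a b|p q [pK pv] [qK qv]].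
  - by rewrite !mulr0; exact: ps0.
  - by rewrite !mulrDr; exact: psD.
  have pe := span_vanishing_mean (invariantM eK pK) _.
  have qe := span_vanishing_mean (invariantM eK qK) _.
  have ->: e * (e * (p * q)) = (e * p) * (e * q) by ring.
  have {}pe : product_span (vanishing G) (invariant K) (e * p).
    by apply: pe; have := etale_local eK ev eQ pK; rewrite pv scale0r subr0.
  have {}qe : product_span (vanishing G) (invariant K) (e * q).
    by apply: qe; have := etale_local eK ev eQ qK; rewrite qv scale0r subr0.
  move: (e * p) pe; apply: ps_ind => [|a1 a2|r1 c1 r1G c1K].
  - by rewrite mul0r; exact: ps0.
  - by rewrite mulrDl; exact: psD.
  move: (e * q) qe; apply: ps_ind => [|a1 a2|r2 c2 r2G c2K].
  - by rewrite mulr0; exact: ps0.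
  - by rewrite mulrDr; exact: psD.
  rewrite mulrACA; apply: psI; [exact: psI | exact: invariantM].
have tr_e2b : M2 (trace G (e * (e * b))).
  move: e2b; move: (e * (e * b)); apply: ps_ind => [|a1 a2|r c rM cK].
  - by rewrite /trace big1; [exact: ps0 | move=> g _; rewrite raddf0].
  - by rewrite traceD; exact: psD.
  have rG : invariant G r.
    move: r rM; apply: ps_ind; [exact: invariant0 | exact: invariantD | ].
    by move=> p q [pG _] [qG _]; apply: invariantM.
  rewrite traceMl //; move: r rM {rG}; apply: ps_ind => [|a1 a2|p q pG [qG qv]].
  - by rewrite mul0r; exact: ps0.
  - by rewrite mulrDl; exact: psD.
  rewrite -mulrA; apply: psI => //; split; last by rewrite mevalM qv mul0r.
  by apply: invariantM => //; apply: trace_invariant.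
have bv : b.@[v 0] = 0.
  move: b bK2 {bG e2b tr_e2b}; apply: (@ps_ind _ _ _ (fun b => b.@[v 0] = 0)).
  - by rewrite meval0.
  - by move=> a b ea eb; rewrite mevalD ea eb addr0.
  by move=> p q [_ pv] _; rewrite mevalM pv mul0r.
have tG := trace_invariant sGW (e * e); set t := trace G (e * e) in tG.
have tv : t.@[v 0] = #|K|%:R by rewrite /t etale_transfer // ev mulr1.
have Et : trace G (e * (e * b)) = b * t by rewrite mulrA mulrC traceMl.
have ->: b = (#|K|%:R^-1)%:MP * (b * t) + (b * (1 - (#|K|%:R^-1)%:MP * t)) by ring.
rewrite -Et; apply: psD.
  move: (trace G _) tr_e2b; apply: ps_ind => [|a1 a2|p q [pG pv] qG].
  - by rewrite mulr0; exact: ps0.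
  - by rewrite mulrDr; exact: psD.
  rewrite mulrA; apply: psI => //; split; last by rewrite mevalM pv mulr0.
  by apply: invariantM => //; apply: invariantC.
apply: psI; first by split.
split; first by apply: invariantB; [exact: invariant1 | apply: invariantM => //; exact: invariantC].
by rewrite mevalB meval1 mevalM mevalC tv mulVf ?subrr // natr_card_neq0.
Qed.

End Etale.

(** * Gradings *)

Section Grading.
Context (k : fieldType) (n : nat) (d : 'I_n -> nat).
Local Notation B := {mpoly k[n]}.
Implicit Types (p q : B) (m : 'X_{1..n}).

(* The coaction of the multiplicative group. *)
Definition grade : B -> {poly B} :=
  mmap (@polyC B \o @mpolyC n k) (fun i => ('X_i)%:P * 'X^(d i)).
HB.instance Definition _ := GRing.RMorphism.copy grade
  (mmap (@polyC B \o @mpolyC n k) (fun i => ('X_i)%:P * 'X^(d i))).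

Definition component e p : B := (grade p)`_e.

Lemma gradeC c : grade c%:MP = (c%:MP)%:P.
Proof. by rewrite /grade mmapC. Qed.

Lemma gradeXU i : grade 'X_i = ('X_i)%:P * 'X^(d i).
Proof. by rewrite /grade mmapX mmap1U. Qed.

Lemma gradeX m : grade 'X_[m] = ('X_[m])%:P * 'X^(weight d m).
Proof.
rewrite /grade mmapX /mmap1 mpolyXE_id rmorph_prod /= /weight -prodrXr -big_split.
by apply: eq_bigr => i _; rewrite exprMn -exprM rmorphXn.
Qed.

Lemma gradeE p : grade p = \sum_(m <- msupp p) (p@_m *: 'X_[m])%:P * 'X^(weight d m).
Proof.
rewrite [in LHS](mpolyE p) raddf_sum; apply: eq_bigr => m _ /=.
by rewrite -mul_mpolyC rmorphM /= gradeC gradeX mulrA polyCM.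
Qed.

Lemma mcoeff_component e p m : (component e p)@_m = if weight d m == e then p@_m else 0.
Proof.
rewrite /component gradeE coef_sum raddf_sum /=.
under eq_bigr do rewrite coefCM coefXn mulr_natr raddfMn /= mcoeffZ mcoeffX.
have [mp|mNp] := boolP (m \in msupp p); last first.
  rewrite (memN_msupp_eq0 mNp) if_same big_seq big1 // => m' m'p.
  case: eqP m'p => [->|_ _]; first by rewrite (negbTE mNp).
  by rewrite mulr0 mul0rn.
rewrite (bigD1_seq m) ?msupp_uniq //= eqxx mulr1 big1 => [|m' /negbTE->].
  by rewrite addr0 eq_sym; case: eqP; rewrite ?mulr1n ?mulr0n.
by rewrite mulr0 mul0rn.
Qed.

Lemma componentD e p q : component e (p + q) = component e p + component e q.
Proof. by rewrite /component rmorphD coefD. Qed.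

Lemma component0 e : component e 0 = 0.
Proof. by rewrite /component rmorph0 coef0. Qed.

Lemma component_sum e I (r : seq I) (P : pred I) (F : I -> B) :
  component e (\sum_(i <- r | P i) F i) = \sum_(i <- r | P i) component e (F i).
Proof. by rewrite /component rmorph_sum coef_sum. Qed.

Lemma componentZ e c p : component e (c *: p) = c *: component e p.
Proof. by rewrite /component -!mul_mpolyC rmorphM /= gradeC coefCM. Qed.

Lemma componentM e p q :
  component e (p * q) = \sum_(i < e.+1) component i p * component (e - i) q.
Proof. by rewrite /component rmorphM coefM. Qed.

Lemma homogeneous_component e p : homogeneous d e (component e p).
Proof.
move=> m; rewrite mcoeff_msupp mcoeff_component.
by case: (weight d m =P e) => // _; rewrite eqxx.
Qed.

Lemma component_homogeneous e e' p : homogeneous d e p ->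
  component e' p = if e == e' then p else 0.
Proof.
move=> ph; apply/mpolyP => m; rewrite mcoeff_component.
have [/ph->|/memN_msupp_eq0 pm] := boolP (m \in msupp p); first by case: eqP => // _; rewrite mcoeff0.
by rewrite pm if_same; case: eqP; rewrite ?mcoeff0 ?pm.
Qed.

Lemma homogeneousP e p : homogeneous d e p <-> grade p = p%:P * 'X^e.
Proof.
split=> [ph|E].
  apply/polyP => i; rewrite coefCM coefXn -/(component i p) (component_homogeneous _ ph) eq_sym.
  by case: eqP; rewrite ?mulr1 ?mulr0.
suff ->: p = component e p by apply: homogeneous_component.
by rewrite /component E coefCM coefXn eqxx mulr1.
Qed.

Lemma component_mul_homogeneous e f p q : homogeneous d e q ->
  component f (p * q) = if (e <= f)%N then component (f - e) p * q else 0.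
Proof.
move=> /homogeneousP qh; rewrite /component rmorphM /= qh mulrA coefMXn coefMC ltnNge.
by case: leqP.
Qed.

Lemma homogeneous0 e : homogeneous d e (0 : B).
Proof. by move=> m; rewrite msupp0. Qed.

Lemma homogeneousD e p q : homogeneous d e p -> homogeneous d e q -> homogeneous d e (p + q).
Proof. by move=> /homogeneousP hp /homogeneousP hq; apply/homogeneousP; rewrite rmorphD /= hp hq polyCD mulrDl. Qed.

Lemma homogeneousZ e c p : homogeneous d e p -> homogeneous d e (c *: p).
Proof.
move=> /homogeneousP hp; apply/homogeneousP.
by rewrite -mul_mpolyC rmorphM /= gradeC hp polyCM mulrA.
Qed.

Lemma homogeneous_sum e I (r : seq I) (P : pred I) (F : I -> B) :
  (forall i, P i -> homogeneous d e (F i)) -> homogeneous d e (\sum_(i <- r | P i) F i).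
Proof. by move=> hF; apply: big_ind => //; [exact: homogeneous0 | exact: homogeneousD]. Qed.

Lemma homogeneousXU i : homogeneous d (d i) ('X_i : B).
Proof. by apply/homogeneousP; rewrite gradeXU. Qed.

Lemma sum_component p : p = \sum_(e < size (grade p)) component e p.
Proof.
have: (horner_eval 1 \o grade) p = idfun p.
  apply: (@mpoly_rmorph_eq k n _ (horner_eval 1 \o grade) idfun) => [c|i] /=.
    by rewrite gradeC /horner_eval hornerC.
  by rewrite gradeXU /horner_eval hornerM hornerC hornerXn expr1n mulr1.
rewrite /= /horner_eval horner_coef => E; rewrite -[LHS]E.
by apply: eq_bigr => i _; rewrite expr1n mulr1.
Qed.

Definition graded_pred (Y : B -> Prop) := forall e p, Y p -> Y (component e p).

(** The common form of the graded Nakayama arguments below: only homogeneous elements matter, and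
    all smaller weights may be assumed. *)
Lemma graded_ind (Y X : B -> Prop) : graded_pred Y -> X 0 ->
    (forall p q, X p -> X q -> X (p + q)) ->
    (forall e p, homogeneous d e p -> Y p ->
       (forall e' p', (e' < e)%N -> homogeneous d e' p' -> Y p' -> X p') -> X p) ->
  forall p, Y p -> X p.
Proof.
move=> gY X0 XD IH p Yp; rewrite [p]sum_component.
apply: big_ind => // e0 _; move: (gY e0 _ Yp) (@homogeneous_component e0 p).
move: (component e0 p) => q; move: (e0 : nat) => e {e0 p Yp}.
elim/ltn_ind: e q => e IHe q Yq hq; apply: (IH e) => // e' p' lt h' Y'.
exact: IHe h'.
Qed.

(** As P has no part of weight 0, the factor taken from Q has weight less than e: this is the
    descent that [graded_ind] needs. *)
Lemma ps_component (P Q X : B -> Prop) e : graded_pred P -> graded_pred Q ->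
    (forall p, P p -> component 0 p = 0) -> X 0 ->
    (forall p q, X p -> X q -> X (p + q)) ->
    (forall i j p q, (0 < i)%N -> (i + j)%N = e -> homogeneous d i p -> homogeneous d j q ->
       P p -> Q q -> X (p * q)) ->
  forall b, product_span P Q b -> X (component e b).
Proof.
move=> gP gQ P0 X0 XD XM; apply: ps_ind; first by rewrite component0.
  by move=> a b Xa Xb; rewrite componentD; apply: XD.
move=> p q Pp Qq; rewrite componentM; apply: big_ind => // [[[|i] le_ie]] _.
  by rewrite (P0 _ Pp) mul0r.
apply: (XM i.+1 (e - i.+1)%N) => //; [exact: subnKC | | | exact: gP | exact: gQ];
  exact: homogeneous_component.
Qed.

Section PositiveWeights.
Context (d_gt0 : forall i, (0 < d i)%N).

Lemma weight_eq0 m : (weight d m == 0)%N = (m == 0%MM).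
Proof.
rewrite /weight sum_nat_eq0; apply/forallP/eqP => [m0|-> i]; last by rewrite mnm0E muln0.
by apply/mnmP => i; move: (m0 i); rewrite mnm0E /= muln_eq0 eqn0Ngt d_gt0 /= => /eqP.
Qed.

Lemma component0E p : component 0 p = (p@_0)%:MP.
Proof.
apply/mpolyP => m; rewrite mcoeff_component weight_eq0 mcoeffC.
by case: eqP => [->|_]; rewrite ?mulr1 ?mulr0.
Qed.

Lemma meval0E p : p.@[fun=> 0] = p@_0.
Proof.
have E : (@mpolyC n k \o meval (fun=> 0)) p = (coefp 0 \o grade) p.
  apply: (@mpoly_rmorph_eq k n _ (@mpolyC n k \o meval (fun=> 0)) (coefp 0 \o grade)) => [c|i].
    by rewrite /= mevalC gradeC coefC.
  by rewrite /= mevalXU gradeXU coefCM coefXn [0%N == _]eq_sym eqn0Ngt d_gt0 mulr0 mpolyC0.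
by move: E; rewrite /= -/(component 0 p) component0E; exact: (can_inj (@mpolyCK n k)).
Qed.

Lemma positive_partP p : positive_part d p <-> p.@[fun=> 0] = 0.
Proof.
rewrite meval0E; split=> [pp|p0 m mp].
  by apply/eqP; rewrite mcoeff_eq0; apply/negP => /pp; rewrite lt0n weight_eq0 eqxx.
by rewrite lt0n weight_eq0; apply: contraTneq mp => ->; rewrite mcoeff_msupp p0 eqxx.
Qed.

Lemma positive_component0 p : p.@[fun=> 0] = 0 -> component 0 p = 0.
Proof. by rewrite meval0E component0E => ->; rewrite mpolyC0. Qed.

Lemma meval0_component e p : p.@[fun=> 0] = 0 -> (component e p).@[fun=> 0] = 0.
Proof. by rewrite !meval0E mcoeff_component => ->; rewrite if_same. Qed.

Lemma homogeneous_meval0 e p : (0 < e)%N -> homogeneous d e p -> p.@[fun=> 0] = 0.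
Proof.
move=> e0 ph; apply/positive_partP => m /ph->; exact: e0.
Qed.

End PositiveWeights.

End Grading.

Section GradedMorphism.
Context (k : fieldType) (n m : nat) (d : 'I_n -> nat) (c : 'I_m -> nat).
Context (f : {lrmorphism {mpoly k[m]} -> {mpoly k[n]}}).
Context (fX : forall j, homogeneous d (c j) (f 'X_j)).

Lemma lrmorph_mpolyC a : f a%:MP = a%:MP.
Proof. by rewrite -[a%:MP]mulr1 mul_mpolyC linearZ rmorph1 /= -mul_mpolyC mulr1. Qed.

Lemma component_morph e p : component d e (f p) = f (component c e p).
Proof.
suff E : grade d (f p) = map_poly f (grade c p) by rewrite /component E coef_map.
apply: (@mpoly_rmorph_eq k m _ (grade d \o f) (map_poly f \o grade c)) => [a|j] /=.
  by rewrite !gradeC map_polyC /= lrmorph_mpolyC gradeC.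
rewrite gradeXU rmorphM /= map_polyC /= map_polyXn.
by apply/homogeneousP.
Qed.

End GradedMorphism.

Section GradedAction.
Context (k : fieldType) (char0 : [pchar k] =i pred0) (n : nat) (d : 'I_n -> nat).

(** The single value t = 2 suffices, its powers being distinct in characteristic 0. *)
Lemma graded_mx_wt (A : 'M[k]_n) i j : graded_mx d A -> A i j != 0 -> d i = d j.
Proof.
move=> gA Aij; have two0 : 2%:R != 0 :> k by rewrite char0_natr_eq0.
have /matrixP/(_ i j) := gA _ two0.
rewrite /grading_action mul_mx_diag mul_diag_mx !mxE mulrC => /(mulIf Aij)/eqP.
rewrite -!natrX => /eqP/(char0_natr_inj char0)/eqP; rewrite eqn_exp2l // => /eqP; exact: esym.
Qed.

Lemma component_mx_act (A : 'M[k]_n) e p : graded_mx d A ->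
  component d e (mx_act A p) = mx_act A (component d e p).
Proof.
move=> gA; apply: (@component_morph k n n d d (mx_act A)) => j.
rewrite /= mx_actX; apply: homogeneous_sum => i _.
have [->|Aij] := eqVneq (A i j) 0; first by rewrite scale0r; exact: homogeneous0.
rewrite -(graded_mx_wt gA Aij); apply: homogeneousZ; exact: homogeneousXU.
Qed.

End GradedAction.
Global Opaque grade component.

(** * Linear algebra and degrees *)

Section LinearAlgebra.
Context (k : fieldType).

(** Among the matrices with rows in S, one of maximal rank spans S. *)
Lemma subspace_mx p (S : 'rV[k]_p -> Prop) : S 0 ->
    (forall a u v, S u -> S v -> S (a *: u + v)) ->
  exists M : 'M[k]_p, forall c, S c <-> (c <= M)%MS.
Proof.
move=> S0 SL.
have Smx q (M : 'M_(q, p)) c : (forall i, S (row i M)) -> (c <= M)%MS -> S c.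
  move=> SM /submxP[D ->]; rewrite mulmx_sum_row.
  apply: (big_ind S) => // [u v Su Sv|i _]; first by rewrite -[u]scale1r; apply: SL.
  by rewrite -[X in S X]addr0; apply: SL.
pose ok r := `[< exists M : 'M_p, (forall i, S (row i M)) /\ \rank M = r >].
have ex_ok : exists r, ok r.
  by exists 0%N; apply/asboolP; exists 0; rewrite mxrank0; split=> // i; rewrite row0.
have ub_ok r : ok r -> (r <= p)%N.
  by case/asboolP=> M [_ <-]; apply: rank_leq_row.
have [r /asboolP[M [SM rM]] maxr] := ex_maxnP ex_ok ub_ok.
exists M => c; split=> [Sc|]; last exact: Smx.
have: (\rank (M + c)%MS <= r)%N.
  apply: maxr; apply/asboolP; exists (M + c)%MS; split=> // i.
  have /sub_addsmxP[[D1 D2] /= ->] := row_sub i (M + c)%MS.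
  rewrite [D2]mx11_scalar mul_scalar_mx addrC; apply: SL => //.
  exact: Smx (submxMl _ _).
rewrite -rM => le_r; apply: submx_trans (addsmxSr M c) _.
by rewrite -(geq_leqif (mxrank_leqif_sup (addsmxSl M c))).
Qed.

Lemma rank1_mx m n (M : 'M[k]_(m, n)) : \rank M = 1%N ->
  exists c : 'cV[k]_m, exists r : 'rV[k]_n, M = c *m r.
Proof.
move=> rM; have /rowV0Pn[r rM' r0] : M != 0 by rewrite -mxrank_eq0 rM.
have: (M <= r)%MS.
  by rewrite -(geq_leqif (mxrank_leqif_sup rM')) rM lt0n mxrank_eq0.
by case/submxP=> D ->; exists D, r.
Qed.

(* A basis of the span of s modulo the subspace J, without forming the quotient. *)
Lemma basis_mod (V : lmodType k) (J : V -> Prop) (s : seq V) : J 0 ->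
    (forall a u v, J u -> J v -> J (a *: u + v)) ->
  exists p, exists b : 'I_p -> V, [/\ forall i, b i \in s,
    forall c : 'I_p -> k, J (\sum_i c i *: b i) -> forall i, c i = 0 &
    forall x, x \in s -> exists c : 'I_p -> k, J (x - \sum_i c i *: b i)].
Proof.
move=> J0 JL; elim: s => [|x s [p [b [bs bfree bspan]]]].
  by exists 0%N, (fun=> 0); split=> // [[]|? _ []].
have [[c Jc]|xfree] := pselect (exists c : 'I_p -> k, J (x - \sum_i c i *: b i)).
  exists p, b; split=> // [i|y]; first by rewrite inE bs orbT.
  by rewrite inE => /predU1P[->|/bspan]; first by exists c.
exists p.+1, (fun i => if unlift ord0 i is Some j then b j else x); split=> [i|c|y].
- by case: unliftP => [j _|_]; rewrite inE ?bs ?orbT ?eqxx.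
- rewrite big_ord_recl unlift_none; under eq_bigr do rewrite liftK.
  move=> Jc; have c0 : c ord0 = 0.
    apply/eqP/negP => /negP c0; case: xfree.
    exists (fun i => - (c ord0)^-1 * c (lift ord0 i)).
    have := JL (c ord0)^-1 _ 0 Jc J0; rewrite addr0 scalerDr scalerA mulVf // scale1r.
    congr (J (_ + _)); rewrite -sumrN scaler_sumr; apply: eq_bigr => i _.
    by rewrite scalerA mulNr scaleNr opprK.
  move: Jc; rewrite c0 scale0r add0r => /bfree cl i.
  by case: (unliftP ord0 i) => [j ->|->].
rewrite inE => /predU1P[->|/bspan[c Jc]].
  exists (fun i => (i == ord0)%:R); rewrite big_ord_recl unlift_none eqxx scale1r.
  by rewrite big1 ?addr0 ?subrr // => i _; rewrite eq_sym (negbTE (neq_lift _ _)) scale0r.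
exists (fun i => if unlift ord0 i is Some j then c j else 0).
rewrite big_ord_recl !unlift_none scale0r add0r.
by under eq_bigr do rewrite !liftK.
Qed.

Lemma meval_row0 n (p : {mpoly k[n]}) : p.@[(0 : 'rV[k]_n) 0] = p.@[fun=> 0].
Proof. by apply: meval_eq => i; rewrite mxE. Qed.

End LinearAlgebra.

Lemma generated_ind (gT : finGroupType) (A : {set gT}) (P : gT -> Prop) : P 1%g ->
    (forall g h, g \in A -> h \in <<A>>%g -> P h -> P (g * h)%g) ->
  forall g, g \in <<A>>%g -> P g.
Proof.
move=> P1 PM g /gen_prodgP[m [c cA ->]].
elim: m c cA => [|m IH] c cA; first by rewrite big_ord0.
rewrite big_ord_recl; apply: PM => //; last exact: IH.
by apply: group_prod => i _; apply: mem_gen.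
Qed.

Section Size.
Context (k : fieldType) (char0 : [pchar k] =i pred0) (n : nat).
Implicit Types p : {mpoly k[n]}.

(** Total degree is the grading with all weights 1, for which every matrix is graded. *)
Lemma msize_mx_act (A : 'M[k]_n) p : (msize (mx_act A p) <= msize p)%N.
Proof.
pose d (i : 'I_n) := 1%N.
have wE m : weight d m = mdeg m by rewrite /weight mdegE; apply: eq_bigr => i _; rewrite mul1n.
have gA : graded_mx d A.
  move=> t _; rewrite /grading_action.
  have ->: diag_mx (\row_i t ^+ d i) = t%:M by apply/matrixP => i j; rewrite !mxE expr1.
  by rewrite /comm_mx mul_mx_scalar mul_scalar_mx.
rewrite [msize (mx_act A p)]msizeE; apply/bigmax_leqP_seq => m mA _; rewrite leqNgt ltnS; apply/negP => le_pm.
have: (component d (mdeg m) (mx_act A p))@_m = 0.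
  rewrite component_mx_act //.
  have ->: component d (mdeg m) p = 0.
    apply/mpolyP => m'; rewrite mcoeff_component wE mcoeff0; case: eqP => // E.
    by apply/eqP; rewrite mcoeff_eq0 msize_mdeg_ge // E.
  by rewrite raddf0 mcoeff0.
rewrite mcoeff_component wE eqxx => /eqP; rewrite mcoeff_eq0.
by rewrite mA.
Qed.

Lemma msize_mul_lin (c : 'cV[k]_n) q N : c != 0 -> (msize (q * lin c) <= N.+1)%N -> (msize q <= N)%N.
Proof.
move=> c0; have [->|q0] := eqVneq q 0; first by rewrite msize0.
have l0 : lin c != 0 by rewrite lin_eq0.
rewrite msizeM //; have [i [z]] := matrix0Pn _ c0; rewrite (ord1 z) => ci.
have: (1 < msize (lin c))%N.
  rewrite -(mdeg1 i); apply: msize_mdeg_lt.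
  by rewrite mcoeff_msupp mcoeff_lin.
case: (msize (lin c)) => [|[|m]] // _; rewrite !addnS /= ltnS.
exact: leq_trans (leq_addr _ _).
Qed.

End Size.

(** * Freeness over the invariants of a reflection group *)

Section Chevalley.
Context (k : fieldType) (char0 : [pchar k] =i pred0) (n : nat).
Context (d : 'I_n -> nat) (d_gt0 : forall i, (0 < d i)%N).
Context (gT : finGroupType) (W : {group gT}) (rW : mx_representation k W n).
Context (grW : graded_repr d rW).
Local Notation B := {mpoly k[n]}.
Local Notation act := (act rW).
Local Notation invariant := (invariant rW).

Lemma act_sub_ldiv (g : gT) (c : 'cV[k]_n) (r : 'rV[k]_n) : rW g - 1%:M = c *m r ->
  forall p, ldiv c (act g p - p).
Proof.
move=> E; have iL := ldiv_ideal c.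
apply: (@mpoly_rmorph_mod k n _ (act g) idfun _ iL) => [a|i] /=; first by rewrite actC.
exists (r 0 i)%:MP; rewrite actE mx_actX.
have ->: 'X_i = \sum_j (1%:M : 'M[k]_n) j i *: 'X_j :> B.
  rewrite (bigD1 i) //= mxE eqxx scale1r big1 ?addr0 // => j /negbTE ji.
  by rewrite mxE ji scale0r.
rewrite -sumrB mul_mpolyC /lin scaler_sumr; apply: eq_bigr => j _.
rewrite -scalerBl scalerA; congr (_ *: _).
by move/matrixP/(_ j i): E; rewrite !mxE big_ord1 mulrC.
Qed.

Lemma reflection_lin (s : gT) : is_reflection rW s ->
  exists2 c : 'cV[k]_n, c != 0 & forall p, ldiv c (act s p - p).
Proof.
move=> /andP[sW /eqP rk].
have : \rank (rW s - 1%:M) = 1%N.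
  apply/eqP; rewrite -(eqn_add2r (\rank (kermx (rW s - 1%:M)))) add1n rk.
  by rewrite mxrank_ker subnKC ?rank_leq_row.
move=> r1; have [c [r E]] := rank1_mx r1; exists c; last exact: act_sub_ldiv E.
by apply: contra_eq_neq r1 => c0; rewrite E c0 mul0mx mxrank0.
Qed.

Local Notation Rp := (vanishing rW 0 W).
Local Notation J := (span_ideal Rp).
Let iJ : mem_ideal J := span_ideal_ideal _.

Lemma span_ideal_act g p : g \in W -> J p -> J (act g p).
Proof.
move=> gW; move: p; apply: ps_ind => [|a b Ja Jb|p q pR _].
- by rewrite raddf0; exact: ideal0.
- by rewrite raddfD; exact: idealD.
by rewrite rmorphM /= (proj1 pR g gW); apply: psI.
Qed.

Lemma ideal_lin X (iX : @mem_ideal B X) (a : k) (u v : B) : X u -> X v -> X (a *: u + v).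
Proof. by move=> Xu Xv; apply: idealD => //; rewrite -mul_mpolyC; apply: idealMl. Qed.

Section ReflectionGroup.
Context (genW : <<[set g | is_reflection rW g]>>%g = W).

(* The divided differences (s y - y) / l_s are linear over the invariants and
   lower the degree. *)
Lemma chevalley_relation p (u : 'I_p -> B) (al : 'I_p -> k) :
    (forall i, invariant W (u i)) ->
    (forall r : 'I_p -> B, (forall i, invariant W (r i)) -> \sum_i r i * u i = 0 ->
      \sum_i al i * (r i).@[(0 : 'rV_n) 0] = 0) ->
  forall y : 'I_p -> B, \sum_i y i * u i = 0 -> J (\sum_i al i *: y i).
Proof.
move=> uI uR y; have [N] : exists N, forall i, (msize (y i) <= N)%N.
  by exists (\max_i msize (y i)) => i; apply: leq_bigmax.
elim: N y => [|N IH] y yN yu.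
  rewrite big1 => [|i _]; first exact: ideal0.
  by move: (yN i); rewrite leqn0 msize_poly_eq0 => /eqP->; rewrite scaler0.
set Y := \sum_i al i *: y i.
have sY s : is_reflection rW s -> J (act s Y - Y).
  move=> sR; have sW : s \in W by case/andP: sR.
  have [c c0 cd] := reflection_lin sR; have [z zP] := choice (fun i => cd (y i)).
  have ->: act s Y - Y = lin c * \sum_i al i *: z i.
    rewrite /Y raddf_sum -sumrB mulr_sumr; apply: eq_bigr => i _ /=.
    by rewrite linearZ /= -scalerBr zP -scalerAr mulrC.
  apply: idealMl => //; apply: IH => [i|].
    apply: (msize_mul_lin c0); rewrite -zP; apply: leq_trans (msizeD_le _ _) _.
    by rewrite msizeN geq_max yN actE (leq_trans (msize_mx_act _ _ _)).
  apply: (mulIf (x := lin c)); first by rewrite lin_eq0.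
  rewrite mul0r mulr_suml; transitivity (act s (\sum_i y i * u i) - \sum_i y i * u i).
    rewrite raddf_sum -sumrB; apply: eq_bigr => i _.
    by rewrite /= rmorphM /= uI // -mulrBl zP mulrAC.
  by rewrite yu raddf0 subrr.
have gY g : g \in W -> J (act g Y - Y).
  suff H : forall g, g \in <<[set g | is_reflection rW g]>>%g -> J (act g Y - Y).
    by move=> gW; apply: H; rewrite genW.
  apply: generated_ind => [|{}g h].
    by rewrite act1 subrr; exact: ideal0.
  rewrite inE genW => gR hW hY; have gW : g \in W by case/andP: gR.
  have ->: act (g * h)%g Y - Y = act g (act h Y - Y) + (act g Y - Y).
    by rewrite actM // raddfB /= addrA subrK.
  exact: (idealD iJ (span_ideal_act gW hY) (sY g gR)).
(* Modulo J, Y equals its average. That average is the combination by [al] of an invariant relation,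
   so it vanishes at 0 by [uR] and is itself in J. *)
have JY : J (Y - mean rW W Y).
  have ->: Y - mean rW W Y = - ((#|W|%:R^-1)%:MP * \sum_(g in W) (act g Y - Y)).
    rewrite sumrB sumr_const -/(trace rW W Y) mulrBr opprB !mul_mpolyC -/(mean rW W Y).
    rewrite -[Y *+ _]scaler_nat scalerA mulVf ?scale1r //.
    exact: natr_card_neq0.
  apply: idealN => //; apply: idealMl => //.
  by apply: ideal_sum => // g /gY.
rewrite -[Y](subrK (mean rW W Y)); apply: idealD => //.
have yI i : invariant W (mean rW W (y i)) by exact: mean_invariant.
apply: span_ideal_in; split; first exact: mean_invariant.
have -> : mean rW W Y = \sum_i al i *: mean rW W (y i).
  rewrite /Y mean_sum; apply: eq_bigr => i _.
  by rewrite -!mul_mpolyC meanMl //; exact: invariantC.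
rewrite raddf_sum -[RHS](uR (fun i => mean rW W (y i))) //=.
  by apply: eq_bigr => i _; rewrite mevalZ.
transitivity (mean rW W (\sum_i y i * u i)).
  by rewrite mean_sum; apply: eq_bigr => i _; rewrite [y i * _]mulrC meanMl // mulrC.
by rewrite yu /mean /trace big1 ?scaler0 // => g _; rewrite raddf0.
Qed.

(** Let S be the space of values at 0 of the invariant relations satisfied by u. A nonzero linear
    form killing S would, by [chevalley_relation] with y = b, be a dependence of b modulo J; so S is
    everything. This yields a square matrix of relations that is the identity at 0, and its nonzero
    determinant kills u. *)
Lemma chevalley_free p (b : 'I_p -> B) :
    (forall c : 'I_p -> k, J (\sum_i c i *: b i) -> forall i, c i = 0) ->
  forall u : 'I_p -> B, (forall i, invariant W (u i)) -> \sum_i b i * u i = 0 ->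
  forall i, u i = 0.
Proof.
move=> bfree u uI bu.
pose S (c : 'rV[k]_p) := exists r : 'I_p -> B,
  [/\ forall i, invariant W (r i), \sum_i r i * u i = 0 &
      forall i, (r i).@[(0 : 'rV_n) 0] = c 0 i].
have [M MP] : exists M : 'M[k]_p, forall c, S c <-> (c <= M)%MS.
  apply: subspace_mx.
    exists (fun=> 0); split=> [i|| i]; first exact: invariant0.
      by rewrite big1 // => i _; rewrite mul0r.
    by rewrite meval0 mxE.
  move=> a c c' [r [rI ru rc]] [r' [rI' ru' rc']].
  exists (fun i => a *: r i + r' i); split=> [i||i].
  - by apply: invariantD => //; apply: invariantZ.
  - under eq_bigr do rewrite mulrDl -scalerAl.
    by rewrite big_split -scaler_sumr /= ru ru' scaler0 addr0.
  by rewrite mevalD mevalZ rc rc' !mxE.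
have fullM : row_full M.
  apply/negPn/negP => notfull.
  have: cokermx M != 0.
    by rewrite -mxrank_eq0 mxrank_coker subn_eq0 -ltnNge ltn_neqAle notfull rank_leq_col.
  case/matrix0Pn=> i [j ij]; case/negP: ij; apply/eqP.
  apply: (bfree (fun i => cokermx M i j)); apply: (chevalley_relation uI) => // r rI ru.
  have : S (\row_i (r i).@[(0 : 'rV_n) 0]) by exists r; split=> // l; rewrite mxE.
  move=> /MP; rewrite submxE => /eqP/matrixP/(_ 0 j); rewrite [LHS]mxE [RHS]mxE => E.
  by rewrite -[RHS]E; apply: eq_bigr => l _; rewrite [X in _ = X * _]mxE mulrC.
have ex_r i : S (delta_mx 0 i) by apply/MP; apply: submx_full.
have [r rP] := choice ex_r.
pose Rm : 'M[B]_p := \matrix_(i, j) r i j; pose U : 'cV[B]_p := \col_j u j.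
have RU : Rm *m U = 0.
  apply/colP => i; rewrite !mxE; have [_ E _] := rP i; rewrite -[RHS]E.
  by apply: eq_bigr => j _; rewrite !mxE.
have detR : \det Rm != 0.
  have: (\det Rm).@[(0 : 'rV_n) 0] = 1.
    rewrite -[LHS](det_map_mx (meval ((0 : 'rV_n) 0))) -[RHS](det1 k p); congr (\det _).
    apply/matrixP => i j; rewrite mxE [Rm i j]mxE /=; have [_ _ ->] := rP i.
    by rewrite !mxE eqxx eq_sym.
  by apply: contra_eq_neq => ->; rewrite meval0 eq_sym oner_eq0.
have: \det Rm *: U = 0 by rewrite -mul_scalar_mx -mul_adj_mx -mulmxA RU mulmx0.
move=> /colP dU i; move: (dU i); rewrite !mxE => /eqP.
by rewrite mulf_eq0 (negbTE detR) => /eqP.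
Qed.

End ReflectionGroup.

Lemma component_act e g p : g \in W -> component d e (act g p) = act g (component d e p).
Proof. by move=> gW; rewrite !actE; apply: component_mx_act => //; exact: grW. Qed.

Lemma invariant_graded : graded_pred d (invariant W).
Proof. by move=> e p pI g gW; rewrite -component_act ?pI. Qed.

Lemma vanishing_graded : graded_pred d Rp.
Proof.
move=> e p [pI p0]; split; first exact: invariant_graded.
by rewrite meval_row0; apply: (meval0_component d_gt0); rewrite -meval_row0; exact: p0.
Qed.

(** The variable is a root of the monic polynomial of degree [#|W|] whose roots are its conjugates,
    and the lower coefficients are invariants vanishing at 0. *)
Lemma coinvariant_power i : J ('X_i ^+ #|W|).
Proof.
pose s : seq B := [seq act g 'X_i | g <- enum W].
have [P PE] : exists P : {poly B}, P = \prod_(z <- s) ('X - z%:P) by eexists.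
have Pm : P \is monic by rewrite PE; apply: monic_prod_XsubC.
have sP : size P = #|W|.+1 by rewrite PE size_prod_XsubC size_map -cardE.
have PX : P.['X_i] = 0.
  rewrite PE; apply: (horner_prod_XsubC_eq0 id) => //.
  by rewrite -[X in X \in _](act1 rW); apply: map_f; rewrite mem_enum.
have PI j : invariant W P`_j.
  rewrite PE; apply: coef_prod_invariant => // g gW; exact: conj_seq_perm.
have P0 j : (j < #|W|)%N -> (P`_j).@[(0 : 'rV_n) 0] = 0.
  move=> jW; rewrite -(coef_map (meval ((0 : 'rV_n) 0))) PE rmorph_prod big_map /=.
  under eq_bigr => g _.
    rewrite rmorphB /= map_polyX map_polyC /= meval_act mul0mx mevalXU mxE subr0; over.
  by rewrite big_const_seq count_predT -cardE -Monoid.iteropE /= coefXn ltn_eqF.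
move: PX; rewrite horner_coef sP big_ord_recr /=.
move: Pm; rewrite monicE /lead_coef sP => /eqP->; rewrite mul1r addrC => /eqP.
rewrite addr_eq0 => /eqP->; apply: idealN => //; apply: ideal_sum => // j _.
by apply: psI => //; split; [exact: PI | exact: P0].
Qed.

Lemma coinvariant_basis : exists p, exists b : 'I_p -> B,
  [/\ forall i, exists e, homogeneous d e (b i),
      forall c : 'I_p -> k, J (\sum_i c i *: b i) -> forall i, c i = 0 &
      forall y, exists c : 'I_p -> k, J (y - \sum_i c i *: b i)].
Proof.
(* By pigeonhole, a monomial of degree at least N contains some variable to the power [#|W|], hence
   lies in J; finitely many monomials remain. *)
pose N := (n * #|W|).+1.
pose s : seq B := [seq 'X_[bmnm m] | m <- enum {: 'X_{1..n < N}}].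
have JL := ideal_lin iJ.
have [p [b [bs bfree bspan]]] := basis_mod s (ideal0 iJ) JL.
exists p, b; split=> // [i|].
  have /mapP[m _ ->] := bs i; exists (weight d m) => m'.
  by rewrite msuppX inE => /eqP->.
apply: mpolyind => [|c m q _ _ [a Ja]].
  by exists (fun=> 0); rewrite big1 ?subr0 => [|i _]; rewrite ?scale0r //; exact: ideal0.
have [a' Ja'] : exists c : 'I_p -> k, J ('X_[m] - \sum_i c i *: b i).
  have [mN|mN] := ltnP (mdeg m) N.
    by apply: bspan; apply/mapP; exists (BMultinom mN); rewrite ?mem_enum.
  have [i mi] : exists i, (#|W| <= m i)%N.
    apply/existsP; apply: contraLR mN => /existsPn small.
    rewrite -ltnNge ltnS mdegE; have <- : (\sum_(i < n) #|W| = n * #|W|)%N.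
      by rewrite sum_nat_const card_ord.
    by apply: leq_sum => i _; apply: ltnW; rewrite ltnNge; apply: small.
  exists (fun=> 0); rewrite big1 ?subr0 => [|j _]; last by rewrite scale0r.
  rewrite mpolyXE_id (bigD1 i) //= -(subnK mi) exprD -mulrA mulrCA.
  by apply: (idealMr _ iJ); exact: coinvariant_power.
exists (fun i => c * a' i + a i).
have -> : c *: 'X_[m] + q - \sum_i (c * a' i + a i) *: b i =
    c *: ('X_[m] - \sum_i a' i *: b i) + (q - \sum_i a i *: b i).
  rewrite scalerBr scaler_sumr; under eq_bigr do rewrite scalerDl -scalerA.
  by rewrite big_split /= opprD addrACA.
exact: JL.
Qed.

(* Freeness over the invariants: phi gives the coordinates in a basis b. *)
Lemma chevalley_coordinates : <<[set g | is_reflection rW g]>>%g = W ->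
  exists p, exists b : 'I_p -> B, exists phi : B -> 'I_p -> B,
  [/\ forall y i, invariant W (phi y i),
      forall y, y = \sum_i b i * phi y i,
      forall r y i, invariant W r -> phi (r * y) i = r * phi y i &
      forall y z i, phi (y + z) i = phi y i + phi z i].
Proof.
move=> genW; have [p [b [bh bfree bspan]]] := coinvariant_basis.
pose X y := exists c : 'I_p -> B, (forall i, invariant W (c i)) /\ y = \sum_i b i * c i.
have X0 : X 0.
  exists (fun=> 0); split=> [i|]; first exact: invariant0.
  by rewrite big1 // => i _; rewrite mulr0.
have XD y z : X y -> X z -> X (y + z).
  move=> [c [cI ->]] [c' [cI' ->]]; exists (fun i => c i + c' i); split=> [i|].
    exact: invariantD.
  by rewrite -big_split; apply: eq_bigr => i _; rewrite mulrDr.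
have XM r y : invariant W r -> X y -> X (r * y).
  move=> rI [c [cI ->]]; exists (fun i => r * c i); split=> [i|]; first exact: invariantM.
  by rewrite mulr_sumr; apply: eq_bigr => i _; rewrite mulrCA.
(* Modulo J, y is a combination of the homogeneous b, and in its own weight the error is a sum of
   invariants of positive weight times elements of smaller weight. *)
have Xall y : X y.
  have: True by []; move: y.
  apply: (@graded_ind _ _ d (fun=> True) X) => // e y yh _ IH.
  have [c Jc] := bspan y.
  have -> : y = component d e (y - \sum_i c i *: b i) + \sum_i component d e (c i *: b i).
    rewrite -component_sum -componentD subrK.
    by rewrite (component_homogeneous _ yh) eqxx.
  apply: (XD).
    apply: (@ps_component _ _ d Rp (fun=> True) X e) Jc => //.
    - exact: vanishing_graded.
    - by move=> q [_ q0]; apply: positive_component0; rewrite // -meval_row0.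
    move=> i j q z i0 ij _ zh [qI _] _; apply: XM => //; apply: (IH j) => //.
    by rewrite -ij -[X in (X < _)%N]add0n ltn_add2r.
  apply: (big_ind X) => // i _; have [f bf] := bh i.
  rewrite componentZ (component_homogeneous _ bf).
  case: eqP => _; last by rewrite scaler0.
  exists (fun j => (if j == i then c i else 0)%:MP); split=> [j|]; first exact: invariantC.
  rewrite (bigD1 i) //= eqxx mulrC mul_mpolyC big1 ?addr0 // => j /negbTE->.
  by rewrite mpolyC0 mulr0.
have [phi phiP] := choice Xall.
have uniq y c : (forall i, invariant W (c i)) -> y = \sum_i b i * c i -> forall i, phi y i = c i.
  move=> cI yc i; have [phiI yE] := phiP y; apply/eqP; rewrite -subr_eq0; apply/eqP.
  apply: (chevalley_free genW bfree (u := fun i => phi y i - c i)) => [j|].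
    exact: invariantB.
  by under eq_bigr do rewrite mulrBr; rewrite sumrB -yE -yc subrr.
exists p, b, phi; split=> [y i|y|r y i rI|y z i].
- by case: (phiP y).
- by case: (phiP y).
- have [phiI yE] := phiP y; apply: (uniq _ (fun i => r * phi y i)) => [j|].
    exact: invariantM.
  by rewrite {1}yE mulr_sumr; apply: eq_bigr => j _; rewrite mulrCA.
have [yI yE] := phiP y; have [zI zE] := phiP z.
apply: (uniq _ (fun i => phi y i + phi z i)) => [j|]; first exact: invariantD.
by under eq_bigr do rewrite mulrDr; rewrite big_split /= -yE -zE.
Qed.

End Chevalley.

(** * Fixators in reflection groups *)

Section LinearFormProducts.
Context (k : fieldType) (char0 : [pchar k] =i pred0) (n : nat).
Context (gT : finGroupType) (W : {group gT}) (rW : mx_representation k W n).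
Local Notation B := {mpoly k[n]}.
Local Notation act := (act rW).

Definition lin_product (p : B) := exists2 ls : seq 'cV[k]_n,
  (forall c, c \in ls -> c != 0) & p = \prod_(c <- ls) lin c.

Lemma lin_product1 : lin_product 1.
Proof. by exists [::] => //; rewrite big_nil. Qed.

Lemma lin_productM p q : lin_product p -> lin_product q -> lin_product (p * q).
Proof.
move=> [ls ls0 ->] [ls' ls0' ->]; exists (ls ++ ls'); last by rewrite big_cat.
by move=> c; rewrite mem_cat => /orP[/ls0|/ls0'].
Qed.

Lemma lin_product_lin c : c != 0 -> lin_product (lin c).
Proof. by move=> c0; exists [:: c]; rewrite ?big_seq1 // => c'; rewrite inE => /eqP->. Qed.

Lemma act_lin g c : act g (lin c) = lin (rW g *m c).
Proof. by rewrite actE mx_act_lin. Qed.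

Lemma lin_product_act g p : g \in W -> lin_product p -> lin_product (act g p).
Proof.
move=> gW [ls ls0 ->]; rewrite rmorph_prod /=.
have : forall c, c \in ls -> lin_product (act g (lin c)).
  move=> c /ls0 c0; rewrite act_lin; apply: lin_product_lin.
  by apply: contraNneq c0 => E; rewrite -(mulKmx (repr_mx_unit rW gW) c) E mulmx0.
elim: ls {ls0} => [|c ls IH] H; first by rewrite big_nil; exact: lin_product1.
rewrite big_cons; apply: lin_productM; first by apply: H; rewrite mem_head.
by apply: IH => c' c's; apply: H; rewrite inE c's orbT.
Qed.

(** The form must avoid the fixed space of each nontrivial g, a proper subspace by faithfulness.
    Having trivial stabilizer, it serves as a primitive element of the fraction field of B over the
    invariants. *)
Lemma regular_linear_form : mx_faithful rW ->
  exists c : 'cV[k]_n, forall g, g \in W -> g != 1%g -> rW g *m c != c.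
Proof.
move=> faithW.
have ex_r g : exists r : 'rV[k]_n, g \in W :\ 1%g -> r != 0 /\ exists i, r = row i (rW g - 1%:M).
  have [/setD1P[g1 gW]|_] := boolP (g \in W :\ 1%g); last by exists 0.
  have /rowV0Pn[r0 /submxP[D r0E] r00] : rW g - 1%:M != 0.
    apply: contraNneq g1 => /eqP; rewrite subr_eq0 => /eqP g1.
    by rewrite -in_set1; apply: (subsetP faithW); apply/rkerP.
  have [i ri] : exists i, row i (rW g - 1%:M) != 0.
    apply/existsP; apply: contraNT r00 => /existsPn rz; rewrite r0E mulmx_sum_row.
    by rewrite big1 // => i _; move/negbNE/eqP: (rz i) => ->; rewrite scaler0.
  by exists (row i (rW g - 1%:M)) => _; split=> //; exists i.
have [r rP] := choice ex_r.
have [|u uP] := @avoid_hyperplanes k char0 n [seq (r g)^T | g <- enum (W :\ 1%g)].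
  move=> c /mapP[g]; rewrite mem_enum => /rP[r0 _] ->.
  by rewrite trmx_eq0.
exists u^T => g gW g1; have gW1 : g \in W :\ 1%g by rewrite !inE g1.
have := uP _ (map_f _ (_ : g \in enum (W :\ 1%g))); rewrite mem_enum => /(_ gW1).
apply: contraNneq => E; have [_ [i ->]] := rP g gW1.
have -> : u *m (row i (rW g - 1%:M))^T = (row i ((rW g - 1%:M) *m u^T))^T.
  by rewrite row_mul trmx_mul trmxK.
by rewrite mulmxBl E mul1mx subrr row0 trmx0 mxE.
Qed.

End LinearFormProducts.

Section Steinberg.
Context (k : fieldType) (char0 : [pchar k] =i pred0) (n : nat).
Context (d : 'I_n -> nat) (d_gt0 : forall i, (0 < d i)%N).
Context (gT : finGroupType) (W : {group gT}) (rW : mx_representation k W n).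
Context (grW : graded_repr d rW) (faithW : mx_faithful rW).
Local Notation B := {mpoly k[n]}.
Local Notation act := (act rW).
Local Notation invariant := (invariant rW).
Local Notation trace := (trace rW).

(* The dual basis of b for the trace form, multiplied by a common denominator N. *)
Lemma trace_dual_basis : <<[set g | is_reflection rW g]>>%g = W ->
  exists N : B, exists p, exists b : 'I_p -> B, exists dl : 'I_p -> B,
  [/\ N != 0, lin_product N, invariant W N,
      forall w, w \in W -> \sum_i b i * act w (dl i) = if w == 1%g then N else 0 &
      forall i q, exists u, trace W (q * dl i) = N * u].
Proof.
move=> genW; have [p [b [phi [phiI phiE phiM phiD]]]] := chevalley_coordinates char0 d_gt0 grW genW.
have [c cP] := regular_linear_form char0 faithW.
have [y yE] : exists y, y = lin c by eexists.
(* Euler's construction of a trace-dual family: P is the characteristic polynomial of y divided by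
   'X - y. Up to the factor F = P(y), the value at y of its derivative, the coefficients of P are
   dual to the powers of y. *)
have [P PE] : exists P : {poly B}, P = \prod_(w in W :\ 1%g) ('X - (act w y)%:P) by eexists.
have [F FE] : exists F, F = P.[y] by eexists.
have PF w : w \in W -> P.[act w y] = if w == 1%g then F else 0.
  move=> wW; case: (eqVneq w 1%g) => [->|w1]; first by rewrite act1 -FE.
  by rewrite PE; apply: (horner_prod_XsubC_eq0 (fun w => act w y)); rewrite ?mem_index_enum // !inE w1.
have Fprod : F = \prod_(w in W :\ 1%g) (y - act w y).
  by rewrite FE PE horner_prod; apply: eq_bigr => w _; rewrite hornerXsubC.
have linF : lin_product F.
  rewrite Fprod; apply: big_ind => [||w /setD1P[w1 wW]].
  - exact: lin_product1.
  - exact: lin_productM.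
  rewrite yE act_lin -linB; apply: lin_product_lin; rewrite subr_eq0 eq_sym; exact: cP.
have lin_product_neq0 (q : B) : lin_product q -> q != 0.
  by move=> [ls ls0 ->]; rewrite prodf_seq_neq0; apply/allP => x /ls0; rewrite lin_eq0.
have dualE w : w \in W -> \sum_(j < size P) y ^+ j * act w P`_j = if w == 1%g then F else 0.
  move=> wW; transitivity (act w (P.[act w^-1%g y])).
    rewrite horner_coef raddf_sum; apply: eq_bigr => j _ /=.
    by rewrite rmorphM rmorphXn /= -actM ?groupV // mulgV act1 mulrC.
  rewrite PF ?groupV // invg_eq1; case: eqP => [->|_]; first by rewrite act1.
  by rewrite raddf0.
(* The denominator F is replaced by its norm N, which is invariant, with cofactor N'. *)
have [N' N'E] : exists N', N' = \prod_(w in W :\ 1%g) act w F by eexists.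
have [N NE] : exists N, N = \prod_(w in W) act w F by eexists.
have NF : N = F * N'.
  by rewrite NE (big_setD1 1%g) //= act1 N'E.
have NI : invariant W N.
  move=> g gW; rewrite NE rmorph_prod [RHS](reindex_inj (mulgI g)) /=.
  apply: eq_big => [h|h hW]; first by rewrite groupMl.
  by rewrite actM.
have linN : lin_product N.
  rewrite NE; apply: big_ind => [||w wW]; [exact: lin_product1 | exact: lin_productM |].
  exact: lin_product_act.
(* The duals of the powers of y are rewritten for the basis b by expanding these powers with
   [phi]. *)
have [dl dlE] : exists dl : 'I_p -> B, forall i, dl i = (\sum_(j < size P) phi (y ^+ j) i * P`_j) * N'.
  by eexists => i.
exists N, p, b, dl; split=> //; first exact: lin_product_neq0.
  move=> w wW.
  transitivity ((\sum_(j < size P) y ^+ j * act w P`_j) * act w N').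
    have bdl i : b i * act w (dl i) =
        (\sum_(j < size P) b i * (phi (y ^+ j) i * act w P`_j)) * act w N'.
      rewrite dlE rmorphM /= raddf_sum /= [LHS]mulrA mulr_sumr; congr (_ * _).
      by apply: eq_bigr => j _; rewrite rmorphM /= phiI.
    rewrite (eq_bigr _ (fun i _ => bdl i)) -mulr_suml; congr (_ * _).
    rewrite exchange_big; apply: eq_bigr => j _ /=.
    by rewrite [in RHS](phiE (y ^+ j)) mulr_suml; apply: eq_bigr => i _; rewrite mulrA.
  rewrite dualE //; case: eqP => [->|_]; last by rewrite mul0r.
  by rewrite act1 NF.
move=> i q; exists (phi q i).
have phi0 l : phi 0 l = 0.
  by have := phiM 0 0 l (@invariant0 _ _ _ _ rW W); rewrite !mul0r.
have phi_sum m (z : 'I_m -> B) l : phi (\sum_j z j) l = \sum_j phi (z j) l.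
  apply: (big_ind2 (fun a e => phi a l = e)) => // a e a' e' <- <-; exact: phiD.
rewrite -phiM //.
(* The expansion of N q on the powers of y. Its i-th coordinate, computed in two ways, shows that
   the trace of q times [dl i] is N times [phi q i]. *)
have -> : N * q = \sum_(j < size P) trace W (q * P`_j * N') * y ^+ j.
  transitivity (\sum_(w in W) act w q * act w N' * (\sum_(j < size P) y ^+ j * act w P`_j)).
    rewrite (big_setD1 1%g) //= !act1 dualE // eqxx big1 => [|w /setD1P[w1 wW]].
      by rewrite addr0 NF; ring.
    by rewrite dualE // (negbTE w1) mulr0.
  under eq_bigr do rewrite mulr_sumr.
  rewrite exchange_big; apply: eq_bigr => j _; rewrite /trace mulr_suml.
  by apply: eq_bigr => w _; rewrite !rmorphM /=; ring.
rewrite phi_sum dlE mulr_suml mulr_sumr trace_sum; apply: eq_bigr => j _.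
rewrite phiM; last exact: trace_invariant.
have -> : q * (phi (y ^+ j) i * P`_j * N') = phi (y ^+ j) i * (q * P`_j * N') by ring.
by rewrite traceMl // mulrC.
Qed.

Context (v : 'rV[k]_n) (H : {group gT}) (sHW : H \subset W).
Context (Hv : forall h, h \in H -> v *m rW h = v).
Context (reflH : forall s, is_reflection rW s -> v *m rW s = v -> s \in H).

(* Applies to r = s^-1 w when w and s agree modulo a linear form. *)
Lemma inertia_reflection (c : 'cV[k]_n) r : c != 0 -> r \in W -> r != 1%g ->
  (forall i, ldiv c (act r 'X_i - 'X_i)) ->
  is_reflection rW r /\ (v *m c = 0 -> v *m rW r = v).
Proof.
move=> c0 rWr r1 rc.
have fixr m (U : 'M[k]_(m, n)) : U *m c = 0 -> U *m rW r = U.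
  move=> Uc; apply/row_matrixP => j; rewrite row_mul.
  have rUc : row j U *m c = 0 by rewrite -row_mul Uc row0.
  apply/rowP => i; apply/eqP; rewrite -subr_eq0; apply/eqP.
  have [q /(congr1 (meval (row j U 0)))] := rc i.
  rewrite mevalB meval_act !mevalXU => ->.
  by rewrite mevalM meval_lin rUc [X in _ * X]mxE mulr0.
split; last exact: fixr.
rewrite /is_reflection rWr /=; have rkc : \rank c = 1%N.
  by apply/eqP; rewrite eqn_leq rank_leq_col lt0n mxrank_eq0.
have n1 : (0 < n)%N by rewrite -rkc rank_leq_row.
have le1 : (n.-1.+1 <= (\rank (kermx (rW r - 1%:M))).+1)%N.
  rewrite ltnS -subn1 -rkc -mxrank_ker; apply: mxrankS.
  by rewrite sub_kermx mulmxBr mulmx1 subr_eq0 fixr // mulmx_ker.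
have {}le1 := leq_trans (leqSpred n) le1.
rewrite eqn_leq le1 andbT ltn_neqAle rank_leq_row andbT.
apply: contraNneq r1 => full; rewrite -in_set1; apply: (subsetP faithW); apply/rkerP.
split=> //; apply/eqP; rewrite -subr_eq0 -mxrank_eq0.
by rewrite mxrank_ker in full; rewrite -(subKn (rank_leq_row (rW r - 1%:M))) full subnn.
Qed.

(** If w fixed all H-invariants modulo the prime [lin c], then modulo it w x would be a root of the
    polynomial with roots the s x, s in H, hence equal to some s x; a general linear form makes s
    independent of x. Then s^-1 w is trivial modulo a linear form vanishing at v, so it is a
    reflection fixing v and lies in H. *)
Lemma inertia_trivial (c : 'cV[k]_n) w : c != 0 -> v *m c = 0 -> w \in W -> w \notin H ->
  exists2 x, invariant H x & ~ ldiv c (act w x - x).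
Proof.
move=> c0 vc wW wH; apply: contrapT => no_x.
have {no_x} wx x : invariant H x -> ldiv c (act w x - x).
  by move=> xH; apply: contrapT => nd; apply: no_x; exists x.
have [sg sgP] := lin_reduction c0.
have iL := ldiv_ideal c.
have ex_s x : exists2 s, s \in H & ldiv c (act w x - act s x).
  pose sq := [seq act s x | s <- enum H].
  have [P PE] : exists P : {poly B}, P = \prod_(z <- sq) ('X - z%:P) by eexists.
  have PI i : invariant H P`_i.
    by rewrite PE; apply: coef_prod_invariant => // g gH; exact: conj_seq_perm.
  have Px : P.[x] = 0.
    rewrite PE; apply: (horner_prod_XsubC_eq0 id) => //.
    by rewrite -[X in X \in _](act1 rW); apply: map_f; rewrite mem_enum.
  have: ldiv c P.[act w x].
    have: coef_ideal (ldiv c) (map_poly (act w) P - P).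
      by move=> i; rewrite coefB coef_map; exact: wx.
    move=> /(coef_ideal_horner iL (act w x)); rewrite hornerD hornerN horner_map Px raddf0.
    by rewrite sub0r => /(idealN iL); rewrite opprK.
  rewrite PE horner_prod => /sgP/eqP; rewrite rmorph_prod prodf_seq_eq0 => /hasP[z /mapP[s]].
  rewrite mem_enum => sH -> /=; rewrite hornerXsubC => /eqP/sgP.
  by exists s.
have [s sH swX] : exists2 s, s \in H & forall i, ldiv c (act w 'X_i - act s 'X_i).
  apply: contrapT => no_s.
  have [|u uP] := @avoid_mpoly k char0 n n _ (enum H) (fun s i => sg (act w 'X_i - act s 'X_i)).
    move=> s; rewrite mem_enum => sH; apply: contrapT => no_j; apply: no_s; exists s => // i.
    by apply/sgP/eqP/negPn/negP => nz; apply: no_j; exists i.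
  have [s sH /sgP sE] := ex_s (\sum_i u i *: 'X_i).
  have /negP[] := uP s (etrans (mem_enum _ _) sH); apply/eqP; rewrite -[RHS]sE.
  have -> : act w (\sum_i u i *: 'X_i) - act s (\sum_i u i *: 'X_i) =
      \sum_i u i *: (act w 'X_i - act s 'X_i).
    rewrite [act w _]raddf_sum [act s _]raddf_sum -sumrB; apply: eq_bigr => i _ /=.
    by rewrite !linearZ /= -scalerDr.
  by rewrite raddf_sum; apply: eq_bigr => i _; rewrite /= linearZ.
have sW := subsetP sHW _ sH.
have rWr : (s^-1 * w)%g \in W by rewrite groupM ?groupV.
have rH : (s^-1 * w)%g \notin H by rewrite groupMl ?groupV.
have vs : v *m rW s^-1%g = v by rewrite Hv ?groupV.
have c'0 : rW s^-1%g *m c != 0.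
  apply: contraNneq c0 => E.
  by rewrite -(mulKmx (repr_mx_unit rW (groupVr sW)) c) E mulmx0.
have r1 : (s^-1 * w)%g != 1%g by apply: contraNneq rH => ->.
have [|rR rv] := inertia_reflection c'0 rWr r1.
  move=> i; have [q qE] := swX i; exists (act s^-1%g q).
  by rewrite -act_lin -rmorphM -qE raddfB /= actK // actM ?groupV.
by case/negP: rH; apply: reflH => //; apply: rv; rewrite mulmxA vs.
Qed.

(** A general combination of the elements given by [inertia_trivial] serves all w outside H at
    once. *)
Lemma unramified_element (c : 'cV[k]_n) : c != 0 -> v *m c = 0 ->
  exists2 x, invariant H x & forall w, w \in W -> w \notin H -> ~ ldiv c (act w x - x).
Proof.
move=> c0 vc; have [sg sgP] := lin_reduction c0.
have ex_x w : exists x, invariant H x /\ (w \in W :\: H -> ~ ldiv c (act w x - x)).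
  have [/setDP[wW wH]|_] := boolP (w \in W :\: H); last by exists 0; split=> //; exact: invariant0.
  by have [x] := inertia_trivial c0 vc wW wH; exists x.
have [x xP] := choice ex_x; pose m := #|W :\: H|.
have [|u uP] := @avoid_mpoly k char0 n m _ (enum (W :\: H))
    (fun w j => sg (act w (x (enum_val j)) - x (enum_val j))).
  move=> w; rewrite mem_enum => wWH; exists (enum_rank_in wWH w).
  rewrite enum_rankK_in //; apply/eqP => /sgP; exact: (proj2 (xP w)).
exists (\sum_(j < m) u j *: x (enum_val j)).
  by apply: invariant_sum => j _; apply: invariantZ; case: (xP (enum_val j)).
move=> w wW wH /sgP E; have wWH : w \in W :\: H by rewrite inE wH.
have /negP[] := uP w (etrans (mem_enum _ _) wWH); apply/eqP; rewrite -[RHS]E.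
set Y := \sum_j u j *: x (enum_val j); have -> : act w Y - Y =
    \sum_(j < m) u j *: (act w (x (enum_val j)) - x (enum_val j)).
  rewrite [act w _]raddf_sum -sumrB; apply: eq_bigr => i _ /=.
  by rewrite linearZ /= -scalerBr.
by rewrite raddf_sum; apply: eq_bigr => i _; rewrite /= linearZ.
Qed.

(** Summing the dual basis over H gives t_i such that the sum of b_i w(t_i) is N for w in H and 0
    otherwise. Once N is traded for a multiplier M with M(v) nonzero, evaluation at v gives a left
    side common to all w fixing v, and nonzero for w = 1. *)
Lemma steinberg_fixator : <<[set g | is_reflection rW g]>>%g = W ->
  forall w, w \in W -> v *m rW w = v -> w \in H.
Proof.
move=> genW; have [N [p [b [dl [N0 linN NI bdl trdl]]]]] := trace_dual_basis genW.
pose t i := trace H (dl i).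
have bt w : w \in W -> \sum_i b i * act w (t i) = if w \in H then N else 0.
  move=> wW; transitivity (\sum_(s in H) \sum_i b i * act (w * s)%g (dl i)).
    rewrite exchange_big; apply: eq_bigr => i _; rewrite /t /trace raddf_sum mulr_sumr.
    by apply: eq_bigr => s sH; rewrite /= actM // (subsetP sHW).
  have sW s : s \in H -> (w * s)%g \in W by move=> sH; rewrite groupM // (subsetP sHW).
  case: ifPn => wH; last first.
    rewrite big1 // => s sH; rewrite bdl ?sW // ifN //.
    by apply: contraNneq wH => E; rewrite -[w](mulgK s) E mul1g groupV.
  rewrite (bigD1 w^-1%g) ?groupV //= bdl ?mulgV // eqxx big1 ?addr0 // => s /andP[sH sw].
  rewrite bdl ?sW // ifN //; apply: contraNneq sw => E.
  by rewrite -(mulKg w s) E mulg1.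
(* F is the product of the differences between an unramified x and its other conjugates, so it is
   prime to [lin c]. As P(w x) = 0 outside H, the sum over W of P(w x) w(t_i) is [#|H|] F t_i;
   expanded in powers of x it is a combination of traces divisible by N. *)
have stripF (c : 'cV[k]_n) : c != 0 -> v *m c = 0 ->
    exists F, ~ ldiv c F /\ forall i, exists u, F * t i = N * u.
  move=> c0 vc; have [x xH xW] := unramified_element c0 vc.
  have [sg sgP] := lin_reduction c0.
  have orbE z : z \in orbit_seq rW W x -> z != x ->
      exists2 w, w \in W & w \notin H /\ z = act w x.
    move=> /orbit_seqP[w wW ->] wx; exists w => //; split=> //.
    by apply: contra wx => wH; rewrite xH.
  have [P PE] : exists P : {poly B}, P = \prod_(z <- orbit_seq rW W x | z != x) ('X - z%:P).
    by eexists.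
  exists P.[x]; split.
    move=> /sgP/eqP; rewrite PE horner_prod rmorph_prod prodf_seq_eq0 => /hasP[z zO].
    case/andP=> zx; rewrite hornerXsubC => /eqP/sgP.
    have [w wW [wH ->]] := orbE z zO zx => /(idealN (ldiv_ideal c)); rewrite opprB.
    exact: xW.
  move=> i; have [u uP] := choice (fun j : nat => trdl i (x ^+ j)).
  exists (\sum_(j < size P) P`_j * u j).
  have H0 : (#|H|%:R : k) != 0 by exact: natr_card_neq0.
  apply: (@scalerI _ _ _ H0).
  transitivity (\sum_(j < size P) P`_j * trace W (x ^+ j * t i)).
    transitivity (\sum_(w in W) P.[act w x] * act w (t i)).
      rewrite (bigID (mem H)) /= [X in _ + X]big1 ?addr0.
        rewrite -sumr_const scaler_suml; apply: eq_big => [w|w].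
          by rewrite andb_idl // => /(subsetP sHW).
        move=> wH; rewrite scale1r xH // /t trace_actl //.
      move=> w /andP[wW wH].
      have wx : act w x != x.
        by apply/eqP => E; apply: (xW w wW wH); rewrite E subrr; exact: ideal0 (ldiv_ideal c).
      suff -> : P.[act w x] = 0 by rewrite mul0r.
      rewrite PE; apply: (horner_prod_XsubC_eq0 id) => //.
      by apply/orbit_seqP; exists w.
    under eq_bigr do rewrite horner_coef mulr_suml.
    rewrite exchange_big; apply: eq_bigr => j _; rewrite /trace mulr_sumr.
    by apply: eq_bigr => w _; rewrite rmorphM rmorphXn /= mulrA.
  rewrite mulr_sumr scaler_sumr; apply: eq_bigr => j _.
  have -> : trace W (x ^+ j * t i) = #|H|%:R *: trace W (x ^+ j * dl i).
    rewrite /t -traceMl; last exact: invariantX.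
    rewrite {2}/trace trace_sum -sumr_const scaler_suml; apply: eq_bigr => s sH.
    by rewrite scale1r trace_actr // (subsetP sHW).
  by rewrite uP -scalerAr; congr (_ *: _); ring.
(* Factors nonzero at v are absorbed into M0. A factor [lin c] vanishing at v divides F u without
   dividing F, hence divides u and cancels. *)
have strip ls : (forall c, c \in ls -> c != 0) -> forall M0 : B, M0.@[v 0] != 0 ->
    (forall i, exists u, M0 * \prod_(c <- ls) lin c * t i = N * u) ->
    exists2 M : B, M.@[v 0] != 0 & forall i, exists u, M * t i = N * u.
  elim: ls => [|c ls IH] ls0 M0 M0v MN.
    by exists M0 => // i; have [u] := MN i; rewrite big_nil mulr1; exists u.
  have c0 := ls0 c (mem_head _ _).
  have ls0' c' : c' \in ls -> c' != 0 by move=> c's; apply: ls0; rewrite inE c's orbT.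
  have [vc|vc] := eqVneq (lin c).@[v 0] 0; last first.
    apply: (IH ls0' (M0 * lin c)); first by rewrite mevalM mulf_neq0.
    by move=> i; have [u uE] := MN i; exists u; rewrite -uE big_cons mulrA.
  apply: (IH ls0' M0 M0v) => i; have [u uE] := MN i.
  have vc0 : v *m c = 0.
    by apply/matrixP => a b'; rewrite (ord1 a) (ord1 b') -meval_lin vc mxE.
  have [F [Fc /(_ i)[u' u'E]]] := stripF c c0 vc0.
  have l0 : lin c != 0 by rewrite lin_eq0.
  have E : F * u = (M0 * \prod_(c <- ls) lin c * u') * lin c.
    apply: (mulfI N0); transitivity (F * (N * u)); first by ring.
    rewrite -uE big_cons.
    transitivity (M0 * \prod_(c <- ls) lin c * lin c * (F * t i)); first by ring.
    by rewrite u'E; ring.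
  have [//|[q qE]] : ldiv c F \/ ldiv c u by apply: lin_prime => //; rewrite E; eexists.
  exists q; apply: (mulIf l0); rewrite -[RHS]mulrA -qE -uE big_cons; ring.
have [M Mv MP] : exists2 M : B, M.@[v 0] != 0 & forall i, exists u, M * t i = N * u.
  have [ls ls0 NE] := linN.
  apply: (strip ls ls0 1); first by rewrite meval1 oner_eq0.
  by move=> i; exists (t i); rewrite -NE mul1r.
have [u uP] := choice MP.
have key w : w \in W -> \sum_i b i * act w (u i) = if w \in H then act w M else 0.
  move=> wW; apply: (mulfI N0).
  transitivity (act w M * \sum_i b i * act w (t i)).
    rewrite !mulr_sumr; apply: eq_bigr => i _.
    rewrite mulrCA -{1}(NI w wW) -rmorphM -uP rmorphM /=; ring.
  by rewrite bt //; case: ifP; rewrite ?mulr0 // mulrC.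
have evalE w : w \in W -> v *m rW w = v ->
    \sum_i (b i).@[v 0] * (u i).@[v 0] = if w \in H then M.@[v 0] else 0.
  move=> wW vw; move/(congr1 (meval (v 0))): (key w wW); rewrite raddf_sum /=.
  under eq_bigr do rewrite mevalM meval_act vw.
  by move=> ->; case: ifP => _; rewrite ?meval0 // meval_act vw.
move=> w wW vw; move: (evalE w wW vw).
rewrite (evalE 1%g) ?repr_mx1 ?mulmx1 // group1.
by case: ifP => // _ E; move: Mv; rewrite E eqxx.
Qed.

End Steinberg.

(** * Substitution and comparison of dimensions *)

HB.lock Definition subst (k : fieldType) (m n : nat) (g : 'I_m -> {mpoly k[n]})
  (a : {mpoly k[m]}) : {mpoly k[n]} := a \mPo [tuple g i | i < m].

Section Substitution.
Context (k : fieldType) (m n : nat) (g : 'I_m -> {mpoly k[n]}).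

Lemma substE a : subst g a = a \mPo [tuple g i | i < m]. Proof. by rewrite unlock. Qed.

Fact subst_is_linear : linear (subst g).
Proof. by move=> a p q; rewrite !substE linearP. Qed.
Fact subst_is_monoid_morphism : monoid_morphism (subst g).
Proof. by split=> [|p q]; rewrite !substE ?rmorph1 ?rmorphM. Qed.
HB.instance Definition _ :=
  GRing.isLinear.Build k {mpoly k[m]} {mpoly k[n]} _ (subst g) subst_is_linear.
HB.instance Definition _ :=
  GRing.isMonoidMorphism.Build {mpoly k[m]} {mpoly k[n]} (subst g) subst_is_monoid_morphism.

Lemma substX i : subst g 'X_i = g i.
Proof. by rewrite substE comp_mpolyXU -tnth_nth tnth_mktuple. Qed.

Lemma substC c : subst g c%:MP = c%:MP.
Proof. by rewrite substE comp_mpolyC. Qed.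

Lemma meval_subst (v : 'I_n -> k) a : (subst g a).@[v] = a.@[fun i => (g i).@[v]].
Proof. by rewrite substE comp_mpoly_meval; apply: meval_eq => i; rewrite tnth_mktuple. Qed.

Lemma subst_lin c : subst g (lin c) = \sum_i c i 0 *: g i.
Proof. by rewrite /lin raddf_sum; apply: eq_bigr => i _; rewrite /= linearZ /= substX. Qed.

End Substitution.

Lemma indep_span_le (k : fieldType) (V : lmodType k) (J : V -> Prop) (p q : nat)
    (b : 'I_p -> V) (w : 'I_q -> V) : J 0 ->
    (forall a u v, J u -> J v -> J (a *: u + v)) ->
    (forall c : 'I_p -> k, J (\sum_i c i *: b i) -> forall i, c i = 0) ->
    (forall i, exists c : 'I_q -> k, J (b i - \sum_j c j *: w j)) -> (p <= q)%N.
Proof.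
move=> J0 JL bfree /choice[C CP]; rewrite leqNgt; apply/negP => lt_qp.
pose M : 'M[k]_(p, q) := \matrix_(i, j) C i j.
have: kermx M != 0.
  by rewrite kermx_eq0 -row_leq_rank -ltnNge; apply: leq_ltn_trans (rank_leq_col M) lt_qp.
case/matrix0Pn=> i [j ij]; case/negP: ij; apply/eqP; move: j.
apply: (bfree (fun j => kermx M i j)).
have -> : \sum_j kermx M i j *: b j = \sum_j kermx M i j *: (b j - \sum_l C j l *: w l).
  rewrite [RHS](eq_bigr _ (fun j _ => scalerBr _ _ _)) sumrB [X in _ - X](_ : _ = 0) ?subr0 //.
  under eq_bigr do rewrite scaler_sumr.
  rewrite exchange_big big1 // => l _; under eq_bigr do rewrite scalerA.
  rewrite -scaler_suml; suff -> : \sum_j kermx M i j * C j l = 0 by rewrite scale0r.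
  have /matrixP/(_ i l) := mulmx_ker M; rewrite [LHS]mxE [RHS]mxE => E; rewrite -[RHS]E.
  by apply: eq_bigr => j _; rewrite [X in _ = _ * X]mxE.
apply: (big_ind J) => // [u v Ju Jv|j _]; first by rewrite -[u]scale1r; apply: JL.
by rewrite -[_ *: _]addr0; apply: JL.
Qed.

(** * Generators of the ideal of relations *)

Section GradedIdeal.
Context (k : fieldType) (m : nat) (wt : 'I_m -> nat) (wt_gt0 : forall i, (0 < wt i)%N).
Local Notation A := {mpoly k[m]}.
Implicit Types (a p q : A) (I : A -> Prop).
Local Notation maxI I := (product_span (positive_part wt) I).

Lemma positive_graded : graded_pred wt (@positive_part k m wt).
Proof. by move=> e p /positive_partP pp; apply/positive_partP => //; apply: meval0_component => //; apply: pp. Qed.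

Lemma positive_comp0 p : positive_part wt p -> component wt 0 p = 0.
Proof. by move=> /positive_partP pp; apply: positive_component0 => //; apply: pp. Qed.

Lemma positive_sub a : positive_part wt (a - (a.@[fun=> 0])%:MP).
Proof. by apply/positive_partP => //; rewrite mevalB mevalC subrr. Qed.

Lemma max_ideal_sub I (iI : mem_ideal I) a q : I q -> maxI I (a * q - a.@[fun=> 0] *: q).
Proof.
move=> Iq; rewrite -mul_mpolyC -mulrBl; apply: psI => //; exact: positive_sub.
Qed.

Section Nakayama.
Context (I : A -> Prop) (iI : mem_ideal I) (gI : graded_pred wt I).
Let iMI : mem_ideal (maxI I) := ps_ideal _ (fun c a => idealMl c iI).
(** Graded Nakayama: what is missing modulo the span of the a_s has coefficients of positive weight,
    so its factors in I have smaller weight. *)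
Lemma nakayama_ideal t (a : 'I_t -> A) (e : 'I_t -> nat) :
    (forall s, I (a s)) -> (forall s, homogeneous wt (e s) (a s)) ->
    (forall p, I p -> exists c : 'I_t -> k, maxI I (p - \sum_s c s *: a s)) ->
  generates_ideal I a.
Proof.
move=> aI ah aspan p; split; last first.
  by move=> [c ->]; apply: ideal_sum => // s _; apply: idealMl.
pose X p := exists c : 'I_t -> A, p = \sum_s c s * a s.
have X0 : X 0 by exists (fun=> 0); rewrite big1 // => s _; rewrite mul0r.
have XD q q' : X q -> X q' -> X (q + q').
  move=> [c ->] [c' ->]; exists (fun s => c s + c' s).
  by rewrite -big_split; apply: eq_bigr => s _; rewrite mulrDl.
have XM q q' : X q' -> X (q * q').
  move=> [c ->]; exists (fun s => q * c s).
  by rewrite mulr_sumr; apply: eq_bigr => s _; rewrite mulrA.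
move: p; apply: (@graded_ind _ _ wt I X) => // f p ph Ip IH.
have [c Jc] := aspan p Ip.
have -> : p = component wt f (p - \sum_s c s *: a s) + \sum_s component wt f (c s *: a s).
  rewrite -component_sum -componentD subrK.
  by rewrite (component_homogeneous _ ph) eqxx.
apply: (XD).
  apply: (@ps_component _ _ wt (positive_part wt) I X f) Jc => //.
  - exact: positive_graded.
  - exact: positive_comp0.
  move=> i j q z i0 ij _ zh _ Iz; apply: XM; apply: (IH j) => //.
  by rewrite -ij -[X in (X < _)%N]add0n ltn_add2r.
apply: (big_ind X) => // s _.
rewrite componentZ (component_homogeneous _ (ah s)).
case: eqP => _; last by rewrite scaler0.
rewrite -mul_mpolyC; apply: XM; exists (fun s' => (s' == s)%:R).
by rewrite (bigD1 s) //= eqxx mul1r big1 ?addr0 // => j /negbTE->; rewrite mul0r.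
Qed.

(** The homogeneous components of the a_s lie in I and still span it modulo the positive part times
    I. A basis extracted from them generates I, and it has at most t elements because the a_s span
    the same quotient. *)
Lemma homogeneous_generators t (a : 'I_t -> A) :
    (forall s, I (a s)) ->
    (forall p, I p -> exists c : 'I_t -> k, maxI I (p - \sum_s c s *: a s)) ->
  exists t', exists a' : 'I_t' -> A, exists e : 'I_t' -> nat, [/\ (t' <= t)%N,
    forall s, I (a' s), forall s, homogeneous wt (e s) (a' s) & generates_ideal I a'].
Proof.
move=> aI aspan; pose J := maxI I.
have J0 : J 0 by exact: ps0.
have JL (c : k) u v : J u -> J v -> J (c *: u + v) by exact: ideal_lin.
pose l := flatten [seq [seq component wt e (a s) | e <- iota 0 (size (grade wt (a s)))] | s <- enum 'I_t].
have lP x : x \in l -> exists s e, x = component wt e (a s).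
  by case/flattenP=> _ /mapP[s _ ->] /mapP[e _ ->]; exists s, e.
have [p [b [bl bfree bspan]]] := basis_mod l J0 JL.
have bI s : I (b s) by have [s' [e ->]] := lP _ (bl s); apply: gI.
have /choice[e bh] : forall s, exists e, homogeneous wt e (b s).
  by move=> s; have [s' [e ->]] := lP _ (bl s); exists e; exact: homogeneous_component.
exists p, b, e; split=> //.
  by apply: (indep_span_le J0 JL bfree (w := a)) => s; apply: aspan.
apply: (nakayama_ideal bI bh).
pose X q := exists c : 'I_p -> k, J (q - \sum_s c s *: b s).
have X0 : X 0 by exists (fun=> 0); rewrite big1 ?subr0 // => i _; rewrite scale0r.
have XL (c0 : k) q q' : X q -> X q' -> X (c0 *: q + q').
  move=> [c Jc] [c' Jc']; exists (fun s => c0 * c s + c' s).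
  have -> : c0 *: q + q' - \sum_s (c0 * c s + c' s) *: b s =
      c0 *: (q - \sum_s c s *: b s) + (q' - \sum_s c' s *: b s).
    under eq_bigr do rewrite scalerDl -scalerA.
    by rewrite big_split /= -scaler_sumr scalerBr opprD addrACA.
  exact: JL.
have XD q q' : X q -> X q' -> X (q + q') by move=> Xq Xq'; rewrite -[q]scale1r; exact: XL.
have Xa s : X (a s).
  rewrite [a s](sum_component wt); apply: (big_ind X) => // i _; apply: bspan.
  apply/flattenP; exists [seq component wt e (a s) | e <- iota 0 (size (grade wt (a s)))].
    by apply: map_f; rewrite mem_enum.
  by apply: map_f; rewrite mem_iota /= ltn_ord.
move=> q Iq; have [c Jc] := aspan q Iq; rewrite -/(X q) -[q](subrK (\sum_s c s *: a s)).
apply: (XD).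
  by move: (_ - _) Jc => q' Jq'; exists (fun=> 0); rewrite big1 ?subr0 // => i _; rewrite scale0r.
by apply: (big_ind X) => // s _; rewrite -[_ *: _]addr0; apply: XL.
Qed.

End Nakayama.
End GradedIdeal.

Lemma leq_exp_base a b e : (a <= b)%N -> (a ^ e <= b ^ e)%N.
Proof. by case: e => [|e] ab; rewrite ?expn0 // leq_exp2r. Qed.

(** * Growth of dimensions in bounded weight *)

Section Counting.
Context (k : fieldType) (m : nat) (wt : 'I_m -> nat) (wt_gt0 : forall i, (0 < wt i)%N).
Local Notation A := {mpoly k[m]}.
Implicit Types (a p q : A) (J : A -> Prop).

Definition wt_le T p := forall e, (T < e)%N -> component wt e p = 0.
Definition truncate T p := \sum_(e < T.+1) component wt e p.

Lemma component_component e f p :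
  component wt f (component wt e p) = if e == f then component wt e p else 0.
Proof. by rewrite (component_homogeneous _ (homogeneous_component (e := e) (p := p))). Qed.

Lemma component_truncate T e p :
  component wt e (truncate T p) = if (e <= T)%N then component wt e p else 0.
Proof.
rewrite component_sum; under eq_bigr do rewrite component_component.
case: leqP => eT; last first.
  by rewrite big1 // => i _; rewrite ifN // neq_ltn (leq_ltn_trans _ eT) // -ltnS.
rewrite (bigD1 (Ordinal (eT : (e < T.+1)%N))) //= eqxx big1 ?addr0 // => i ne.
by rewrite ifN.
Qed.

Lemma eq_component p q : (forall e, component wt e p = component wt e q) -> p = q.
Proof.
move=> E; apply/mpolyP => mo.
have := mcoeff_component wt (weight wt mo) p mo; rewrite eqxx => <-.
by rewrite E mcoeff_component eqxx.
Qed.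

Lemma truncate_id T p : wt_le T p -> truncate T p = p.
Proof.
move=> pT; apply: eq_component => e; rewrite component_truncate.
by case: leqP => // /pT.
Qed.

Lemma wt_le_truncate T p : wt_le T (truncate T p).
Proof. by move=> e Te; rewrite component_truncate leqNgt Te. Qed.

Lemma truncateD T p q : truncate T (p + q) = truncate T p + truncate T q.
Proof. by rewrite -big_split; apply: eq_bigr => e _; rewrite componentD. Qed.

Lemma truncate_graded T J : mem_ideal J -> graded_pred wt J -> forall p, J p -> J (truncate T p).
Proof. by move=> iJ gJ p Jp; apply: ideal_sum => // e _; apply: gJ. Qed.

Lemma wt_leD T p q : wt_le T p -> wt_le T q -> wt_le T (p + q).
Proof. by move=> pT qT e Te; rewrite componentD pT // qT // addr0. Qed.

Lemma wt_leZ T c p : wt_le T p -> wt_le T (c *: p).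
Proof. by move=> pT e Te; rewrite componentZ pT // scaler0. Qed.

Lemma wt_leB T p q : wt_le T p -> wt_le T q -> wt_le T (p - q).
Proof.
by move=> pT qT e Te; rewrite componentD pT // -scaleN1r componentZ qT // scaler0 addr0.
Qed.

Lemma wt_le_sum T I (r : seq I) (P : pred I) (F : I -> A) :
  (forall i, P i -> wt_le T (F i)) -> wt_le T (\sum_(i <- r | P i) F i).
Proof.
move=> FT; apply: (big_ind (wt_le T)) FT; first by move=> e _; rewrite component0.
exact: wt_leD.
Qed.

Lemma wt_leMh e T a q : homogeneous wt e a -> (e <= T)%N -> wt_le (T - e) q -> wt_le T (q * a).
Proof.
move=> ah eT qT f Tf; rewrite (component_mul_homogeneous _ _ ah) qT ?mul0r ?if_same //.
by rewrite ltn_sub2r // (leq_ltn_trans eT).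
Qed.

Lemma truncateMh e T a q : homogeneous wt e a ->
  truncate T (q * a) = if (e <= T)%N then truncate (T - e) q * a else 0.
Proof.
move=> ah; apply: eq_component => f; rewrite component_truncate (component_mul_homogeneous _ _ ah).
case: leqP => fT; case: (leqP e T) => eT; rewrite ?component0 //.
- rewrite (component_mul_homogeneous _ _ ah) component_truncate leq_sub2r //.
- by rewrite leqNgt (leq_ltn_trans fT eT).
- rewrite (component_mul_homogeneous _ _ ah) component_truncate.
  by rewrite [(f - e <= T - e)%N]leqNgt ltn_sub2r ?mul0r ?if_same // (leq_ltn_trans eT).
Qed.

Fixpoint lspan (l : seq A) p : Prop :=
  if l is a :: l' then exists c : k, lspan l' (p - c *: a) else p = 0.

Lemma lspan_cat l l' p q : lspan l p -> lspan l' q -> lspan (l ++ l') (p + q).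
Proof.
elim: l p => [|a l IH] p /=; first by move=> ->; rewrite add0r.
by move=> [c lp] lq; exists c; rewrite addrAC; apply: IH.
Qed.

Lemma lspan_mul l p a : lspan l p -> lspan [seq x * a | x <- l] (p * a).
Proof.
elim: l p => [|b l IH] p /=; first by move=> ->; rewrite mul0r.
by move=> [c /IH]; rewrite mulrBl -scalerAl; exists c.
Qed.

Lemma lspanP l p : lspan l p -> exists c : 'I_(size l) -> k, p = \sum_i c i *: l`_i.
Proof.
elim: l p => [|a l IH] p /=; first by move=> ->; exists (fun=> 0); rewrite big_ord0.
move=> [c /IH[c' E]]; exists (fun i => if unlift ord0 i is Some j then c' j else c).
rewrite big_ord_recl unlift_none /= -[p](subrK (c *: a)) addrC E; congr (_ + _).
by apply: eq_bigr => i _; rewrite liftK.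
Qed.

Lemma lspan_sum s (b : 'I_s -> A) (c : 'I_s -> k) :
  lspan [seq b i | i <- enum 'I_s] (\sum_i c i *: b i).
Proof.
rewrite -big_enum /=; elim: (enum 'I_s) => [|i l IH] /=; first by rewrite big_nil.
by exists (c i); rewrite big_cons addrC addrK.
Qed.

(** A bound for the Hilbert function of the quotient by J, cumulated up to weight T; only its growth
    in T is used. *)
Definition spanned J T N := exists2 l : seq A, (size l <= N)%N &
  forall p, wt_le T p -> exists q, [/\ lspan l q, wt_le T q & J (p - q)].

Definition add_generator J a p := exists q, exists2 j, J j & p = j + q * a.

(** In weight at most T, an element of J + (a) is modulo J a multiple of a by an element of weight
    at most T - e. The descent takes at most T + 1 steps, each costing the bound for J + (a), whence
    one more factor T + 1. *)
Lemma spanned_step J a e M : mem_ideal J -> graded_pred wt J ->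
    homogeneous wt e a -> (0 < e)%N ->
    (forall T, spanned (add_generator J a) T (T.+1 ^ M)) ->
  forall T, spanned J T (T.+1 ^ M.+1).
Proof.
move=> iJ gJ ah e0 spJ T0; rewrite expnS; set C := (T0.+1 ^ M)%N.
suff: forall T, (T <= T0)%N -> spanned J T (T.+1 * C) by apply.
elim/ltn_ind => T IH leT; have [l1 size1 l1P] := spJ T.
have {}size1 : (size l1 <= C)%N by apply: leq_trans size1 _; exact: leq_exp_base.
have JT p : wt_le T p -> add_generator J a p ->
    exists q, exists2 j, J j & p = j + (if (e <= T)%N then truncate (T - e) q * a else 0).
  move=> pT [q [j Jj E]]; exists q, (truncate T j); first exact: truncate_graded.
  by rewrite -(truncateMh _ _ ah) -truncateD -E truncate_id.
have [leeT|ltTe] := leqP e T; last first.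
  exists l1; first by apply: leq_trans size1 _; rewrite leq_pmull.
  move=> p pT; have [q [lq qT Jq]] := l1P p pT; exists q; split=> //.
  have pqT : wt_le T (p - q) by exact: wt_leB pT qT.
  have [r [j Jj E]] := JT _ pqT Jq.
  by move: E; rewrite ifN -?ltnNge // addr0 => ->.
have lt_Te : (T - e < T)%N by rewrite ltn_subrL e0 (leq_trans e0).
have [l2 size2 l2P] := IH _ lt_Te (leq_trans (leq_subr _ _) leT).
exists (l1 ++ [seq x * a | x <- l2]).
  rewrite size_cat size_map mulSn; apply: leq_add => //; apply: leq_trans size2 _.
  by rewrite leq_mul2r lt_Te orbT.
move=> p pT; have [q [lq qT Jq]] := l1P p pT.
have pqT : wt_le T (p - q) by exact: wt_leB pT qT.
have [r [j Jj]] := JT _ pqT Jq; rewrite leeT => E.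
have [q2 [lq2 q2T Jq2]] := l2P _ (@wt_le_truncate (T - e) r).
exists (q + q2 * a); split.
- exact: (lspan_cat lq (lspan_mul a lq2)).
- exact: (wt_leD qT (wt_leMh ah leeT q2T)).
have -> : p - (q + q2 * a) = j + a * (truncate (T - e) r - q2).
  by rewrite opprD addrA E; ring.
exact: (idealD iJ Jj (idealMl a iJ Jq2)).
Qed.

Lemma add_generator_ideal J a : mem_ideal J -> mem_ideal (add_generator J a).
Proof.
move=> iJ; split.
- by exists 0, 0; rewrite ?mul0r ?addr0 //; exact: ideal0.
- move=> _ _ [q [j Jj ->]] [q' [j' Jj' ->]]; exists (q + q'), (j + j'); first exact: idealD.
  by rewrite mulrDl addrACA.
move=> c _ [q [j Jj ->]]; exists (c * q), (c * j); first exact: idealMl.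
by rewrite mulrDr mulrA.
Qed.

Lemma add_generator_graded J a e : homogeneous wt e a -> mem_ideal J -> graded_pred wt J ->
  graded_pred wt (add_generator J a).
Proof.
move=> ah iJ gJ f _ [q [j Jj ->]]; rewrite componentD (component_mul_homogeneous _ _ ah).
exists (if (e <= f)%N then component wt (f - e) q else 0), (component wt f j); first exact: gJ.
by case: ifP => //; rewrite mul0r.
Qed.

Lemma spanned_iter (l : seq (A * nat)) J M : mem_ideal J -> graded_pred wt J ->
    (forall x, x \in l -> homogeneous wt x.2 x.1 /\ (0 < x.2)%N) ->
    (forall T, spanned (foldl (fun J x => add_generator J x.1) J l) T (T.+1 ^ M)) ->
  forall T, spanned J T (T.+1 ^ (M + size l)).
Proof.
elim: l J => [|[a e] l IH] J iJ gJ lP H T; first by rewrite addn0; apply: H.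
have [ah e0] := lP _ (mem_head _ _); rewrite addnS.
apply: (spanned_step iJ gJ ah e0) => {}T; apply: IH => //.
- exact: add_generator_ideal.
- exact: add_generator_graded ah iJ gJ.
by move=> x xl; apply: lP; rewrite inE xl orbT.
Qed.

(** The box of exponents at most T: weights being positive, it contains every monomial of weight at
    most T, and its cardinal is (T + 1)^m. *)
Definition box_monomial T (f : {ffun 'I_m -> 'I_T.+1}) : 'X_{1..m} := [multinom (f i : nat) | i < m].

Lemma box_monomial_inj T : injective (@box_monomial T).
Proof.
move=> f g /mnmP E; apply/ffunP => i; apply/val_inj.
by have := E i; rewrite !mnmE.
Qed.

Lemma wt_leE T p : wt_le T p ->
  p = \sum_(f : {ffun 'I_m -> 'I_T.+1} | (weight wt (box_monomial f) <= T)%N)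
        p@_(box_monomial f) *: 'X_[box_monomial f].
Proof.
move=> pT; apply/mpolyP => mo; rewrite raddf_sum /=.
under eq_bigr do rewrite mcoeffZ mcoeffX.
have [moT|Tmo] := leqP (weight wt mo) T; last first.
  have := mcoeff_component wt (weight wt mo) p mo; rewrite eqxx pT // mcoeff0 => <-.
  rewrite big1 // => f fT; case: eqP fT => [->|_ _]; last by rewrite mulr0.
  by rewrite leqNgt Tmo.
have moi i : (mo i < T.+1)%N.
  rewrite ltnS (leq_trans _ moT) // /weight (bigD1 i) //= -[X in (X <= _)%N]mul1n.
  by apply: leq_trans (leq_addr _ _); rewrite leq_mul2r wt_gt0 orbT.
pose f : {ffun 'I_m -> 'I_T.+1} := [ffun i => Ordinal (moi i)].
have fE : box_monomial f = mo by apply/mnmP => i; rewrite mnmE ffunE.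
rewrite (bigD1 f) /= ?fE // eqxx mulr1 big1 ?addr0 // => g /andP[_ gf].
rewrite -fE; case: eqP => [/box_monomial_inj E|]; last by rewrite mulr0.
by rewrite E eqxx in gf.
Qed.

Lemma spanned0_bound N : (forall T, spanned (fun p => p = 0) T (T.+1 ^ N)) -> (m <= N)%N.
Proof.
move=> sp; rewrite leqNgt; apply/negP => ltNm.
(* The monomials with exponents at most D have weight at most T = w D, and there are (D + 1)^m of
   them. On the other side, (T + 1)^N is at most (w + 1)^N (D + 1)^N = D (D + 1)^N, which is less
   than (D + 1)^(N + 1). *)
pose w := (\sum_i wt i)%N; pose D := ((w.+1) ^ N)%N; pose T := (w * D)%N.
have [l sizel lP] := sp T.
have: (D.+1 ^ m <= size l)%N.
  have <- : #|{ffun 'I_m -> 'I_D.+1}| = (D.+1 ^ m)%N by rewrite card_ffun !card_ord.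
  apply: (@indep_span_le _ _ (fun p => p = 0 :> A) _ _
    (fun i => 'X_[box_monomial (enum_val i : {ffun 'I_m -> 'I_D.+1})]) (fun i => l`_i)) => //.
  - by move=> a u v -> ->; rewrite scaler0 addr0.
  - move=> c E i; have := congr1 (mcoeff (box_monomial (enum_val i))) E.
    rewrite mcoeff0 raddf_sum /= => Ei; rewrite -[RHS]Ei (bigD1 i) //=.
    rewrite mcoeffZ mcoeffX eqxx mulr1 big1 ?addr0 // => j ji.
    rewrite mcoeffZ mcoeffX; case: eqP => [/box_monomial_inj/enum_val_inj E'|]; last by rewrite mulr0.
    by rewrite E' eqxx in ji.
  move=> i; have [|q [lq _ /eqP]] := lP 'X_[box_monomial (enum_val i : {ffun 'I_m -> 'I_D.+1})].
    move=> e Te; rewrite (component_homogeneous (e := weight wt (box_monomial (enum_val i)))).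
      rewrite ifN // neq_ltn (leq_ltn_trans _ Te) //.
      rewrite /weight /T /w big_distrl; apply: leq_sum => j _ /=.
      by rewrite leq_mul2l mnmE -ltnS ltn_ord orbT.
    by move=> mo; rewrite msuppX inE => /eqP->.
  rewrite subr_eq0 => /eqP->; have [c ->] := lspanP lq.
  by exists c; rewrite subrr.
move=> /leq_trans/(_ sizel); rewrite leqNgt => /negP[].
have leT : (T.+1 <= w.+1 * D.+1)%N by rewrite mulSn mulnS /T -addn1 addnC leq_add // leq_addl.
apply: leq_ltn_trans (_ : (w.+1 * D.+1) ^ N < _)%N; first exact: leq_exp_base.
rewrite expnMn -/D; apply: leq_trans (_ : D.+1 ^ N.+1 <= _)%N; last by rewrite leq_exp2l // ltnS expn_gt0.
by rewrite expnS ltn_mul2r ltnSn expn_gt0.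
Qed.

End Counting.

Section GeneratorCount.
Context (k : fieldType) (n m : nat) (d : 'I_n -> nat) (wt : 'I_m -> nat).
Context (d_gt0 : forall i, (0 < d i)%N) (wt_gt0 : forall i, (0 < wt i)%N).
Context (gen : 'I_m -> {mpoly k[n]}) (gen_h : forall i, homogeneous d (wt i) (gen i)).
Local Notation A := {mpoly k[m]}.
Let I (a : A) : Prop := subst gen a = 0.

Lemma component_subst e a : component d e (subst gen a) = subst gen (component wt e a).
Proof. by apply: component_morph => j; rewrite /= substX. Qed.

(** The quotient by I embeds into the polynomials in n variables, compatibly with weights, and there
    the box bounds the dimension. *)
Lemma kernel_spanned T : spanned wt I T (T.+1 ^ n).
Proof.
pose s : seq A := [seq 'X_[box_monomial f] |
  f <- enum [pred f : {ffun 'I_m -> 'I_T.+1} | (weight wt (box_monomial f) <= T)%N]].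
have I0 : I 0 by rewrite /I raddf0.
have IL (c : k) u v : I u -> I v -> I (c *: u + v).
  by move=> Iu Iv; rewrite /I linearP /= Iu Iv scaler0 addr0.
have [p [b [bs bfree bspan]]] := basis_mod s I0 IL.
have bT i : wt_le wt T (b i).
  have /mapP[f] := bs i; rewrite mem_enum inE => fT -> e Te.
  rewrite (component_homogeneous (e := weight wt (box_monomial f))).
    by rewrite ifN // neq_ltn (leq_ltn_trans _ Te).
  by move=> mo; rewrite msuppX inE => /eqP->.
exists [seq b i | i <- enum 'I_p].
  rewrite size_map size_enum_ord.
  have <- : #|{ffun 'I_n -> 'I_T.+1}| = (T.+1 ^ n)%N by rewrite card_ffun !card_ord.
  apply: (@indep_span_le _ _ (fun x => x = 0) _ _ (fun i => subst gen (b i))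
    (fun j => 'X_[box_monomial (enum_val j : {ffun 'I_n -> 'I_T.+1})])) => //.
  - by move=> a u v -> ->; rewrite scaler0 addr0.
  - move=> c E; apply: bfree; rewrite /I raddf_sum -[RHS]E; apply: eq_bigr => i _.
    by rewrite /= linearZ.
  move=> i; have sT : wt_le d T (subst gen (b i)).
    by move=> e Te; rewrite component_subst bT ?raddf0.
  exists (fun j => if (weight d (box_monomial (enum_val j : {ffun 'I_n -> 'I_T.+1})) <= T)%N
    then (subst gen (b i))@_(box_monomial (enum_val j)) else 0).
  apply/eqP; rewrite subr_eq0 {1}(wt_leE d_gt0 sT) big_mkcond /=.
  rewrite (reindex (@enum_val _ {ffun 'I_n -> 'I_T.+1})) /=; last first.
    exists enum_rank => j _; [exact: enum_valK | exact: enum_rankK].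
  apply/eqP; apply: eq_bigr => j _; case: ifP => //; by rewrite scale0r.
move=> q qT; suff [c Ic] : exists c : 'I_p -> k, I (q - \sum_i c i *: b i).
  exists (\sum_i c i *: b i); split; [exact: lspan_sum | | exact: Ic].
  by apply: wt_le_sum => i _; apply: wt_leZ; exact: bT.
rewrite {1}(wt_leE wt_gt0 qT).
pose X q := exists c : 'I_p -> k, I (q - \sum_i c i *: b i); rewrite -/(X _).
apply: (big_ind X) => [|q1 q2 [c1 I1] [c2 I2]|f fT].
- by exists (fun=> 0); rewrite big1 ?subr0 // => i _; rewrite scale0r.
- exists (fun i => c1 i + c2 i); under eq_bigr do rewrite scalerDl.
  by rewrite big_split /= opprD addrACA -[X in I (X + _)]scale1r; apply: IL.
have [|c Ic] := bspan 'X_[box_monomial f]; first by apply/mapP; exists f; rewrite ?mem_enum.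
exists (fun i => q@_(box_monomial f) * c i).
under eq_bigr do rewrite -scalerA; rewrite -scaler_sumr -scalerBr.
by rewrite -[_ *: _]addr0; apply: IL.
Qed.

(** A/I grows at most like (T + 1)^n, and undoing the t relations one at a time costs t further
    factors T + 1; [spanned0_bound] compares this with the growth of A. *)
Lemma kernel_generators_ge t (a : 'I_t -> A) (e : 'I_t -> nat) :
    (forall s, homogeneous wt (e s) (a s)) -> generates_ideal I a -> (m <= n + t)%N.
Proof.
move=> ah aI.
(* A generator of weight 0 is a constant in I, hence 0, and may be declared of weight 1; the
   counting step needs positive weights. *)
have a_e s : exists f, homogeneous wt f (a s) /\ (0 < f)%N.
  have [e0|e0] := posnP (e s); last by exists (e s).
  exists 1%N; split=> //; suff -> : a s = 0 by exact: homogeneous0.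
  have Ias : I (a s).
    apply/aI; exists (fun i => (i == s)%:R); rewrite (bigD1 s) //= eqxx mul1r.
    by rewrite big1 ?addr0 // => j /negbTE->; rewrite mul0r.
  have := component_homogeneous 0 (ah s).
  rewrite e0 eqxx (component0E wt_gt0); set c := (a s)@_0 => E.
  move: Ias; rewrite /I -E substC => /eqP; rewrite mpolyC_eq0 => /eqP->.
  exact: mpolyC0.
have [f fP] := choice a_e.
pose l := [seq (a s, f s) | s <- enum 'I_t].
have sizel : size l = t by rewrite size_map size_enum_ord.
rewrite -sizel; apply: (@spanned0_bound _ _ wt).
have i0 : mem_ideal (fun p : A => p = 0) by split=> // [x y -> ->|c x ->]; rewrite ?addr0 ?mulr0.
apply: spanned_iter => //.
- by move=> e' p ->; rewrite component0.
- by move=> x /mapP[s _ ->]; exact: fP.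
move=> T; have [lT sizeT lP] := kernel_spanned T; exists lT => // p pT.
have [q [lq qT Iq]] := lP p pT; exists q; split=> //.
have /aI[c ->] := Iq; rewrite -big_enum /= /l.
have : forall J : A -> Prop, mem_ideal J ->
  foldl (fun J x => add_generator J x.1) J [seq (a s, f s) | s <- enum 'I_t]
    (\sum_(i <- enum 'I_t) c i * a i); last by apply.
elim: (enum 'I_t) => [|s r IH] J iJ /=; first by rewrite big_nil; exact: ideal0.
rewrite big_cons.
have foldl_ideal (l' : seq (A * nat)) (J1 : A -> Prop) : mem_ideal J1 ->
    mem_ideal (foldl (fun J x => add_generator J x.1) J1 l').
  by elim: l' J1 => //= x l' IHl J1 iJ1; apply: IHl; exact: add_generator_ideal.
have foldl_sub (l' : seq (A * nat)) (J1 : A -> Prop) x : mem_ideal J1 -> J1 x ->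
    foldl (fun J x => add_generator J x.1) J1 l' x.
  elim: l' J1 => //= y l' IHl J1 iJ1 J1x; apply: IHl; first exact: add_generator_ideal.
  by exists 0, x => //; rewrite mul0r addr0.
have iJ' := add_generator_ideal (a s) iJ.
apply: idealD; [exact: foldl_ideal | | exact: IH].
by apply: foldl_sub => //; exists (c s), 0; rewrite ?add0r //; exact: ideal0.
Qed.

End GeneratorCount.

(** * Presentation of the ring of invariants *)

Section Presentation.
Context (k : fieldType) (char0 : [pchar k] =i pred0) (n : nat).
Context (d : 'I_n -> nat) (d_gt0 : forall i, (0 < d i)%N).
Context (gT : finGroupType) (W : {group gT}) (rW : mx_representation k W n).
Context (grW : graded_repr d rW) (G : {group gT}) (sGW : G \subset W).
Context (N : nat) (wt : 'I_N -> nat) (gen : 'I_N -> {mpoly k[n]}).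
Local Notation V := (vanishing rW 0 G).
Context (gen_h : forall i, homogeneous d (wt i) (gen i)) (gen_van : forall i, V (gen i)).
Context (gen_span : forall b, V b -> exists c : 'I_N -> k, product_span V V (b - \sum_i c i *: gen i)).
Context (gen_free : forall c : 'I_N -> k, product_span V V (\sum_i c i *: gen i) -> forall i, c i = 0).
Local Notation A := {mpoly k[N]}.
Local Notation act := (act rW).
Local Notation invariant := (invariant rW).

Lemma generator_wt_gt0 i : (0 < wt i)%N.
Proof.
rewrite lt0n; apply/negP => /eqP wi.
have gi0 : gen i = 0.
  have [_] := gen_van i; rewrite meval_row0 => /(positive_component0 d_gt0).
  by rewrite (component_homogeneous 0 (gen_h (i := i))) wi eqxx.
have /(_ i)/eqP : forall j, (j == i)%:R = 0 :> k.
  apply: gen_free; rewrite (bigD1 i) //= eqxx scale1r gi0 add0r big1.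
    exact: ps0.
  by move=> j /negbTE->; rewrite scale0r.
by rewrite eqxx oner_eq0.
Qed.

Lemma subst_invariant a : invariant G (subst gen a).
Proof.
move: a; apply: mpoly_ring_ind => [c|i|p q|p q].
- by rewrite substC; apply: invariantC.
- by rewrite substX; case: (gen_van i).
- by rewrite raddfD; apply: invariantD.
by rewrite rmorphM; apply: invariantM.
Qed.

Lemma meval0_subst a : (subst gen a).@[(0 : 'rV_n) 0] = a.@[fun=> 0].
Proof. by rewrite meval_subst; apply: meval_eq => i; case: (gen_van i). Qed.

(** Generators modulo the square of V generate the algebra: in a product of two elements of V both
    factors have smaller weight, where induction applies. *)
Lemma presentation_surjective b : invariant G b -> exists a, b = subst gen a.
Proof.
pose X b := exists a, b = subst gen a.
have X0 : X 0 by exists 0; rewrite raddf0.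
have XD p q : X p -> X q -> X (p + q).
  by move=> [a ->] [a' ->]; exists (a + a'); rewrite raddfD.
have gradG : graded_pred d (invariant G).
  by move=> f p pI g gG; rewrite -(component_act char0 grW) ?(subsetP sGW) ?pI.
have gradV : graded_pred d V.
  move=> f p [pI p0]; split; first exact: gradG.
  by rewrite meval_row0; apply: (meval0_component d_gt0); rewrite -meval_row0; exact: p0.
move: b; apply: (@graded_ind _ _ d (invariant G) X) => // f b bh bI IH.
have [f0|f0] := posnP f.
  have := component_homogeneous 0 bh; rewrite f0 eqxx (component0E d_gt0) => <-.
  by exists (b@_0)%:MP; rewrite substC.
have bV : V b by split=> //; rewrite meval_row0 (homogeneous_meval0 d_gt0 f0 bh).
have [c bc] := gen_span bV.
have -> : b = component d f (b - \sum_i c i *: gen i) + \sum_i component d f (c i *: gen i).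
  rewrite -component_sum -componentD subrK.
  by rewrite (component_homogeneous _ bh) eqxx.
apply: (XD).
  have V0 p : V p -> component d 0 p = 0.
    by move=> [_]; rewrite meval_row0 => /(positive_component0 d_gt0).
  apply: (@ps_component _ _ d V V X f) bc => // i j p q i0 ij ph qh pV qV.
  have [j0|j0] := posnP j.
    have := V0 _ qV; rewrite (component_homogeneous _ qh) j0 eqxx => ->.
    by rewrite mulr0.
  have [||a ->] := IH i p _ ph; [by rewrite -ij -[X in (X < _)%N]addn0 ltn_add2l | by case: pV |].
  have [||a' ->] := IH j q _ qh; [by rewrite -ij -[X in (X < _)%N]add0n ltn_add2r | by case: qV |].
  by exists (a * a'); rewrite rmorphM.
apply: (big_ind X) => // i _.
rewrite componentZ (component_homogeneous _ (gen_h (i := i))).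
case: eqP => _; last by rewrite scaler0.
by exists (c i *: 'X_i); rewrite linearZ /= substX.
Qed.

(** The linear terms of a relation would be a dependence of the [gen] modulo the square of V; so the
    coefficients can be chosen to vanish at 0. *)
Lemma kernel_linear_part a : subst gen a = 0 ->
  exists2 c : 'I_N -> A, (forall j, (c j).@[fun=> 0] = 0) & a = \sum_j c j * 'X_j.
Proof.
move=> a0; have := meval0_subst a; rewrite a0 meval0 => /esym a00.
have [F] := mpoly_taylor a (fun=> 0); rewrite a00 mpolyC0 subr0 => aF.
have {}aF : a = \sum_i F i * 'X_i.
  by rewrite aF; apply: eq_bigr => i _; rewrite subr0.
exists F => //; apply: gen_free.
have -> : \sum_i (F i).@[fun=> 0] *: gen i =
    - \sum_i subst gen (F i - ((F i).@[fun=> 0])%:MP) * gen i.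
  transitivity (subst gen a - \sum_i subst gen (F i - ((F i).@[fun=> 0])%:MP) * gen i).
    rewrite aF raddf_sum -sumrB; apply: eq_bigr => i _ /=.
    by rewrite rmorphM raddfB /= substC substX -mul_mpolyC; ring.
  by rewrite a0 sub0r.
rewrite -sumrN; apply: (big_ind (product_span V V)) => [||i _].
- exact: ps0.
- exact: psD.
rewrite -mulNr; apply: psI => //; split; first by apply: invariantN; exact: subst_invariant.
by rewrite mevalN meval0_subst mevalB mevalC subrr oppr0.
Qed.

End Presentation.

Section FixedGenerators.
Context (k : fieldType) (char0 : [pchar k] =i pred0) (n : nat).
Context (gT : finGroupType) (W : {group gT}) (rW : mx_representation k W n).
Context (faithW : mx_faithful rW) (G : {group gT}) (sGW : G \subset W).

(** The polynomial whose roots are the G-conjugates of a form with trivial stabilizer has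
    coefficients fixed by w; so w sends the form to a G-conjugate, and this determines w. *)
Lemma invariant_galois w : w \in W -> (forall b, invariant rW G b -> act rW w b = b) -> w \in G.
Proof.
move=> wW wI; have [c cP] := regular_linear_form char0 faithW.
have [P PE] : exists P : {poly {mpoly k[n]}},
    P = \prod_(z <- [seq act rW g (lin c) | g <- enum G]) ('X - z%:P) by eexists.
have Pc : P.[lin c] = 0.
  rewrite PE; apply: (horner_prod_XsubC_eq0 id) => //.
  by rewrite -[X in X \in _](act1 rW); apply: map_f; rewrite mem_enum.
have wP : map_poly (act rW w) P = P.
  apply/polyP => i; rewrite coef_map; apply: wI; rewrite PE.
  by apply: coef_prod_invariant => // g gG; exact: conj_seq_perm.
have: P.[act rW w (lin c)] = 0 by rewrite -wP horner_map Pc raddf0.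
move=> /eqP; rewrite PE horner_prod prodf_seq_eq0 => /hasP[z /mapP[g]].
rewrite mem_enum => gG -> /=; rewrite hornerXsubC subr_eq0 => /eqP E.
have gW := subsetP sGW _ gG.
have: act rW (g^-1 * w)%g (lin c) = lin c by rewrite actM ?groupV // E actK.
move=> E'; suff -> : w = g by [].
apply/eqP; rewrite eq_sym eq_mulVg1; apply: contraT => /(cP _ (groupM (groupVr gW) wW)) /eqP[].
apply/eqP; rewrite -subr_eq0 -lin_eq0 linB -(act_lin rW) E'.
by rewrite subrr.
Qed.

(** If w fixes u = (w - 1) c, then w^m c = c + m u, and the finite order of w forces u = 0. *)
Lemma repr_unipotent N (rV : mx_representation k W N) w (c : 'cV[k]_N) : w \in W ->
  (rV w - 1%:M) *m ((rV w - 1%:M) *m c) = 0 -> (rV w - 1%:M) *m c = 0.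
Proof.
move=> wW; set u := (rV w - 1%:M) *m c => Tu.
have wu : rV w *m u = u.
  by apply/eqP; rewrite -subr_eq0 -[X in _ - X]mul1mx -mulmxBl Tu.
have wc : rV w *m c = c + u by rewrite /u mulmxBl mul1mx addrC subrK.
have E m : rV (w ^+ m)%g *m c = c + m%:R *: u.
  elim: m => [|m IH]; first by rewrite repr_mx1 mul1mx scale0r addr0.
  rewrite expgS repr_mxM ?groupX // -mulmxA IH mulmxDr wc -scalemxAr wu.
  by rewrite -natr1 scalerDl scale1r -addrA [u + _]addrC.
have /eqP := E #[w]%g; rewrite expg_order repr_mx1 mul1mx eq_sym addrC -subr_eq0 addrK.
rewrite scaler_eq0 char0_natr_eq0 // => /orP[|/eqP//].
by rewrite -leqn0 leqNgt order_gt0.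
Qed.

End FixedGenerators.

(** * Reflections on the tangent space of the quotient *)

Section LinearPart.
Context (k : fieldType) (N : nat) (u : 'rV[k]_N).
Local Notation A := {mpoly k[N]}.
Implicit Types (a p q : A) (c : 'cV[k]_N).

Definition vanishes_at p := p.@[u 0] = 0.
Local Notation m2 := (product_span vanishes_at vanishes_at).
(** The affine function with differential c that vanishes at u. By [affine_sq_eq0] and
    [linear_part], these identify columns with the cotangent space at u. *)
Definition affine c : A := lin c - ((lin c).@[u 0])%:MP.

Lemma vanishes_at_ideal : mem_ideal vanishes_at.
Proof.
rewrite /vanishes_at; split=> [|p q pu qu|p q qu]; rewrite ?meval0 //.
  by rewrite mevalD pu qu addr0.
by rewrite mevalM qu mulr0.
Qed.

Lemma vanishes_at_sq_ideal : mem_ideal m2.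
Proof. by apply: ps_ideal => c a; apply: idealMl; exact: vanishes_at_ideal. Qed.

Lemma affine_vanishes c : vanishes_at (affine c).
Proof. by rewrite /vanishes_at mevalB mevalC subrr. Qed.

Lemma affineB c c' : affine (c - c') = affine c - affine c'.
Proof. by rewrite /affine linB mevalB mpolyCB; ring. Qed.

Lemma affine_lincomb m (x : 'I_m -> k) (f : 'I_m -> 'cV[k]_N) :
  affine (\sum_i x i *: f i) = \sum_i x i *: affine (f i).
Proof.
rewrite /affine lin_lincomb [(_).@[_]]raddf_sum [_%:MP]raddf_sum -sumrB.
by apply: eq_bigr => i _; rewrite /= mevalZ mpolyCM mul_mpolyC scalerBr.
Qed.

Lemma mderiv_vanishes_at_sq i p : m2 p -> (p^`M(i)).@[u 0] = 0.
Proof.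
move: p; apply: ps_ind => [|a b Ea Eb|p q pu qu].
- by rewrite mderiv0 meval0.
- by rewrite mderivD mevalD Ea Eb addr0.
by rewrite mderivM mevalD !mevalM pu qu mul0r mulr0 addr0.
Qed.

Lemma mderiv_lin i c : (lin c)^`M(i) = (c i 0)%:MP.
Proof.
rewrite /lin [_^`M(i)]raddf_sum (bigD1 i) //= mderivZ mderivX mnm1E eqxx scale1r.
rewrite big1 => [|j ji]; last by rewrite mderivZ mderivX mnm1E (negbTE ji) scale0r scaler0.
rewrite addr0 [X in 'X_[X]](_ : _ = 0%MM); last first.
  by apply/mnmP => j; rewrite mnmBE subnn mnm0E.
by rewrite mpolyX0 -mul_mpolyC mulr1.
Qed.

Lemma affine_sq_eq0 c : m2 (affine c) -> c = 0.
Proof.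
move=> cm; apply/colP => i; rewrite [RHS]mxE; have := mderiv_vanishes_at_sq i cm.
by rewrite /affine mderivB mderivC subr0 mderiv_lin mevalC.
Qed.

Lemma linear_part p : vanishes_at p -> exists c, m2 (p - affine c).
Proof.
move=> pu; have [F] := mpoly_taylor p (u 0); rewrite pu mpolyC0 subr0 => pF.
exists (\col_i (F i).@[u 0]).
have -> : p - affine (\col_i (F i).@[u 0]) =
    \sum_i (F i - ((F i).@[u 0])%:MP) * ('X_i - (u 0 i)%:MP).
  have -> : affine (\col_i (F i).@[u 0]) = \sum_i ((F i).@[u 0])%:MP * ('X_i - (u 0 i)%:MP).
    rewrite /affine meval_lin mxE [_%:MP]raddf_sum /lin -sumrB; apply: eq_bigr => i _ /=.
    by rewrite mxE mulrBr mul_mpolyC -mpolyCM mulrC.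
  by rewrite {1}pF -sumrB; apply: eq_bigr => i _; rewrite mulrBl.
apply: (big_ind m2) => [||i _]; [exact: ps0 | exact: psD |].
by apply: psI; rewrite /vanishes_at mevalB mevalC ?mevalXU subrr.
Qed.

End LinearPart.

Section LocalKernel.
Context (k : fieldType) (char0 : [pchar k] =i pred0) (n : nat).
Context (d : 'I_n -> nat) (d_gt0 : forall i, (0 < d i)%N).
Context (gT : finGroupType) (W : {group gT}) (rW : mx_representation k W n).
Context (grW : graded_repr d rW) (G : {group gT}) (sGW : G \subset W).
Context (N : nat) (wt : 'I_N -> nat) (gen : 'I_N -> {mpoly k[n]}).
Local Notation V := (vanishing rW 0 G).
Context (gen_h : forall i, homogeneous d (wt i) (gen i)) (gen_van : forall i, V (gen i)).
Context (gen_span : forall b, V b -> exists c : 'I_N -> k, product_span V V (b - \sum_i c i *: gen i)).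
Context (gen_free : forall c : 'I_N -> k, product_span V V (\sum_i c i *: gen i) -> forall i, c i = 0).
Context (rV : mx_representation k W N).
Context (gen_act : forall w i, w \in W -> act rW w (gen i) = \sum_j rV w j i *: gen j).
Local Notation A := {mpoly k[N]}.
Definition kernel (a : A) : Prop := subst gen a = 0.
Local Notation I := kernel.
Context (v : 'rV[k]_n) (X : {group gT}) (sXW : X \subset W).
Context (Xv : forall w, w \in X -> v *m rW w = v).
Context (X_trivial : forall w a, w \in X -> I a ->
  product_span (positive_part wt) I (act rV w a - a)).

Let wt_gt0 i : (0 < wt i)%N := generator_wt_gt0 d_gt0 gen_h gen_van gen_free i.

Definition image_pt : 'rV[k]_N := \row_i (gen i).@[v 0].
Local Notation gv := image_pt.
Local Notation mv := (vanishes_at gv).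

Lemma kernel_ideal : mem_ideal I.
Proof.
rewrite /kernel; split=> [|p q p0 q0|p q q0]; first by rewrite raddf0.
  by rewrite raddfD /= p0 q0 addr0.
by rewrite rmorphM /= q0 mulr0.
Qed.

Lemma subst_act w a : w \in W -> subst gen (act rV w a) = act rW w (subst gen a).
Proof.
move=> wW; apply: (mpoly_rmorph_eq (f := subst gen \o act rV w) (g := act rW w \o subst gen)) => [c|i] /=.
  by rewrite actC !substC actC.
by rewrite substX gen_act // actE mx_actX raddf_sum; apply: eq_bigr => j _; rewrite /= linearZ /= substX.
Qed.

Lemma kernel_act w a : w \in W -> I a -> I (act rV w a).
Proof. by move=> wW Ia; rewrite /kernel subst_act // Ia raddf0. Qed.

Lemma kernel_graded : graded_pred wt I.
Proof. by move=> e a Ia; rewrite /kernel -(component_subst gen_h) Ia component0. Qed.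

Lemma meval_image a : a.@[gv 0] = (subst gen a).@[v 0].
Proof. by rewrite meval_subst; apply: meval_eq => i; rewrite mxE. Qed.

Lemma kernel_vanishes a : I a -> mv a.
Proof. by move=> Ia; rewrite /vanishes_at meval_image Ia meval0. Qed.

Lemma image_pt_fix w : w \in X -> gv *m rV w = gv.
Proof.
move=> wX; apply/rowP => i; rewrite !mxE; have wW := subsetP sXW _ wX.
transitivity (act rW w (gen i)).@[v 0]; last by rewrite meval_act Xv.
rewrite gen_act // raddf_sum; apply: eq_bigr => j _.
by rewrite /= mevalZ mxE mulrC.
Qed.

Lemma meval_image_act w p : w \in X -> (act rV w p).@[gv 0] = p.@[gv 0].
Proof. by move=> wX; rewrite meval_act image_pt_fix. Qed.

Lemma affine_act w c : w \in X -> act rV w (affine gv c) = affine gv (rV w *m c).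
Proof.
by move=> wX; rewrite /affine raddfB /= actC act_lin !meval_lin mulmxA image_pt_fix.
Qed.

Lemma vanishes_at_sq_act w p : w \in X ->
  product_span mv mv p -> product_span mv mv (act rV w p).
Proof.
move=> wX; move: p; apply: ps_ind => [|a b|p q pm qm].
- by rewrite raddf0; exact: ps0.
- by rewrite raddfD; exact: psD.
by rewrite rmorphM; apply: psI; rewrite /vanishes_at meval_image_act.
Qed.

Lemma positive_mv_ideal : mem_ideal (product_span mv I).
Proof. by apply: ps_ideal => c a; exact: (idealMl _ kernel_ideal). Qed.

(* Averaging over X, the hypothesis at 0 lets X act trivially on the fibre of the
   conormal module I/I^2 at the image of v. *)
Lemma kernel_act_local w f : w \in X -> I f -> product_span mv I (act rV w f - f).
Proof.
move=> wX If; pose Y f := forall w, w \in X -> product_span mv I (act rV w f - f).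
suff: Y f by apply.
have iM := positive_mv_ideal; have iI := kernel_ideal.
have Y0 : Y 0 by move=> x _; rewrite raddf0 subrr; exact: ps0.
have YD p q : Y p -> Y q -> Y (p + q).
  move=> Yp Yq x xX; have -> : act rV x (p + q) - (p + q) =
    (act rV x p - p) + (act rV x q - q) by rewrite raddfD /=; ring.
  exact: psD (Yp x xX) (Yq x xX).
move: f If; apply: (@graded_ind _ _ wt I Y) => //; first exact: kernel_graded.
move=> e f fh If IH.
pose avg := mean rV X f.
have avgI : I avg by apply: mean_ideal => // g gX; apply: kernel_act => //; exact: (subsetP sXW).
have fM : product_span (positive_part wt) I (f - avg).
  have -> : f - avg = - ((#|X|%:R^-1)%:MP * \sum_(g in X) (act rV g f - f)).
    rewrite sumrB sumr_const -/(trace rV X f) mulrBr opprB !mul_mpolyC -/(mean rV X f).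
    rewrite -[f *+ _]scaler_nat scalerA mulVf ?scale1r //.
    exact: natr_card_neq0.
  have iP : mem_ideal (product_span (positive_part wt) I).
    by apply: ps_ideal => c a; exact: (idealMl _ iI).
  apply: (idealN iP); apply: (idealMl _ iP); apply: (ideal_sum iP) => g gX; exact: X_trivial.
(* The second summand is X-invariant. The first is handled by weight: the component of weight e of f
   - avg involves only relations of weight less than e. *)
have -> : f = component wt e (f - avg) + component wt e avg.
  by rewrite -componentD subrK (component_homogeneous _ fh) eqxx.
apply: (YD); last first.
  have cI : invariant rV X avg by apply: mean_invariant.
  move=> x xX; have -> : act rV x (component wt e avg) = component wt e (act rV x avg).
    apply/esym/component_morph => j; rewrite /= actE mx_actX.
    apply: homogeneous_sum => i _; have [->|rji] := eqVneq (rV x i j) 0.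
      by rewrite scale0r; exact: homogeneous0.
    (* [rV x] mixes only generators of equal weight: compare components of weight [wt i] in the
       expansion of x applied to [gen j] and use [gen_free]. *)
    suff <- : wt i = wt j by apply: homogeneousZ; exact: homogeneousXU.
    apply/eqP/contraT => neq_wt; case/negP: rji; apply/eqP.
    have xW := subsetP sXW _ xX.
    have E := congr1 (component d (wt i)) (gen_act j xW).
    rewrite (component_act char0 grW) // (component_homogeneous _ (gen_h (i := j))) in E.
    rewrite eq_sym (negbTE neq_wt) raddf0 component_sum in E.
    have : forall l, (if wt l == wt i then rV x l j else 0) = 0.
      apply: gen_free; rewrite [X in product_span _ _ X](_ : _ = 0); first exact: ps0.
      rewrite [RHS]E; apply: eq_bigr => l _.
      rewrite componentZ (component_homogeneous _ (gen_h (i := l))).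
      by case: eqP => _; rewrite ?scaler0 ?scale0r.
    by move=> /(_ i); rewrite eqxx.
  by rewrite cI // subrr; exact: ps0.
apply: (@ps_component _ _ wt (positive_part wt) I Y e) fM => //.
- by apply: positive_graded.
- exact: kernel_graded.
- exact: positive_comp0.
move=> i j a q i0 ij _ qh _ Iq x xX.
(* Leibniz rule: the first term is covered by induction on the weight, and in the second x a - a
   vanishes at [gv] because x fixes this point. Here the ideal of 0 is exchanged for that of
   [gv]. *)
have -> : act rV x (a * q) - a * q =
    act rV x a * (act rV x q - q) + (act rV x a - a) * q by rewrite rmorphM /=; ring.
apply: (psD (Q := I)); first apply: (idealMl _ iM).
  by apply: (IH j) => //; rewrite -ij -[X in (X < _)%N]add0n ltn_add2r.
by apply: psI => //; rewrite /vanishes_at mevalB meval_image_act // subrr.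
Qed.

Context (K : {group gT}) (sKG : K \subset G).
Context (stabP : forall g, g \in G -> (v *m rW g == v) = (g \in K)).

Lemma vanishing_lift p : vanishing rW v G p -> exists2 a, mv a & p = subst gen a.
Proof.
move=> [pG pv]; have [a E] := presentation_surjective char0 d_gt0 grW sGW gen_h gen_span pG.
by exists a => //; rewrite /vanishes_at meval_image -E.
Qed.

(** A covector that dies in the cotangent space of the quotient by K is the linear term of a
    relation: by [etale_square] its pullback is in the square for G, which lifts to F in the square
    of [mv], and the relation is the difference. *)
Lemma affine_kernel (c : 'cV[k]_N) :
    product_span (vanishing rW v K) (vanishing rW v K) (subst gen (affine gv c)) ->
  exists2 f, I f & product_span mv mv (f - affine gv c).
Proof.
move=> cK; have cG : invariant rW G (subst gen (affine gv c)) by apply: subst_invariant.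
have := etale_square char0 sGW sKG stabP cG cK.
have lift b : product_span (vanishing rW v G) (vanishing rW v G) b ->
    exists2 F, product_span mv mv F & b = subst gen F.
  move: b; apply: ps_ind => [|a b [F Fm ->] [F' Fm' ->]|p q /vanishing_lift[F Fm ->] /vanishing_lift[F' Fm' ->]].
  - by exists 0; [exact: ps0 | rewrite raddf0].
  - by exists (F + F'); [exact: psD | rewrite raddfD].
  by exists (F * F'); [exact: psI | rewrite rmorphM].
move=> /lift[F Fm E]; exists (affine gv c - F); first by rewrite /kernel raddfB /= E subrr.
rewrite addrAC subrr sub0r; exact: (idealN (vanishes_at_sq_ideal _)).
Qed.

(** Let f be a relation with linear term c. Then w f - f is in [mv] times I, hence in the square of
    [mv], so w does not move c. *)
Lemma affine_act_trivial (c : 'cV[k]_N) w : w \in X ->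
    product_span (vanishing rW v K) (vanishing rW v K) (subst gen (affine gv c)) ->
  rV w *m c = c.
Proof.
move=> wX /affine_kernel[f If fc]; apply/eqP; rewrite -subr_eq0; apply/eqP.
have i2 := vanishes_at_sq_ideal gv.
apply: (@affine_sq_eq0 _ _ gv); rewrite affineB -affine_act //.
have -> : act rV w (affine gv c) - affine gv c =
    (act rV w f - f) - (act rV w (f - affine gv c) - (f - affine gv c)).
  by rewrite [act rV w (f - _)]raddfB /=; ring.
apply: (idealB i2); last by apply: (idealB i2) => //; exact: vanishes_at_sq_act.
apply: ps_mono (kernel_act_local wX If) => // a; exact: kernel_vanishes.
Qed.

End LocalKernel.

Section GenericVector.
Context (k : fieldType) (char0 : [pchar k] =i pred0) (n : nat).
Context (gT : finGroupType) (W : {group gT}) (rW : mx_representation k W n).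

(** Each g not fixing all of L fixes only a proper subspace of it, and v avoids these finitely many
    subspaces. *)
Lemma generic_vector l (L : 'M[k]_(l, n)) : exists2 v : 'rV[k]_n, (v <= L)%MS &
  forall g, g \in W -> v *m rW g = v -> L *m rW g = L.
Proof.
have ex_c g : exists c : 'cV[k]_l, L *m rW g != L -> c != 0 /\ exists j, c = col j (L *m rW g - L).
  have [E|E] := eqVneq (L *m rW g) L; first by exists 0.
  have /matrix0Pn[i [j ij]] : L *m rW g - L != 0 by rewrite subr_eq0.
  exists (col j (L *m rW g - L)) => _; split; last by exists j.
  by apply/matrix0Pn; exists i, 0; rewrite mxE.
have [c cP] := choice ex_c.
have [|u uP] := @avoid_hyperplanes k char0 l [seq c g | g <- enum W & L *m rW g != L].
  by move=> x /mapP[g]; rewrite mem_filter => /andP[/cP[c0 _] _] ->.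
exists (u *m L); first exact: submxMl.
move=> g gW vg; apply/eqP/contraT => Lg.
have /negP[] : (u *m c g) 0 0 != 0.
  by apply: uP; apply: map_f; rewrite mem_filter Lg mem_enum.
have [_ [j ->]] := cP g Lg; apply/eqP.
by rewrite colE mulmxA mulmxBr mulmxA vg subrr mul0mx mxE.
Qed.

End GenericVector.

Section ReflectionImage.
Context (k : fieldType) (char0 : [pchar k] =i pred0) (n : nat).
Context (d : 'I_n -> nat) (d_gt0 : forall i, (0 < d i)%N).
Context (gT : finGroupType) (W : {group gT}) (rW : mx_representation k W n).
Context (grW : graded_repr d rW) (G : {group gT}) (sGW : G \subset W).
Context (N : nat) (wt : 'I_N -> nat) (gen : 'I_N -> {mpoly k[n]}).
Local Notation V := (vanishing rW 0 G).
Context (gen_h : forall i, homogeneous d (wt i) (gen i)) (gen_van : forall i, V (gen i)).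
Context (gen_span : forall b, V b -> exists c : 'I_N -> k, product_span V V (b - \sum_i c i *: gen i)).
Context (gen_free : forall c : 'I_N -> k, product_span V V (\sum_i c i *: gen i) -> forall i, c i = 0).
Context (rV : mx_representation k W N).
Context (gen_act : forall w i, w \in W -> act rW w (gen i) = \sum_j rV w j i *: gen j).
Context (W_trivial : forall w a, w \in W -> kernel gen a ->
  product_span (positive_part wt) (kernel gen) (act rV w a - a)).
Local Notation B := {mpoly k[n]}.
Local Notation act := (act rW).

(* Functions invariant under a group fixing a hyperplane pointwise are, near a
   generic point of it, functions of l^e and of coordinates on the hyperplane. *)
Lemma hyperplane_invariants (K : {group gT}) (c : 'cV[k]_n) : K \subset W -> c != 0 ->
    (forall g, g \in K -> kermx c *m rW g = kermx c) ->
  exists e, [/\ (0 < e)%N, invariant rW K (lin c ^+ e) &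
    forall p, invariant rW K p -> ldiv c p ->
      exists2 q, invariant rW K q & p = lin c ^+ e * q].
Proof.
move=> sKW c0 Kc; have lc0 : lin c != 0 by rewrite lin_eq0.
have /row_fullP[u uc] : row_full c.
  by rewrite /row_full eqn_leq rank_leq_col lt0n mxrank_eq0.
(* As u c = 1, the rows of 1 - c u lie in [kermx c], which g fixes; so g - 1 is c times a row. *)
have gE g : g \in K -> rW g - 1%:M = c *m (u *m (rW g - 1%:M)).
  move=> gK; apply/eqP; rewrite -subr_eq0 mulmxA -[X in X - _]mul1mx -mulmxBl.
  have /submxP[D ->] : (1%:M - c *m u <= kermx c)%MS.
    by rewrite sub_kermx mulmxBl mul1mx -mulmxA uc mulmx1 subrr.
  by rewrite -mulmxA mulmxBr Kc // mulmx1 subrr mulmx0.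
have gl g : g \in K -> forall p, ldiv c (act g p - p).
  by move=> gK; exact: act_sub_ldiv (gE g gK).
have ex_chi g : exists x : k, g \in K -> rW g *m c = x *: c.
  exists (1 + (u *m (rW g - 1%:M) *m c) 0 0) => gK.
  have -> : rW g *m c = c + (rW g - 1%:M) *m c by rewrite mulmxBl mul1mx addrC subrK.
  rewrite {1}(gE g gK) -[c *m _ *m c]mulmxA [X in c *m X]mx11_scalar mul_mx_scalar.
  by rewrite scalerDl scale1r.
have [chi chiP] := choice ex_chi.
have actl g : g \in K -> act g (lin c) = chi g *: lin c.
  by move=> gK; rewrite act_lin chiP // linZ.
(* The least such j is the order of the character by which K acts on c: the ramification index. *)
pose ok j := (0 < j)%N && [forall g in K, chi g ^+ j == 1].
have ex_ok : exists j, ok j.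
  exists #|K|; rewrite /ok cardG_gt0; apply/forall_inP => g gK.
  have E m : rW (g ^+ m)%g *m c = chi g ^+ m *: c.
    elim: m => [|m IH]; first by rewrite repr_mx1 mul1mx scale1r.
    rewrite expgS repr_mxM ?groupX ?(subsetP sKW) // -mulmxA IH -scalemxAr chiP //.
    by rewrite scalerA exprSr.
  have /eqP gK1 : (g ^+ #|K|)%g == 1%g by rewrite -order_dvdn order_dvdG.
  have := E #|K|; rewrite gK1 repr_mx1 mul1mx => /eqP.
  rewrite eq_sym -subr_eq0 -[X in _ - X]scale1r -scalerBl scaler_eq0 (negbTE c0) orbF.
  by rewrite subr_eq0.
have [e /andP[e0 /forall_inP eK] mine] := ex_minnP ex_ok.
have leI : invariant rW K (lin c ^+ e).
  by move=> g gK; rewrite rmorphXn /= actl // exprZn (eqP (eK g gK)) scale1r.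
exists e; split=> // p pI lp.
(* If p = l^i p1 with i < e, some g has chi(g)^i different from 1. Invariance of p gives chi(g)^i
   g(p1) = p1, while g(p1) = p1 modulo l; hence l divides p1. *)
have div j : (j < e)%N -> exists q, p = lin c ^+ j.+1 * q.
  elim: j => [|j IH] lt_je; first by have [q ->] := lp; exists q; rewrite expr1 mulrC.
  have [p1 pE] := IH (ltnW lt_je).
  have /forall_inPn[g gK chij] : ~~ [forall g in K, chi g ^+ j.+1 == 1].
    by apply: contraL lt_je => H; rewrite -leqNgt; apply: mine; rewrite /ok H.
  have E : chi g ^+ j.+1 *: act g p1 = p1.
    apply: (mulfI (expf_neq0 j.+1 lc0)); rewrite -pE -[RHS](pI g gK) pE.
    by rewrite rmorphM rmorphXn /= actl // exprZn -scalerAl scalerAr.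
  have [q qE] := gl g gK p1.
  have chi1 : 1 - chi g ^+ j.+1 != 0 by rewrite subr_eq0 eq_sym.
  exists ((1 - chi g ^+ j.+1)^-1 *: (chi g ^+ j.+1 *: q)).
  rewrite pE [in RHS]exprSr -mulrA; congr (_ * _).
  apply: (scalerI chi1); rewrite -!scalerAr [RHS]scalerA mulfV // scale1r.
  rewrite scalerBl scale1r -{1}E -scalerBr qE; congr (_ *: _); exact: mulrC.
have [q pE] : exists q, p = lin c ^+ e * q by have := div e.-1; rewrite prednK //; apply.
exists q => // g gK; apply: (mulfI (expf_neq0 e lc0)).
by rewrite -{1}(leI g gK) -rmorphM /= -pE pI.
Qed.

(** At a generic v of the hyperplane, the pullback of (s - 1) x is l^e times an invariant with value
    [kap *m x] at v. If this value is 0, the pullback is a product of two K-invariants vanishing at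
    v, so s fixes (s - 1) x, which is then 0. Thus s - 1 factors through the single form [kap]. *)
Lemma reflection_image_rank s : is_reflection rW s -> (\rank (rV s - 1%:M)%R <= 1)%N.
Proof.
move=> sR; have sW : s \in W by case/andP: sR.
have [c c0 cd] := reflection_lin sR.
have [v vc vgen] := generic_vector char0 rW (kermx c).
have {}vc : v *m c = 0 by apply/sub_kermxP.
have vs : v *m rW s = v.
  apply/rowP => i; apply/eqP; rewrite -subr_eq0; apply/eqP.
  have [q /(congr1 (meval (v 0)))] := cd 'X_i.
  rewrite mevalB meval_act !mevalXU => ->.
  by rewrite mevalM meval_lin vc [X in _ * X]mxE mulr0.
pose K := (rstab_group rW v :&: G)%G.
have sKG : K \subset G := subsetIr _ _.
have sKW : K \subset W := subset_trans sKG sGW.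
have stabP g : g \in G -> (v *m rW g == v) = (g \in K).
  by move=> gG; rewrite !inE gG andbT (subsetP sGW).
have Kc g : g \in K -> kermx c *m rW g = kermx c.
  move=> gK; have gG := subsetP sKG _ gK; apply: vgen; first exact: (subsetP sGW).
  by apply/eqP; rewrite stabP.
have sXW : <[s]>%g \subset W by rewrite cycle_subG.
have Xv w : w \in <[s]>%G -> v *m rW w = v.
  case/cycleP=> m ->; elim: m => [|m IH]; first by rewrite repr_mx1 mulmx1.
  by rewrite expgS repr_mxM ?groupX // mulmxA vs IH.
have sX : s \in <[s]>%G by exact: cycle_id.
have X_trivial w a (wX : w \in <[s]>%G) := W_trivial (a := a) (subsetP sXW _ wX).
have star (x : 'cV[k]_N) := affine_act_trivial char0 d_gt0 grW sGW gen_h gen_van gen_span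
  gen_free gen_act sXW Xv X_trivial sKG stabP (c := x) sX.
have [e [e0 leK divK]] := hyperplane_invariants sKW c0 Kc.
pose gv := image_pt gen v.
have imgE (x : 'cV[k]_N) : subst gen (affine gv (rV s *m x - x)) =
    act s (subst gen (affine gv x)) - subst gen (affine gv x).
  by rewrite affineB -(affine_act gen_act sXW Xv) // raddfB /= (subst_act gen_act).
have ex_q i : exists q, invariant rW K q /\
    subst gen (affine gv (rV s *m delta_mx i 0 - delta_mx i 0)) = lin c ^+ e * q.
  have [|| q qK qE] := divK (subst gen (affine gv (rV s *m delta_mx i 0 - delta_mx i 0))).
  - by apply: invariantS sKG _; exact: subst_invariant.
  - by rewrite imgE; exact: cd.
  by exists q.
have [q qP] := choice ex_q.
pose kap : 'rV[k]_N := \row_i (q i).@[v 0].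
have kapP (x : 'cV[k]_N) : kap *m x = 0 -> rV s *m x = x.
  move=> kx; apply/eqP; rewrite -subr_eq0; apply/eqP.
  have -> : rV s *m x - x = (rV s - 1%:M) *m x by rewrite mulmxBl mul1mx.
  apply: (repr_unipotent char0 sW); rewrite mulmxBl mul1mx; apply/eqP; rewrite subr_eq0; apply/eqP.
  apply: star; rewrite mulmxBl mul1mx.
  have -> : rV s *m x - x = \sum_i x i 0 *: (rV s *m delta_mx i 0 - delta_mx i 0).
    rewrite {1 2}[x]matrix_sum_delta.
    under eq_bigr do rewrite big_ord1; rewrite mulmx_sumr -sumrB; apply: eq_bigr => i _.
    by rewrite scalerBr scalemxAr.
  have -> : subst gen (affine gv (\sum_i x i 0 *: (rV s *m delta_mx i 0 - delta_mx i 0))) =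
      lin c ^+ e * \sum_i x i 0 *: q i.
    rewrite affine_lincomb raddf_sum mulr_sumr; apply: eq_bigr => i _ /=.
    by rewrite linearZ /= (proj2 (qP i)) scalerAr.
  apply: psI; split=> //.
  - by rewrite rmorphXn /= meval_lin vc mxE expr0n eqn0Ngt e0.
  - by apply: invariant_sum => i _; apply: invariantZ; case: (qP i).
  move/matrixP/(_ 0 0): kx; rewrite [LHS]mxE [RHS]mxE => kx; rewrite raddf_sum -[RHS]kx.
  by apply: eq_bigr => i _; rewrite /= mevalZ mxE mulrC.
have /submxP[D ->] : (rV s - 1%:M <= kap)%MS.
  rewrite submxE mulmxBl mul1mx subr_eq0; apply/eqP/matrixP => i j.
  have /colP/(_ i) : col j (rV s *m cokermx kap) = col j (cokermx kap).
    rewrite colE -mulmxA -colE; apply: kapP.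
    by rewrite colE mulmxA mulmx_coker mul0mx.
  by rewrite [LHS]mxE [RHS]mxE.
exact: leq_trans (mxrankM_maxr _ _) (rank_leq_row _).
Qed.

End ReflectionImage.

(** * Conormal modules at v and at 0 *)

Section LocalComparison.
Context (k : fieldType) (char0 : [pchar k] =i pred0) (n : nat).
Context (d : 'I_n -> nat) (d_gt0 : forall i, (0 < d i)%N).
Context (gT : finGroupType) (W : {group gT}) (rW : mx_representation k W n).
Context (grW : graded_repr d rW) (G : {group gT}) (sGW : G \subset W).
Context (N : nat) (wt : 'I_N -> nat) (gen : 'I_N -> {mpoly k[n]}).
Local Notation V := (vanishing rW 0 G).
Context (gen_h : forall i, homogeneous d (wt i) (gen i)) (gen_van : forall i, V (gen i)).
Context (gen_span : forall b, V b -> exists c : 'I_N -> k, product_span V V (b - \sum_i c i *: gen i)).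
Context (gen_free : forall c : 'I_N -> k, product_span V V (\sum_i c i *: gen i) -> forall i, c i = 0).
Context (rV : mx_representation k W N).
Context (gen_act : forall w i, w \in W -> act rW w (gen i) = \sum_j rV w j i *: gen j).
Context (v : 'rV[k]_n) (X : {group gT}) (sXW : X \subset W).
Context (Xv : forall w, w \in X -> v *m rW w = v).
Local Notation I := (kernel gen).
Context (X_trivial : forall w a, w \in X -> I a ->
  product_span (positive_part wt) I (act rV w a - a)).
Context (K : {group gT}) (sKG : K \subset G) (sKX : K \subset X).
Context (stabP : forall g, g \in G -> (v *m rW g == v) = (g \in K)).
Context (M : nat) (wtL : 'I_M -> nat) (h : 'I_M -> {mpoly k[n]}).
Local Notation VK := (vanishing rW 0 K).
Context (h_h : forall i, homogeneous d (wtL i) (h i)) (h_van : forall i, VK (h i)).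
Context (h_span : forall b, VK b -> exists c : 'I_M -> k, product_span VK VK (b - \sum_i c i *: h i)).
Context (h_free : forall c : 'I_M -> k, product_span VK VK (\sum_i c i *: h i) -> forall i, c i = 0).
Context (rL : mx_representation k X M).
Context (h_act : forall w i, w \in X -> act rW w (h i) = \sum_j rL w j i *: h j).
Local Notation B := {mpoly k[n]}.
Local Notation A := {mpoly k[N]}.
Local Notation AL := {mpoly k[M]}.
Local Notation gv := (image_pt gen v).
Local Notation mv := (vanishes_at gv).
Local Notation Vv := (vanishing rW v).
Local Notation IL := (kernel h).

Let sKW : K \subset W := subset_trans sKG sGW.
Let wtL_gt0 i : (0 < wtL i)%N := generator_wt_gt0 d_gt0 h_h h_van h_free i.

Lemma lift_invariant p : invariant rW K p -> exists a, p = subst h a.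
Proof. exact: (presentation_surjective char0 d_gt0 grW sKW h_h h_span). Qed.

Lemma meval0_substK a : (subst h a).@[(0 : 'rV_n) 0] = a.@[fun=> 0].
Proof. exact: (meval0_subst h_van). Qed.

Lemma substK_invariant a : invariant rW K (subst h a).
Proof. exact: (subst_invariant h_van). Qed.

Lemma substK_act w a : w \in X -> act rW w (subst h a) = subst h (act rL w a).
Proof.
move=> wX; apply: (mpoly_rmorph_eq (f := act rW w \o subst h) (g := subst h \o act rL w)) => [c|i] /=.
  by rewrite !actC !substC actC.
rewrite substX h_act // [in RHS]actE mx_actX raddf_sum; apply: eq_bigr => j _.
by rewrite /= linearZ /= substX.
Qed.

(** Translation by v. It commutes with X, which fixes v, and it carries the K-invariants vanishing
    at v to those vanishing at 0, where the homogeneous generators h are available. *)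
Definition shift : B -> B := subst (fun i => 'X_i + (v 0 i)%:MP).
Definition unshift : B -> B := subst (fun i => 'X_i - (v 0 i)%:MP).
HB.instance Definition _ := GRing.LRMorphism.copy shift (subst (fun i => 'X_i + (v 0 i)%:MP)).
HB.instance Definition _ := GRing.LRMorphism.copy unshift (subst (fun i => 'X_i - (v 0 i)%:MP)).

Lemma unshiftK p : shift (unshift p) = p.
Proof.
move: p; apply: (mpoly_rmorph_eq (f := shift \o unshift) (g := idfun)) => [c|i] /=.
  by rewrite /shift /unshift !substC.
by rewrite /unshift substX raddfB /= /shift substX substC addrK.
Qed.

Lemma shiftK p : unshift (shift p) = p.
Proof.
move: p; apply: (mpoly_rmorph_eq (f := unshift \o shift) (g := idfun)) => [c|i] /=.
  by rewrite /shift /unshift !substC.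
by rewrite /shift substX raddfD /= /unshift substX substC subrK.
Qed.

Lemma meval_shift p : (shift p).@[(0 : 'rV_n) 0] = p.@[v 0].
Proof.
rewrite /shift meval_subst; apply: meval_eq => i.
by rewrite mevalD mevalXU mevalC mxE add0r.
Qed.

Lemma act_shift w p : w \in X -> act rW w (shift p) = shift (act rW w p).
Proof.
move=> wX; move: p; apply: (mpoly_rmorph_eq (f := act rW w \o shift) (g := shift \o act rW w)) => [c|i] /=.
  by rewrite /shift actC !substC actC.
rewrite /shift substX raddfD /= actC actE mx_actX [in RHS]raddf_sum /=.
under [in RHS]eq_bigr do rewrite linearZ /= substX scalerDr.
rewrite big_split /=; congr (_ + _); move/rowP/(_ i): (Xv wX); rewrite mxE => <-.
by rewrite [LHS]raddf_sum; apply: eq_bigr => j _; rewrite /= mpolyCM mulrC mul_mpolyC.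
Qed.

Lemma shift_invariant p : invariant rW K p -> invariant rW K (shift p).
Proof. by move=> pK g gK; rewrite act_shift ?pK // (subsetP sKX). Qed.

Lemma unshift_invariant p : invariant rW K p -> invariant rW K (unshift p).
Proof.
move=> pK g gK; rewrite -[act rW g _]shiftK -act_shift ?(subsetP sKX) // unshiftK pK //.
Qed.

Lemma shift_vanishing p : Vv K p -> VK (shift p).
Proof. by move=> [pK pv]; split; [exact: shift_invariant | rewrite meval_shift]. Qed.

Lemma unshift_vanishing p : VK p -> Vv K (unshift p).
Proof.
move=> [pK pv]; split; first exact: unshift_invariant.
by rewrite -meval_shift unshiftK.
Qed.

Lemma shift_sq p : product_span (Vv K) (Vv K) p -> product_span VK VK (shift p).
Proof.
move: p; apply: ps_ind => [|a b|p q /shift_vanishing pV /shift_vanishing qV].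
- by rewrite raddf0; exact: ps0.
- by rewrite raddfD; exact: psD.
by rewrite rmorphM; exact: psI.
Qed.

Lemma unshift_sq p : product_span VK VK p -> product_span (Vv K) (Vv K) (unshift p).
Proof.
move: p; apply: ps_ind => [|a b|p q /unshift_vanishing pV /unshift_vanishing qV].
- by rewrite raddf0; exact: ps0.
- by rewrite raddfD; exact: psD.
by rewrite rmorphM; exact: psI.
Qed.

Lemma psZ P (a : k) p : (forall q, P q -> P (a *: q)) -> product_span P P p ->
  @product_span B P P (a *: p).
Proof.
move=> PZ; move: p; apply: ps_ind => [|x y|p q Pp Pq].
- by rewrite scaler0; exact: ps0.
- by rewrite scalerDr; exact: psD.
by rewrite scalerAl; apply: psI => //; exact: PZ.
Qed.

Lemma vanishingZ u (H : {set gT}) a p : vanishing rW u H p -> vanishing rW u H (a *: p).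
Proof.
move=> [pH pu]; split; last by rewrite mevalZ pu mulr0.
by move=> g gH; rewrite linearZ /= pH.
Qed.

Lemma ps_vanishing_sub u p q : product_span (vanishing rW u K) (vanishing rW u K) p ->
  product_span (vanishing rW u K) (vanishing rW u K) q ->
  product_span (vanishing rW u K) (vanishing rW u K) (p - q).
Proof.
move=> pV qV; apply: psD => //; rewrite -scaleN1r; apply: psZ => // x; exact: vanishingZ.
Qed.

(* Coordinates of covectors at the image of v on the covectors at 0. *)
Lemma conormal_matrix : exists D : 'M[k]_(M, N), forall c : 'cV_N,
  product_span VK VK (shift (subst gen (affine gv c)) - \sum_j (D *m c) j 0 *: h j).
Proof.
have genv i : VK (shift (subst gen (affine gv (delta_mx i 0)))).
  apply: shift_vanishing; split; first by apply: invariantS sKG _; exact: subst_invariant.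
  by rewrite -meval_image; exact: affine_vanishes.
have [D DP] := choice (fun i => h_span (genv i)).
exists (\matrix_(j, i) D i j) => c.
have -> : shift (subst gen (affine gv c)) - \sum_j ((\matrix_(j, i) D i j) *m c) j 0 *: h j =
    \sum_i c i 0 *: (shift (subst gen (affine gv (delta_mx i 0))) - \sum_j D i j *: h j).
  under [RHS]eq_bigr do rewrite scalerBr scaler_sumr.
  rewrite sumrB exchange_big; congr (_ - _).
    rewrite {1}[c]matrix_sum_delta; under eq_bigr do rewrite big_ord1.
    rewrite affine_lincomb [subst gen _]raddf_sum [shift _]raddf_sum; apply: eq_bigr => i _.
    by rewrite /= 2!linearZ.
  apply: eq_bigr => j _; rewrite mxE scaler_suml; apply: eq_bigr => i _.
  by rewrite mxE scalerA mulrC.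
apply: (big_ind (product_span VK VK)) => [||i _]; [exact: ps0 | exact: psD |].
by apply: psZ => // q; exact: vanishingZ.
Qed.

(** A G-invariant vanishing at v lifts to a polynomial vanishing at [gv], and Taylor expansion there
    brings out the gen_i - gen_i(v). P is the kind of coefficients to be preserved: K-invariant, or
    arbitrary. *)
Lemma span_vanishing_gen (P : B -> Prop) p : P 0 ->
    (forall a b, P a -> P b -> P (a + b)) -> (forall a b, invariant rW G a -> P b -> P (a * b)) ->
    product_span (Vv G) P p ->
  exists2 E : 'I_N -> B, forall i, P (E i) & p = \sum_i E i * (gen i - (gv 0 i)%:MP).
Proof.
move=> P0 PD PM; move: p; apply: ps_ind.
- by exists (fun=> 0) => //; rewrite big1 // => i _; rewrite mul0r.
- move=> _ _ [E EP ->] [E' EP' ->]; exists (fun i => E i + E' i); first by move=> i; apply: PD.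
  by rewrite -big_split; apply: eq_bigr => i _; rewrite mulrDl.
move=> r c rVv cP; have [F Fm rE] :=
  vanishing_lift char0 d_gt0 grW sGW gen_h gen_span rVv.
have [F' FE] := mpoly_taylor F (gv 0); rewrite Fm mpolyC0 subr0 in FE.
exists (fun i => subst gen (F' i) * c) => [i|].
  by apply: PM => //; exact: subst_invariant.
rewrite rE FE raddf_sum mulr_suml; apply: eq_bigr => i _ /=.
by rewrite rmorphM raddfB /= substX substC; ring.
Qed.

Lemma gen_sub_invariant i : invariant rW G (gen i - (gv 0 i)%:MP).
Proof. by apply: invariantB; [case: (gen_van i) | exact: invariantC]. Qed.

Lemma gen_sub_vanishing i : Vv G (gen i - (gv 0 i)%:MP).
Proof. by split; [exact: gen_sub_invariant | rewrite mevalB mevalC mxE subrr]. Qed.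

Lemma subst_affine c : subst gen (affine gv c) = \sum_i c i 0 *: (gen i - (gv 0 i)%:MP).
Proof.
rewrite /affine raddfB /= substC subst_lin meval_lin mxE [_%:MP]raddf_sum -sumrB.
by apply: eq_bigr => i _; rewrite /= scalerBr mulrC -mul_mpolyC mpolyCM mul_mpolyC mul_mpolyC.
Qed.

Section Idempotent.
Context (e : B) (eK : invariant rW K e) (ev : e.@[v 0] = 1).
Context (eQ : forall g, g \in G -> g \notin K -> span_ideal (Vv G) (e * act rW g e)).

Lemma etale_expand p : Vv K p -> exists2 E : 'I_N -> B, forall i, invariant rW K (E i) &
  e * p = \sum_i E i * (gen i - (gv 0 i)%:MP).
Proof.
move=> [pK pv]; apply: span_vanishing_gen.
- exact: invariant0.
- by move=> a b; exact: invariantD.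
- by move=> a b aG bK; apply: invariantM => //; exact: invariantS aG.
apply: (span_vanishing_mean char0 sGW sKG (invariantM eK pK)).
by have := etale_local char0 sGW sKG eK ev eQ pK; rewrite pv scale0r subr0.
Qed.

Lemma etale_expand_linear p : Vv K p ->
  exists c : 'cV[k]_N, product_span (Vv K) (Vv K) (p - subst gen (affine gv c)).
Proof.
move=> pV; have [E EK eE] := etale_expand pV; exists (\col_i (E i).@[v 0]).
have -> : p - subst gen (affine gv (\col_i (E i).@[v 0])) =
    (1 - e) * p + \sum_i (E i - ((E i).@[v 0])%:MP) * (gen i - (gv 0 i)%:MP).
  under [in RHS]eq_bigr do rewrite mulrBl mul_mpolyC.
  rewrite sumrB -eE subst_affine.
  under [in LHS]eq_bigr do rewrite mxE.
  by ring.
apply: psD.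
  apply: psI => //; split; last by rewrite mevalB meval1 ev subrr.
  by apply: invariantB => //; exact: invariant1.
apply: (big_ind (product_span (Vv K) (Vv K))) => [||i _]; [exact: ps0 | exact: psD |].
apply: psI; last by case: (gen_sub_vanishing i) => qG qv; split=> //; exact: invariantS qG.
split; last by rewrite mevalB mevalC subrr.
by apply: invariantB => //; exact: invariantC.
Qed.

End Idempotent.

Section Conormal.
Context (D : 'M[k]_(M, N)) (DP : forall c : 'cV_N,
  product_span VK VK (shift (subst gen (affine gv c)) - \sum_j (D *m c) j 0 *: h j)).

Lemma conormal_kernel (c : 'cV_N) : D *m c = 0 ->
  product_span (Vv K) (Vv K) (subst gen (affine gv c)).
Proof.
move=> Dc; rewrite -[subst gen _]shiftK; apply: unshift_sq.
have := DP c; rewrite Dc big1 ?subr0 // => j _; by rewrite mxE scale0r.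
Qed.

Lemma h_uniq (c c' : 'cV[k]_M) p : product_span VK VK (p - \sum_j c j 0 *: h j) ->
  product_span VK VK (p - \sum_j c' j 0 *: h j) -> c = c'.
Proof.
move=> pc pc'; apply/colP => j; apply/eqP; rewrite -subr_eq0; apply/eqP; move: j.
apply: h_free; have := ps_vanishing_sub pc' pc; rewrite opprB addrC addrA subrK.
by rewrite -sumrB; under eq_bigr do rewrite -scalerBl.
Qed.

(** The cotangent map is onto: modulo the square at v, h_j translated to v equals e times itself,
    and this product expands on the gen_i - gen_i(v). *)
Lemma conormal_surj : exists E : 'M[k]_(N, M), D *m E = 1%:M.
Proof.
have [e [eK ev eQ]] := etale_idempotent sGW sKG stabP.
have [E EP] := choice (fun j => etale_expand_linear eK ev eQ (unshift_vanishing (h_van j))).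
exists (\matrix_(i, j) E j i 0); apply/matrixP => l j.
have ED : D *m E j = delta_mx j 0.
  apply: (h_uniq (p := h j)).
    have -> : h j - \sum_j0 (D *m E j) j0 0 *: h j0 =
        shift (unshift (h j) - subst gen (affine gv (E j))) +
        (shift (subst gen (affine gv (E j))) - \sum_j0 (D *m E j) j0 0 *: h j0).
      by rewrite [shift (_ - _)]raddfB /= unshiftK; ring.
    by apply: psD; [apply: shift_sq; exact: EP | exact: DP].
  rewrite (bigD1 j) //= mxE !eqxx scale1r big1 ?addr0 ?subrr; first exact: ps0.
  by move=> l' /negbTE ne; rewrite mxE ne scale0r.
have -> : (D *m \matrix_(i, j) E j i 0) l j = (D *m E j) l 0.
  by rewrite !mxE; apply: eq_bigr => i _; rewrite mxE.
by rewrite ED !mxE eqxx andbT.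
Qed.

Lemma vanishingK_act w p : w \in X -> VK p -> VK (act rW w p).
Proof.
move=> wX [pK p0]; have [a pE] := lift_invariant pK.
split; first by rewrite pE substK_act //; exact: substK_invariant.
by rewrite meval_act mul0mx.
Qed.

Lemma vanishingK_sq_act w p : w \in X ->
  product_span VK VK p -> product_span VK VK (act rW w p).
Proof.
move=> wX; move: p; apply: ps_ind => [|a b|p q pV qV].
- by rewrite raddf0; exact: ps0.
- by rewrite raddfD; exact: psD.
by rewrite rmorphM; apply: psI; exact: vanishingK_act.
Qed.

Lemma conormal_equivariant w : w \in X -> rL w *m D = D *m rV w.
Proof.
move=> wX; apply/matrixP => l i.
suff E (c : 'cV_N) : rL w *m (D *m c) = D *m (rV w *m c).
  have /colP/(_ l) := E (delta_mx i 0).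
  by rewrite !mulmxA -!colE ![col _ _ _ _]mxE.
apply: (h_uniq (p := act rW w (shift (subst gen (affine gv c))))).
  have := vanishingK_sq_act wX (DP c); congr (product_span _ _ _).
  rewrite [LHS]raddfB; congr (_ - _); rewrite [LHS]raddf_sum /=.
  under eq_bigr do rewrite linearZ /= h_act // scaler_sumr.
  rewrite exchange_big; apply: eq_bigr => j _ /=; rewrite [in RHS]mxE scaler_suml.
  by apply: eq_bigr => j' _; rewrite scalerA mulrC.
have := DP (rV w *m c); congr (product_span _ _ (_ - _)).
rewrite act_shift // -(subst_act gen_act) ?(subsetP sXW) //.
by rewrite (affine_act gen_act sXW Xv).
Qed.

(** D is onto and equivariant, and w acts trivially on its kernel. If D kills (w - 1) z, then (w -
    1)^2 z = 0 and so (w - 1) z = 0: the rank of w - 1 does not drop under D. *)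
Lemma tangent_rank w : w \in X -> \rank (rV w - 1%:M) = \rank (rL w - 1%:M).
Proof.
move=> wX; have wW := subsetP sXW _ wX; have [E DE] := conormal_surj.
have Dfree : row_free D by apply/row_freeP; exists E.
have ED : (rL w - 1%:M) *m D = D *m (rV w - 1%:M).
  by rewrite mulmxBl mulmxBr mul1mx mulmx1 conormal_equivariant.
rewrite -(mxrankMfree (rL w - 1%:M) Dfree) ED.
apply/eqP; rewrite eqn_leq mxrankM_maxr andbT; apply: mxrankS.
rewrite submxE; apply/eqP/matrixP => i j; rewrite [RHS]mxE.
set Z := cokermx _.
suff /colP/(_ i) : (rV w - 1%:M) *m col j Z = 0.
  by rewrite colE mulmxA -colE [LHS]mxE [RHS]mxE.
apply: (repr_unipotent char0 wW).
have DZ : D *m ((rV w - 1%:M) *m col j Z) = 0.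
  by rewrite mulmxA colE mulmxA mulmx_coker mul0mx.
have := affine_act_trivial char0 d_gt0 grW sGW gen_h gen_van gen_span gen_free gen_act
  sXW Xv X_trivial sKG stabP wX (conormal_kernel DZ).
by move=> fixZ; rewrite mulmxBl fixZ mul1mx subrr.
Qed.

End Conormal.

(** * From relations at the image of v to relations at 0 *)

Section ConormalFibre.
Context (Gam : 'I_N -> AL) (GamE : forall i, subst h (Gam i) = shift (gen i)).
Local Notation mL := (fun p : AL => p.@[fun=> 0] = 0).
Local Notation MIL := (product_span (positive_part wtL) IL).

(** [subst Gam] lifts, to the polynomial rings, the inclusion of G-invariants into K-invariants
    followed by translation by v; it takes I to I_L and the point [gv] to 0. *)
Lemma subst_Gam a : subst h (subst Gam a) = shift (subst gen a).
Proof.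
move: a; apply: (mpoly_rmorph_eq (f := subst h \o subst Gam) (g := shift \o subst gen)) => [c|i] /=.
  by rewrite /shift !substC.
by rewrite !substX GamE.
Qed.

Lemma meval0_Gam a : (subst Gam a).@[fun=> 0] = a.@[gv 0].
Proof. by rewrite -meval0_substK subst_Gam meval_shift meval_image. Qed.

Lemma kernel_Gam f : I f -> IL (subst Gam f).
Proof. by move=> If; rewrite /kernel subst_Gam If raddf0. Qed.

Lemma MIL_ideal : mem_ideal MIL.
Proof. by apply: ps_ideal => c a; exact: (idealMl _ (kernel_ideal h)). Qed.

Lemma MILI p q : mL p -> IL q -> MIL (p * q).
Proof. by move=> p0 Iq; apply: psI => //; apply/positive_partP. Qed.

Lemma MIL_Gam f : product_span mv I f -> MIL (subst Gam f).
Proof.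
move: f; apply: ps_ind => [|a b|p q pm Iq].
- by rewrite raddf0; exact: ps0.
- by rewrite raddfD; exact: psD.
by rewrite rmorphM; apply: MILI; [rewrite meval0_Gam | exact: kernel_Gam].
Qed.

(** Factors equal to 1 at 0, such as the lift of e, can be inserted or removed modulo m I_L. *)
Lemma MIL_unit eL a : eL.@[fun=> 0] = 1 -> IL a -> MIL (eL * a - a).
Proof.
move=> e1 Ia; have -> : eL * a - a = (eL - 1) * a by ring.
by apply: MILI; rewrite // mevalB e1 meval1 subrr.
Qed.

(** Koszul relations: a skew-symmetric correction of coefficients does not change the sum. *)
Lemma skew_combination (S : 'I_N -> 'I_N -> AL) (Z : 'I_N -> AL) :
  \sum_i (\sum_l (S i l - S l i) * Z l) * Z i = 0.
Proof.
under eq_bigr do rewrite mulr_suml.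
have E : \sum_i \sum_l S l i * Z l * Z i = \sum_i \sum_l S i l * Z l * Z i.
  by rewrite exchange_big; apply: eq_bigr => i _; apply: eq_bigr => l _; ring.
transitivity (\sum_i \sum_l S i l * Z l * Z i - \sum_i \sum_l S l i * Z l * Z i); last first.
  by rewrite E subrr.
by rewrite -sumrB; apply: eq_bigr => i _; rewrite -sumrB; apply: eq_bigr => l _; ring.
Qed.

(* A relation a among the h_j is transported to a relation f among the gen_i by
   expanding e h_j on the gen_i - gen_i(v) and averaging over G. *)
Lemma conormal_fibre_surj a : IL a ->
  exists f, [/\ I f, product_span mv mv f & MIL (subst Gam f - a)].
Proof.
move=> Ia; have [e [eK ev eQ]] := etale_idempotent sGW sKG stabP.
pose q i := gen i - (gv 0 i)%:MP.
have qG i : invariant rW G (q i) by exact: gen_sub_invariant.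
have qK i : invariant rW K (q i) by exact: invariantS (qG i).
pose hv j := unshift (h j).
have ex_E j : exists E : 'I_N -> B, (forall i, invariant rW K (E i)) /\ e * hv j = \sum_i E i * q i.
  by have [E EK eE] := etale_expand eK ev eQ (unshift_vanishing (h_van j)); exists E.
have [E EP] := choice ex_E.
have [aj aj0 aE] := kernel_linear_part h_van h_free Ia.
pose cv j := unshift (subst h (aj j)).
have cvK j : invariant rW K (cv j) by apply: unshift_invariant; exact: substK_invariant.
have cv0 j : (cv j).@[v 0] = 0 by rewrite -meval_shift unshiftK meval0_substK aj0.
have cvhv : \sum_j cv j * hv j = 0.
  transitivity (unshift (subst h a)); last by rewrite Ia raddf0.
  rewrite aE [subst h _]raddf_sum [unshift _]raddf_sum; apply: eq_bigr => j _ /=.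
  by rewrite !rmorphM /= substX.
(* Inserting the expansions of the e h_j into the relation a gives a syzygy of the q_i, with
   K-invariant coefficients vanishing at v. *)
pose rho i := \sum_j cv j * E j i.
have rhoK i : invariant rW K (rho i).
  by apply: invariant_sum => j _; apply: invariantM => //; case: (EP j).
have rho0 i : (rho i).@[v 0] = 0.
  by rewrite raddf_sum big1 // => j _; rewrite /= mevalM cv0 mul0r.
have rhoq : \sum_i rho i * q i = 0.
  transitivity (e * \sum_j cv j * hv j); last by rewrite cvhv mulr0.
  under eq_bigr do rewrite mulr_suml.
  rewrite exchange_big mulr_sumr; apply: eq_bigr => j _ /=.
  rewrite mulrCA (proj2 (EP j)) mulr_sumr; apply: eq_bigr => i _; ring.
(* The q_i being G-invariant, the syzygy can be averaged over G after multiplication by e; its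
   coefficients then lift to F. Dividing by [#|K|] normalises the result, since at v only the terms
   in K count. *)
have /choice[F FP] : forall i, exists F, mv F /\ trace rW G (e * rho i) = subst gen F.
  move=> i; have [|F Fm FE] := vanishing_lift char0 d_gt0 grW sGW gen_h gen_span
      (v := v) (p := trace rW G (e * rho i)); last by exists F.
  split; first exact: trace_invariant.
  by rewrite (etale_transfer sKG eK ev eQ) // rho0 mulr0.
have cK : (#|K|%:R : k) != 0 by exact: natr_card_neq0.
pose f0 := \sum_i F i * ('X_i - (gv 0 i)%:MP).
pose f := #|K|%:R^-1 *: f0.
have gq g : g \in G -> \sum_i act rW g (rho i) * q i = 0.
  move=> gG; transitivity (act rW g (\sum_i rho i * q i)); last by rewrite rhoq raddf0.
  rewrite [RHS]raddf_sum; apply: eq_bigr => i _ /=.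
  by rewrite rmorphM /= qG.
have f0E : subst gen f0 = 0.
  transitivity (\sum_i trace rW G (e * rho i) * q i).
    rewrite /f0 [LHS]raddf_sum; apply: eq_bigr => i _ /=.
    by rewrite rmorphM raddfB /= substX substC (proj2 (FP i)).
  under eq_bigr do rewrite /trace mulr_suml.
  rewrite exchange_big big1 // => g gG.
  transitivity (act rW g e * \sum_i act rW g (rho i) * q i); last by rewrite gq ?mulr0.
  by rewrite mulr_sumr; apply: eq_bigr => i _; rewrite rmorphM /= mulrA.
have If : I f by rewrite /kernel /f linearZ /= f0E scaler0.
exists f; split=> //.
  rewrite /f -mul_mpolyC; apply: (idealMl _ (vanishes_at_sq_ideal gv)).
  apply: (big_ind (product_span mv mv)) => [||i _]; [exact: ps0 | exact: psD |].
  by apply: psI; [case: (FP i) | rewrite /vanishes_at mevalB mevalXU mevalC subrr].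
have lift p : invariant rW K p -> exists b, subst h b = shift p.
  by move=> pK; have [b bE] := lift_invariant (shift_invariant pK); exists b.
have [eL eLE] := lift e eK.
have eL1 : eL.@[fun=> 0] = 1 by rewrite -meval0_substK eLE meval_shift ev.
have ex_EL j : exists EL : 'I_N -> AL, forall i, subst h (EL i) = shift (E j i).
  by have [EL ELE] := choice (fun i => lift _ (proj1 (EP j) i)); exists EL.
have [EL ELE] := choice ex_EL.
pose Z i := Gam i - (gv 0 i)%:MP.
have hZ i : subst h (Z i) = shift (q i).
  by rewrite /Z raddfB /= GamE substC /q [shift (_ - _)]raddfB /= /shift substC.
have Z0 i : mL (Z i).
  by rewrite /Z mevalB mevalC -(substX Gam) meval0_Gam mevalXU subrr.
pose rhoL i := \sum_j aj j * EL j i.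
have hrhoL i : subst h (rhoL i) = shift (rho i).
  rewrite /rhoL /rho [subst h _]raddf_sum [shift _]raddf_sum; apply: eq_bigr => j _ /=.
  by rewrite !rmorphM /= ELE /cv unshiftK.
have iM := MIL_ideal.
(* Each [eL * 'X_j] agrees with its expansion modulo I_L, and the multiplier [aj j] vanishes at
   0. *)
have step1 : MIL (eL * a - \sum_i rhoL i * Z i).
  have -> : eL * a - \sum_i rhoL i * Z i = \sum_j aj j * (eL * 'X_j - \sum_i EL j i * Z i).
    under [RHS]eq_bigr do rewrite mulrBr mulr_sumr.
    rewrite sumrB; congr (_ - _).
      by rewrite aE mulr_sumr; apply: eq_bigr => j _; rewrite mulrCA.
    under eq_bigr do rewrite mulr_suml.
    by rewrite exchange_big; apply: eq_bigr => j _; apply: eq_bigr => i _; rewrite mulrA.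
  apply: (ideal_sum iM) => j _; apply: MILI; first exact: aj0.
  rewrite /kernel raddfB /= rmorphM /= eLE substX [subst h (\sum_i _)]raddf_sum /=.
  under eq_bigr do rewrite rmorphM /= ELE hZ.
  rewrite -[h j]unshiftK -rmorphM /= -/(hv j) (proj2 (EP j)) [shift _]raddf_sum -sumrB.
  by rewrite big1 // => i _; rewrite /= rmorphM subrr.
have [kap kapP] : exists kap : gT -> 'I_N -> B, forall g, g \in G -> g \notin K ->
    e * act rW g e = \sum_l kap g l * q l.
  have ex_kap g : exists kap : 'I_N -> B, g \in G -> g \notin K ->
      e * act rW g e = \sum_l kap l * q l.
    have [gG|gG] := boolP (g \in G); last by exists (fun=> 0).
    have [gK|gK] := boolP (g \in K); first by exists (fun=> 0).
    have [kap _ kapE] : exists2 E : 'I_N -> B, forall i : 'I_N, True &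
        e * act rW g e = \sum_i E i * (gen i - (gv 0 i)%:MP).
      by apply: (@span_vanishing_gen (fun=> True)) => //; exact: (eQ g gG gK).
    by exists kap.
  by have [kap kapP] := choice ex_kap; exists kap.
(* The defect of the averaging comes from g outside K. Subtracting [kap g i] times the syzygy with
   coefficients g(rho_l), which is 0, makes its coefficients skew-symmetric in i and l; the mean
   over K makes them liftable to [AL]. *)
pose sig i l := #|K|%:R^-1 *: mean rW K (\sum_(g in G :\: K) kap g l * act rW g (rho i)).
have sigK i l : invariant rW K (sig i l) by apply: invariantZ; exact: mean_invariant.
have deltaE i : #|K|%:R^-1 *: (e * trace rW G (e * rho i)) - e * (e * rho i) =
    \sum_l (sig i l - sig l i) * q l.
  have -> : #|K|%:R^-1 *: (e * trace rW G (e * rho i)) - e * (e * rho i) =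
      #|K|%:R^-1 *: (\sum_(g in G :\: K) e * act rW g e * act rW g (rho i)).
    rewrite (trace_split _ sKG) trace_id; last exact: invariantM.
    rewrite mulrDr scalerDr -scalerAr scalerA mulVf // scale1r addrAC subrr add0r.
    by rewrite mulr_sumr; congr (_ *: _); apply: eq_bigr => g _; rewrite rmorphM mulrA.
  have dK : invariant rW K (\sum_(g in G :\: K) e * act rW g e * act rW g (rho i)).
    have -> : \sum_(g in G :\: K) e * act rW g e * act rW g (rho i) =
        e * trace rW G (e * rho i) - #|K|%:R *: (e * (e * rho i)).
      rewrite (trace_split _ sKG) trace_id; last exact: invariantM.
      rewrite mulrDr -scalerAr addrAC subrr add0r mulr_sumr.
      by apply: eq_bigr => g _; rewrite rmorphM mulrA.
    apply: invariantB; last by apply: invariantZ; do 2!apply: invariantM => //.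
    by apply: invariantM => //; apply: invariantS sKG _; exact: trace_invariant.
  rewrite -(mean_id char0 dK) /sig.
  under [RHS]eq_bigr do rewrite -scalerBr -scalerAl.
  rewrite -scaler_sumr; congr (_ *: _).
  transitivity (mean rW K (\sum_l q l * (\sum_(g in G :\: K)
      (kap g l * act rW g (rho i) - kap g i * act rW g (rho l))))); last first.
    rewrite mean_sum; apply: eq_bigr => l _; rewrite meanMl // sumrB mulrC; congr (_ * _).
    exact: meanB.
  congr (mean _ _ _); under [RHS]eq_bigr do rewrite mulr_sumr.
  rewrite exchange_big; apply: eq_bigr => g /setDP[gG gK].
  rewrite kapP // mulr_suml.
  transitivity (\sum_l kap g l * q l * act rW g (rho i) -
      kap g i * \sum_l act rW g (rho l) * q l); first by rewrite gq // mulr0 subr0.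
  by rewrite mulr_sumr -sumrB; apply: eq_bigr => l _; ring.
have ex_S i : exists S : 'I_N -> AL, forall l, subst h (S l) = shift (sig i l).
  by have [S SP] := choice (fun l => lift _ (sigK i l)); exists S.
have [S SP] := choice ex_S.
pose T i := eL * (#|K|%:R^-1 *: subst Gam (F i)) - eL * eL * rhoL i.
(* By [deltaE], T_i is skew-symmetric in the Z_l modulo I_L; the skew part sums to 0 and the rest is
   multiplied by Z_i, which vanishes at 0. *)
have step2 : MIL (\sum_i T i * Z i).
  have -> : \sum_i T i * Z i = \sum_i (T i - \sum_l (S i l - S l i) * Z l) * Z i.
    under [RHS]eq_bigr do rewrite mulrBl.
    by rewrite sumrB skew_combination subr0.
  apply: (ideal_sum iM) => i _; rewrite mulrC; apply: MILI; first exact: Z0.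
  rewrite /kernel raddfB /= /T raddfB /= !rmorphM /= linearZ /= subst_Gam -(proj2 (FP i)) eLE hrhoL.
  rewrite [subst h (\sum_l _)]raddf_sum /=.
  under eq_bigr do rewrite rmorphM raddfB /= !SP hZ.
  have := congr1 shift (deltaE i).
  rewrite [shift (_ - _)]raddfB /= [shift (_ *: _)]linearZ /= [shift (\sum_l _)]raddf_sum /= !rmorphM /=.
  under eq_bigr do rewrite rmorphM raddfB /=.
  by move=> <-; rewrite -scalerAr mulrA subrr.
have step3 : MIL (eL * subst Gam f - eL * eL * \sum_i rhoL i * Z i).
  have -> : eL * subst Gam f - eL * eL * \sum_i rhoL i * Z i = \sum_i T i * Z i => //.
  rewrite /f linearZ /= /f0 [subst Gam _]raddf_sum scaler_sumr !mulr_sumr -sumrB.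
  apply: eq_bigr => i _; rewrite /T /= rmorphM raddfB /= substX substC.
  by rewrite -/(Z i) mulrBl -!scalerAr -!scalerAl !mulrA.
have IGf := kernel_Gam If.
have IeLa : IL (eL * a) by exact: (idealMl _ (kernel_ideal h) Ia).
have -> : subst Gam f - a =
    - (eL * subst Gam f - subst Gam f) + (eL * subst Gam f - eL * eL * \sum_i rhoL i * Z i)
    - eL * eL * (eL * a - \sum_i rhoL i * Z i)
    + eL * (eL * (eL * a) - eL * a) + (eL * (eL * a) - eL * a) + (eL * a - a) by ring.
have m1 := MIL_unit eL1 IGf; have m2 := MIL_unit eL1 Ia; have m3 := MIL_unit eL1 IeLa.
apply: psD m2; apply: psD (m3); apply: psD; last exact: (idealMl _ iM m3).
apply: (idealB iM); last exact: (idealMl _ iM step1).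
by apply: psD step3; exact: (idealN iM m1).
Qed.

(** [Gam] is not assumed equivariant. The maps [al] and [be], which apply w after or before it,
    differ by elements of I_L, and by elements of m I_L on products of two functions vanishing at
    [gv]. This is why [conormal_fibre_surj] supplies f in the square of [mv]. *)
Lemma conormal_fibre_act w a : w \in X -> IL a -> MIL (act rL w a - a).
Proof.
move=> wX Ia; have wW := subsetP sXW _ wX; have iM := MIL_ideal.
have [f [If fm fa]] := conormal_fibre_surj Ia.
have ILact b : IL b -> IL (act rL w b).
  by move=> Ib; rewrite /kernel -substK_act // Ib raddf0.
have MILact b : MIL b -> MIL (act rL w b).
  move: b; apply: ps_ind => [|x y|p q /positive_partP p0 Iq].
  - by rewrite raddf0; exact: ps0.
  - by rewrite raddfD; exact: psD.
  rewrite rmorphM; apply: MILI; last exact: ILact.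
  by rewrite -meval_row0 meval_act mul0mx meval_row0 p0.
pose al p := act rL w (subst Gam p); pose be p := subst Gam (act rV w p).
have albe p : IL (al p - be p).
  rewrite /kernel raddfB /= /al -substK_act // !subst_Gam act_shift //.
  by rewrite (subst_act gen_act) // subrr.
have al0 p : mv p -> mL (al p).
  by move=> pm; rewrite /al -meval_row0 meval_act mul0mx meval_row0 meval0_Gam.
have be0 p : mv p -> mL (be p).
  by move=> pm; rewrite /be meval0_Gam (meval_image_act gen_act sXW Xv).
have albef : MIL (al f - be f).
  move: f fm {If fa}; apply: ps_ind => [|x y|p q pm qm].
  - have -> : al 0 - be 0 = 0 by rewrite /al /be [subst Gam 0]raddf0 [act rV w 0]raddf0 [act _ _ 0]raddf0 [subst Gam 0]raddf0 subrr.
    exact: ps0.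
  - move=> hx hy; have -> : al (x + y) - be (x + y) = (al x - be x) + (al y - be y).
      by rewrite /al /be [subst Gam (x + y)]raddfD /= [act rL w (_ + _)]raddfD /= [act rV w _]raddfD /= [subst Gam (_ + _)]raddfD /=; ring.
    exact: psD.
  have -> : al (p * q) - be (p * q) = al p * (al q - be q) + be q * (al p - be p).
    by rewrite /al /be [subst Gam (p * q)]rmorphM /= [act rL w (_ * _)]rmorphM /= [act rV w _]rmorphM /= [subst Gam (_ * _)]rmorphM /=; ring.
  by apply: psD; apply: MILI => //; [exact: al0 | exact: be0].
have m1 : MIL (act rL w (subst Gam f - a)) by exact: MILact.
have m2 : MIL (subst Gam (act rV w f - f)).
  apply: MIL_Gam; exact: (kernel_act_local char0 d_gt0 grW gen_h gen_van gen_free gen_act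
    sXW Xv X_trivial wX If).
have -> : act rL w a - a = - act rL w (subst Gam f - a) + (al f - be f) +
    subst Gam (act rV w f - f) + (subst Gam f - a).
  by rewrite /al /be [act rL w (_ - a)]raddfB [subst Gam (_ - f)]raddfB /=; ring.
by apply: psD fa; apply: psD m2; apply: psD albef; exact: (idealN iM m1).
Qed.

(** The rows of L are the linear terms of the generators u. Combinations of u without linear term,
    up to [mv] times I, form a space of dimension r - rank L, and they reach all of the fibre of
    I_L. *)
Lemma conormal_fibre_span r (u : 'I_r -> A) : generates_ideal I u ->
  exists t, exists b : 'I_t -> AL, [/\ (t + N <= r + M)%N, forall s, IL (b s) &
    forall a, IL a -> exists c : 'I_t -> k, MIL (a - \sum_s c s *: b s)].
Proof.
move=> genI; have iM := MIL_ideal.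
have uI s : I (u s).
  apply/genI; exists (fun i => (i == s)%:R); rewrite (bigD1 s) //= eqxx mul1r.
  by rewrite big1 ?addr0 // => j /negbTE->; rewrite mul0r.
have [c cP] := choice (fun s => linear_part (kernel_vanishes v (uI s))).
pose L : 'M[k]_(r, N) := \matrix_(s, i) c s i 0.
(* x collects the values at [gv] of the coefficients of f on u. *)
have redE f : I f -> exists x : 'rV[k]_r, product_span mv I (f - \sum_s x 0 s *: u s) /\
    product_span mv mv (f - affine gv (x *m L)^T).
  move=> /genI[p ->]; pose x : 'rV[k]_r := \row_s (p s).@[gv 0].
  have E1 : product_span mv I (\sum_s p s * u s - \sum_s x 0 s *: u s).
    rewrite -sumrB; apply: (big_ind (product_span mv I)) => [||s _]; [exact: ps0 | exact: psD |].
    rewrite mxE -mul_mpolyC -mulrBl; apply: psI => //.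
    by rewrite /vanishes_at mevalB mevalC subrr.
  exists x; split=> //.
  have -> : \sum_s p s * u s - affine gv (x *m L)^T =
      (\sum_s p s * u s - \sum_s x 0 s *: u s) + \sum_s x 0 s *: (u s - affine gv (c s)).
    have -> : (x *m L)^T = \sum_s x 0 s *: c s.
      apply/colP => i; rewrite !mxE summxE; apply: eq_bigr => s _.
      by rewrite !mxE.
    rewrite affine_lincomb.
    have -> : \sum_s x 0 s *: (u s - affine gv (c s)) =
        \sum_s x 0 s *: u s - \sum_s x 0 s *: affine gv (c s).
      by rewrite -sumrB; apply: eq_bigr => s _; exact: scalerBr.
    by rewrite addrA subrK.
  apply: psD; first by apply: ps_mono E1 => // z; exact: kernel_vanishes.
  apply: (ideal_sum (vanishes_at_sq_ideal gv)) => s _; rewrite -mul_mpolyC.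
  by apply: (idealMl _ (vanishes_at_sq_ideal gv)).
have [D DP] := conormal_matrix; have [E DE] := conormal_surj DP.
(* The kernel of D has dimension N - M and consists of linear terms of relations, all of which are
   in the row space of L. *)
have rankL : (N <= \rank L + M)%N.
  have rD : \rank D = M by apply/eqP/row_freeP; exists E.
  have : \rank (cokermx D) = (N - M)%N by rewrite mxrank_coker rD.
  move=> rk; rewrite addnC -leq_subLR -rk -mxrank_tr; apply: mxrankS.
  apply/row_subP => i; rewrite -tr_col.
  have : D *m col i (cokermx D) = 0 by rewrite colE mulmxA mulmx_coker mul0mx.
  move=> /(conormal_kernel DP)/(affine_kernel char0 d_gt0 grW sGW gen_h gen_van gen_span sKG stabP).
  move=> [f If fc]; have [x [_ fx]] := redE f If.
  suff -> : col i (cokermx D) = (x *m L)^T by rewrite trmxK submxMl.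
  apply/eqP; rewrite -subr_eq0; apply/eqP/(@affine_sq_eq0 _ _ gv); rewrite affineB.
  have -> : affine gv (col i (cokermx D)) - affine gv (x *m L)^T =
    (f - affine gv (x *m L)^T) - (f - affine gv (col i (cokermx D))) by ring.
  exact: (idealB (vanishes_at_sq_ideal gv)).
pose Ker := row_base (kermx L).
exists (\rank (kermx L)), (fun s => subst Gam (\sum_i Ker s i *: u i)); split.
- rewrite mxrank_ker; apply: (@leq_trans (r - \rank L + (\rank L + M))).
    by rewrite leq_add2l.
  by rewrite addnA subnK // rank_leq_row.
- move=> s; apply: kernel_Gam; apply: (ideal_sum (kernel_ideal gen)) => i _.
  by rewrite -mul_mpolyC; apply: (idealMl _ (kernel_ideal gen)).
move=> a Ia; have [f [If fm fa]] := conormal_fibre_surj Ia.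
have [x [xI xm]] := redE f If.
have xL : x *m L = 0.
  apply: trmx_inj; rewrite trmx0; apply: (@affine_sq_eq0 _ _ gv).
  have -> : affine gv (x *m L)^T = f - (f - affine gv (x *m L)^T) by ring.
  exact: (idealB (vanishes_at_sq_ideal gv)).
have /submxP[y xE] : (x <= Ker)%MS by rewrite eq_row_base; apply/sub_kermxP.
exists (fun s => y 0 s).
have -> : \sum_s y 0 s *: subst Gam (\sum_i Ker s i *: u i) = subst Gam (\sum_i x 0 i *: u i).
  transitivity (subst Gam (\sum_s y 0 s *: \sum_i Ker s i *: u i)).
    by rewrite [RHS]raddf_sum; apply: eq_bigr => s _; rewrite /= linearZ.
  congr (subst Gam _); under eq_bigr do rewrite scaler_sumr.
  rewrite exchange_big; apply: eq_bigr => i _; rewrite xE mxE scaler_suml.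
  by apply: eq_bigr => s _; rewrite scalerA.
have := MIL_Gam xI; rewrite raddfB /= => m1.
have -> : a - subst Gam (\sum_i x 0 i *: u i) =
  (subst Gam f - subst Gam (\sum_i x 0 i *: u i)) - (subst Gam f - a) by ring.
exact: (idealB iM).
Qed.

End ConormalFibre.

End LocalComparison.

(** * The fixator of a subspace *)

Section Splittings.
Context (k : fieldType) (char0 : [pchar k] =i pred0) (n : nat).
Context (d : 'I_n -> nat) (d_gt0 : forall i, (0 < d i)%N).
Context (gT : finGroupType) (W : {group gT}) (rW : mx_representation k W n).
Context (grW : graded_repr d rW) (G : {group gT}) (sGW : G \subset W).
Context (rG : mx_representation k G n) (rGE : forall g, g \in G -> rG g = rW g).
Context (S : splitting d rG).
Local Notation gen := (sp_gen S).
Local Notation V := (vanishing rW 0 G).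

Lemma positive_invariantP p : positive_invariant d rG p <-> V p.
Proof.
rewrite /positive_invariant /vanishing meval_row0.
split=> -[pG p0]; split; try by apply/(positive_partP d_gt0).
  by move=> g gG; rewrite actE -rGE // pG.
by move=> g gG; rewrite rGE // -actE pG.
Qed.

Lemma splitting_vanishing i : V (gen i).
Proof. by apply/positive_invariantP; exact: sp_invariant. Qed.

Lemma splitting_span b : V b ->
  exists c : 'I_(sp_dim S) -> k, product_span V V (b - \sum_i c i *: gen i).
Proof.
move=> /positive_invariantP/(sp_basis S)[c [cP _]]; exists (c 0).
by apply: ps_mono cP => p /positive_invariantP.
Qed.

Lemma splitting_free (c : 'I_(sp_dim S) -> k) :
  product_span V V (\sum_i c i *: gen i) -> forall i, c i = 0.
Proof.
move=> cV i; have pV := proj2 (positive_invariantP _).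
have /(sp_basis S)[c0 [_ c0u]] : positive_invariant d rG (\sum_i c i *: gen i).
  apply: pV; split; last first.
    rewrite [(_).@[_]]raddf_sum big1 // => j _ /=.
    by rewrite mevalZ (proj2 (splitting_vanishing j)) mulr0.
  move=> g gG; rewrite [LHS]raddf_sum; apply: eq_bigr => j _ /=.
  by rewrite linearZ /= (proj1 (splitting_vanishing j)).
have E1 : c0 = 0.
  apply: c0u; rewrite [X in _ - X]big1 ?subr0 => [|j _]; last by rewrite mxE scale0r.
  by apply: ps_mono cV => p; exact: pV.
have E2 : c0 = \row_j c j.
  apply: c0u; under [X in _ - X]eq_bigr do rewrite mxE.
  by rewrite subrr; exact: ps0.
by have := congr1 (fun r : 'rV_ _ => r 0 i) (etrans (esym E1) E2); rewrite !mxE.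
Qed.

Lemma relation_idealE : relation_ideal S = kernel gen.
Proof. by apply/funext => a; rewrite /kernel substE. Qed.

Let wt_gt0 i : (0 < sp_wt S i)%N :=
  generator_wt_gt0 d_gt0 (@sp_homogeneous _ _ _ _ _ _ S) splitting_vanishing splitting_free i.

(** The number of generators is squeezed between the hypothesis and the growth bound, applied both
    to b and to any competing system w. *)
Lemma complete_intersection_span t (b : 'I_t -> {mpoly k[sp_dim S]}) :
    (forall s, kernel gen (b s)) ->
    (forall a, kernel gen a -> exists c : 'I_t -> k,
      product_span (positive_part (sp_wt S)) (kernel gen) (a - \sum_s c s *: b s)) ->
  (n + t <= sp_dim S)%N -> complete_intersection S.
Proof.
have ge t0 (b0 : 'I_t0 -> {mpoly k[sp_dim S]}) : (forall s, kernel gen (b0 s)) ->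
    (forall a, kernel gen a -> exists c : 'I_t0 -> k,
      product_span (positive_part (sp_wt S)) (kernel gen) (a - \sum_s c s *: b0 s)) ->
    exists t1, [/\ (t1 <= t0)%N, (sp_dim S <= n + t1)%N &
      exists u : 'I_t1 -> {mpoly k[sp_dim S]}, generates_ideal (kernel gen) u].
  move=> b0I b0s.
  have [t1 [u [e [t10 _ uh ug]]]] := homogeneous_generators wt_gt0 (kernel_ideal gen)
     (kernel_graded (@sp_homogeneous _ _ _ _ _ _ S)) b0I b0s.
  exists t1; split=> //; last by exists u.
  exact: (kernel_generators_ge d_gt0 wt_gt0 (@sp_homogeneous _ _ _ _ _ _ S) uh ug).
move=> bI bs nt; have [t1 [t1t dt1 [u ug]]] := ge _ _ bI bs.
have t1E : (n + t1)%N = sp_dim S.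
  by apply/eqP; rewrite eqn_leq dt1 andbT; apply: leq_trans nt; rewrite leq_add2l.
exists t1; split=> //; rewrite relation_idealE; split; first by exists u.
move=> r w wg.
have wI s : kernel gen (w s).
  apply/wg; exists (fun i => (i == s)%:R); rewrite (bigD1 s) //= eqxx mul1r.
  by rewrite big1 ?addr0 // => j /negbTE->; rewrite mul0r.
have [|t2 [t2r dt2 _]] := ge _ w wI.
  move=> a /wg[p ->]; exists (fun s => (p s).@[fun=> 0]).
  rewrite -sumrB; apply: (big_ind (product_span _ _)) => [||s _]; [exact: ps0 | exact: psD |].
  exact: (max_ideal_sub wt_gt0 (kernel_ideal gen) (p s) (wI s)).
by apply: leq_trans t2r; rewrite -(leq_add2l n) t1E.
Qed.

(** Otherwise some linear form l separates v' from the whole orbit of v, and the product over g of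
    g(l) - l(v') is an invariant vanishing at v' but not at v. *)
Lemma splitting_orbit v v' : quotient_pt S v' = quotient_pt S v ->
  exists2 g, g \in G & v' = v *m rW g.
Proof.
move=> vv'.
have inv p : invariant rW G p -> p.@[v' 0] = p.@[v 0].
  move=> /(presentation_surjective char0 d_gt0 grW sGW (@sp_homogeneous _ _ _ _ _ _ S) splitting_span).
  move=> [a ->]; rewrite !meval_subst; apply: meval_eq => i.
  by move/rowP/(_ i): vv'; rewrite !mxE.
have [/existsP[g /andP[gG /eqP]]|] := boolP [exists g, (g \in G) && (v' == v *m rW g)].
  by exists g.
rewrite negb_exists => /forallP nex.
have [|u uP] := @avoid_hyperplanes k char0 n [seq (v *m rW g - v')^T | g <- enum G].
  move=> x /mapP[g]; rewrite mem_enum => gG ->.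
  have := nex g; rewrite gG /= => ne; rewrite -(inj_eq trmx_inj) trmxK trmx0 subr_eq0.
  by rewrite eq_sym.
pose b := \prod_(g in G) (act rW g (lin u^T) - ((lin u^T).@[v' 0])%:MP).
have bG : invariant rW G b.
  move=> g gG; rewrite /b rmorph_prod [RHS](reindex_inj (mulgI g)) /=.
  apply: eq_big => [f|f fG]; first by rewrite groupMl.
  by rewrite raddfB /= actC actM ?(subsetP sGW).
have := inv b bG; rewrite {1}/b (bigD1 1%g) //= act1 mevalM mevalB mevalC subrr mul0r.
move=> /esym/eqP; rewrite rmorph_prod => /prodf_eq0[g gG /=].
rewrite mevalB meval_act mevalC !meval_lin => /eqP E.
have: (u *m (v *m rW g - v')^T) 0 0 != 0 by apply: uP; apply: map_f; rewrite mem_enum.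
by rewrite -[u]trmxK -trmx_mul mxE mulmxBl mxE [X in _ + X]mxE E eqxx.
Qed.

End Splittings.

Lemma is_reflectionE (k : fieldType) n (gT : finGroupType) (G : {group gT})
    (rG : mx_representation k G n) g :
  is_reflection rG g = (g \in G) && (\rank (rG g - 1%:M) == 1).
Proof.
rewrite /is_reflection mxrank_ker -addn1.
by rewrite -[X in _ == X](subnK (rank_leq_row (rG g - 1%:M))) eqn_add2l eq_sym.
Qed.

Section QuotientRepresentation.
Context (k : fieldType) (char0 : [pchar k] =i pred0) (n : nat).
Context (d : 'I_n -> nat) (d_gt0 : forall i, (0 < d i)%N).
Context (gT : finGroupType) (W : {group gT}) (rW : mx_representation k W n).
Context (grW : graded_repr d rW) (G : {group gT}) (nGW : (G <| W)%g).
Context (S : splitting d (subg_repr rW (normal_sub nGW))).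
Let rG := subg_repr rW (normal_sub nGW).
Let rGE g : g \in G -> rG g = rW g := fun=> erefl.
Local Notation rV := (tangent_repr grW S).
Local Notation rQ := (quotient_repr grW S).
Local Notation gen := (sp_gen S).

Lemma tangent_act w i : w \in W -> act rW w (gen i) = \sum_j rV w j i *: gen j.
Proof.
by move=> wW; rewrite actE; apply: tangent_mxE; exact: repr_graded_normalizer.
Qed.

Lemma quotient_reprE w : w \in W -> rQ (coset G w) = rV w.
Proof. exact: quo_repr_coset. Qed.

(** An element trivial on V fixes the generators, hence all G-invariants. *)
Lemma tangent_faithful w : mx_faithful rW -> w \in W -> rV w = 1%:M -> w \in G.
Proof.
move=> faithW wW w1; apply: (invariant_galois char0 faithW (normal_sub nGW) wW) => b.
move=> /(presentation_surjective char0 d_gt0 grW (normal_sub nGW)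
  (@sp_homogeneous _ _ _ _ _ _ S) (splitting_span d_gt0 rGE S)) [a ->].
by rewrite -(subst_act tangent_act) // actE w1 mx_act1.
Qed.

Lemma quotient_faithful : mx_faithful rW -> mx_faithful rQ.
Proof.
move=> faithW; apply/subsetP => x /rkerP[/morphimP[w nGw wW ->]].
by rewrite quotient_reprE // => /(tangent_faithful faithW wW) wG; apply/set1P; exact: coset_id.
Qed.

(** A reflection s with s - 1 of rank at most 1 on V maps to a reflection, or acts trivially on V
    and is then in G. *)
Lemma quotient_generated (faithW : mx_faithful rW)
    (genW : <<[set g | is_reflection rW g]>>%g = W) :
    (forall s, is_reflection rW s -> (\rank (rV s - 1%:M)%R <= 1)%N) ->
  <<[set x | is_reflection rQ x]>>%g = (W / G)%g.
Proof.
move=> le1; apply/eqP; rewrite eqEsubset gen_subG; apply/andP; split.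
  by apply/subsetP => x; rewrite inE => /andP[].
have sRW : [set g | is_reflection rW g] \subset W.
  by apply/subsetP => s; rewrite inE => /andP[].
rewrite -[X in (X / _)%g]genW quotient_gen; last exact: subset_trans sRW (normal_norm nGW).
rewrite gen_subG; apply/subsetP => _ /morphimP[s nGs sR ->]; have sW := subsetP sRW _ sR.
rewrite inE in sR.
have := le1 s sR; rewrite leq_eqVlt ltnS leqn0 mxrank_eq0 subr_eq0 => /orP[r1|/eqP s1].
  by apply: mem_gen; rewrite inE is_reflectionE (mem_quotient G sW) (quotient_reprE sW).
have sG : s \in G by exact: tangent_faithful faithW sW s1.
by have /= -> := coset_id sG; exact: group1.
Qed.

End QuotientRepresentation.

Section Fixator.
Context (k : fieldType) (char0 : [pchar k] =i pred0) (n : nat).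
Context (d : 'I_n -> nat) (d_gt0 : forall i, (0 < d i)%N).
Context (gT : finGroupType) (W : {group gT}) (rW : mx_representation k W n).
Context (grW : graded_repr d rW) (reflW : reflection_group rW).
Context (l : nat) (L : 'M[k]_(l, n)).

(** Steinberg's theorem for a generic v of L: the reflections fixing v are those fixing L. *)
Lemma fixator_reflection_group : reflection_group (stab_repr rW L).
Proof.
case: reflW => faithW genW; split; first exact: subg_mx_faithful.
set R := [set g | _].
have sRX : R \subset rstab rW L by apply/subsetP => s; rewrite inE => /andP[].
apply/eqP; rewrite eqEsubset gen_subG sRX; apply/subsetP => w /setIdP[wW /eqP Lw].
have [v vL vgen] := generic_vector char0 rW L.
have vX g : L *m rW g = L -> v *m rW g = v.
  by move=> Lg; case/submxP: vL => D ->; rewrite -mulmxA Lg.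
apply: (steinberg_fixator char0 d_gt0 grW faithW (v := v) (H := <<R>>%G) _ _ _ genW wW).
- by rewrite /= gen_subG; apply: subset_trans sRX (rstab_sub _ _).
- move=> h hR; apply: vX; have : h \in rstab rW L by apply: subsetP hR; rewrite gen_subG.
  by case/setIdP=> _ /eqP.
- move=> s sR vs; apply: mem_gen; have /andP[sW s1] := sR.
  by rewrite inE /is_reflection s1 inE sW (vgen s sW vs) eqxx.
exact: vX.
Qed.

End Fixator.

(** * Transport of reflections along group morphisms *)

Section ReflectionMorphisms.
Context (k : fieldType) (aT rT : finGroupType) (n m : nat).
Context (G : {group aT}) (H : {group rT}).
Context (rG : mx_representation k G n) (rH : mx_representation k H m) (f : aT -> rT).
Context (fG : {in G, forall x, f x \in H}) (fM : {in G &, {morph f : x y / (x * y)%g}}).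
Context (f_onto : {in H, forall y, exists2 x, x \in G & f x = y}).

Lemma reflections_generate_image :
    (forall x, is_reflection rG x -> f x = 1%g \/ is_reflection rH (f x)) ->
    <<[set x | is_reflection rG x]>>%g = G ->
  <<[set y | is_reflection rH y]>>%g = H.
Proof.
move=> f_refl genG; apply/eqP; rewrite eqEsubset gen_subG; apply/andP; split.
  by apply/subsetP => y; rewrite inE => /andP[].
have sRG : [set x | is_reflection rG x] \subset G.
  by apply/subsetP => x; rewrite inE => /andP[].
pose f1 := Morphism fM.
have <- : (f1 @* G)%g = H.
  apply/setP => y; apply/morphimP/idP => [[x _ xG ->]|/f_onto[x xG <-]]; first exact: fG.
  by exists x.
have <- := congr1 (fun A : {set aT} => (f1 @* A)%g) genG.
rewrite morphim_gen // gen_subG; apply/subsetP => _ /morphimP[x _ xR ->].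
rewrite inE in xR; have [/= ->|fx] := f_refl x xR; first exact: group1.
by apply: mem_gen; rewrite inE.
Qed.

Lemma refl_isomorphism_bij : {in G &, injective f} ->
    {in G, forall x, is_reflection rH (f x) = is_reflection rG x} ->
  refl_isomorphism rG rH f.
Proof.
move=> f_inj f_refl; split.
  split=> // x xR; right; rewrite f_refl //.
  by case/andP: xR.
have ex_g y : exists x, y \in H -> x \in G /\ f x = y.
  have [/f_onto[x xG fx]|_] := boolP (y \in H); last by exists 1%g.
  by exists x.
have [g gP] := choice ex_g; exists g; split.
- split=> [y /gP[]//|x y xH yH|y yR].
    have [gx fx] := gP x xH; have [gy fy] := gP y yH; have [gxy fxy] := gP _ (groupM xH yH).
    by apply: f_inj; rewrite ?groupM // fM // fx fy.
  have yH : y \in H by case/andP: yR.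
  by have [gy fy] := gP y yH; right; rewrite -f_refl // fy.
- by move=> x xG; have [gx fx] := gP _ (fG xG); apply: f_inj.
by move=> y /gP[].
Qed.

End ReflectionMorphisms.

(** * The fixator in a good pair, and the canonical map *)

Section GoodFixator.
Context (k : fieldType) (char0 : [pchar k] =i pred0) (n : nat).
Context (d : 'I_n -> nat) (d_gt0 : forall i, (0 < d i)%N).
Context (gT : finGroupType) (W : {group gT}) (rW : mx_representation k W n).
Context (grW : graded_repr d rW) (reflW : reflection_group rW).
Context (G : {group gT}) (nGW : (G <| W)%g).
Context (S : splitting d (subg_repr rW (normal_sub nGW))).
Context (goodG : good grW S) (l : nat) (L : 'M[k]_(l, n)).
Context (SL : splitting d (subg_repr (stab_repr rW L) (normal_sub (stab_normal rW nGW L)))).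
Local Notation rG := (subg_repr rW (normal_sub nGW)).
Local Notation X := (rstab_group rW L).
Local Notation K := (rstab_group rG L).
Local Notation gen := (sp_gen S).
Local Notation h := (sp_gen SL).
Local Notation rV := (tangent_repr grW S).
Local Notation rL := (tangent_repr (stab_graded L grW) SL).
Local Notation rQ := (quotient_repr grW S).
Local Notation rQL := (quotient_repr (stab_graded L grW) SL).

Let sGW : G \subset W := normal_sub nGW.
Let sKG : K \subset G := rstab_sub rG L.
Let sKW : K \subset W := subset_trans sKG sGW.
Let sXW : X \subset W := rstab_sub rW L.
Let nKX : (K <| X)%g := stab_normal rW nGW L.
Let sKX : K \subset X := normal_sub nKX.
Let rGE g : g \in G -> rG g = rW g := fun=> erefl.
Let rKE g : g \in K -> subg_repr (stab_repr rW L) sKX g = rW g := fun=> erefl.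
Let gen_van := splitting_vanishing d_gt0 rGE (S := S).
Let gen_span := splitting_span d_gt0 rGE S.
Let gen_free := splitting_free d_gt0 rGE (S := S).
Let gen_h := @sp_homogeneous _ _ _ _ _ _ S.
Let h_van := splitting_vanishing d_gt0 rKE (S := SL).
Let h_span := splitting_span d_gt0 rKE SL.
Let h_free := splitting_free d_gt0 rKE (S := SL).
Let h_h := @sp_homogeneous _ _ _ _ _ _ SL.
Let gen_act := @tangent_act _ _ _ _ _ _ grW _ nGW S.

Let h_act w i : w \in X -> act rW w (h i) = \sum_j rL w j i *: h j.
Proof. by move=> wX; have := tangent_act (stab_graded L grW) (S := SL) i wX; rewrite !actE. Qed.

Let W_trivial w a : w \in W -> kernel gen a ->
  product_span (positive_part (sp_wt S)) (kernel gen) (act rV w a - a).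
Proof.
move=> wW; case: goodG => _ _; rewrite relation_idealE => triv /(triv _ _ (mem_quotient G wW)).
by rewrite quotient_reprE // actE.
Qed.

Let X_trivial w a : w \in X -> kernel gen a ->
  product_span (positive_part (sp_wt S)) (kernel gen) (act rV w a - a).
Proof. by move=> wX; apply: W_trivial; exact: (subsetP sXW). Qed.

Let generic_point : exists v : 'rV[k]_n, [/\ (v <= L)%MS, forall w, w \in X -> v *m rW w = v,
  forall w, w \in W -> v *m rW w = v -> w \in X &
  forall g, g \in G -> (v *m rW g == v) = (g \in K)].
Proof.
have [v vL vgen] := generic_vector char0 rW L.
have vX w : w \in X -> v *m rW w = v.
  by case/setIdP=> _ /eqP Lw; case/submxP: vL => D ->; rewrite -mulmxA Lw.
exists v; split=> // [w wW vw|g gG]; first by rewrite inE wW (vgen w wW vw) eqxx.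
have gW := subsetP sGW _ gG; rewrite inE gG /=; apply/eqP/eqP => [|Lg]; first exact: vgen.
by apply: vX; rewrite inE gW Lg eqxx.
Qed.

Lemma fixator_reflection_rank w : w \in X ->
  \rank (rV w - 1%:M) = \rank (rL w - 1%:M).
Proof.
have [v [_ vX _ vK]] := generic_point => wX.
have [D DP] := conormal_matrix gen_van vX sKG sKX h_span.
exact: (tangent_rank char0 d_gt0 grW sGW gen_h gen_van gen_span gen_free gen_act sXW vX
  X_trivial sKG sKX vK h_h h_van h_span h_free h_act DP wX).
Qed.

Lemma good_fixator : good (stab_graded L grW) SL.
Proof.
have [v [_ vX _ vK]] := generic_point.
have [Gam GamE] : exists Gam, forall i, subst h (Gam i) = shift v (gen i).
  have ex_Gam i : exists a, subst h a = shift v (gen i).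
    have genK : invariant rW K (gen i) by apply: invariantS sKG _; case: (gen_van i).
    have [a aE] := lift_invariant char0 d_gt0 grW sGW sKG h_h h_span
      (shift_invariant vX sKX genK).
    by exists a.
  by have [Gam GamE] := choice ex_Gam; exists Gam.
have wtL_gt0 i : (0 < sp_wt SL i)%N := generator_wt_gt0 d_gt0 h_h h_van h_free i.
split.
- exact: fixator_reflection_group.
- case: goodG => _ [r [[[u uI] _] nr]] _; rewrite relation_idealE in uI.
  have [t [b [tN bI bspan]]] := conormal_fibre_span char0 d_gt0 grW sGW gen_h gen_van gen_span
    vX sKG sKX vK h_h h_van h_span h_free GamE uI.
  apply: (complete_intersection_span d_gt0 rKE bI bspan).
  by rewrite -nr addnA [(r + _)%N]addnC leq_add2r in tN; rewrite addnC.
move=> x a xQ; rewrite relation_idealE => Ia; have /morphimP[w nKw wX ->] := xQ.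
have := conormal_fibre_act char0 d_gt0 grW sGW gen_h gen_van gen_span gen_free gen_act sXW vX
  X_trivial sKG sKX vK h_h h_van h_span h_free h_act GamE wX Ia.
by rewrite actE -(quotient_reprE (stab_graded L grW) SL wX).
Qed.

Section PointImage.
Context (pL : 'rV[k]_(sp_dim S) -> Prop).
Context (pLE : forall y, pL y <-> exists2 v : 'rV[k]_n, (v <= L)%MS & y = quotient_pt S v).
Local Notation P := (point_stabilizer rQ pL).
Local Notation rWpL := (subg_repr rQ (point_stabilizer_sub rQ pL)).
Local Notation f := (@canonical_map gT K G).

Lemma canonical_map_coset w : w \in X -> f (coset K w) = coset G w.
Proof.
move=> wX; apply: canonical_mapE => //.
  by apply: (subsetP (normal_norm nKX)).
by apply: (subsetP (normal_norm nGW)); exact: (subsetP sXW).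
Qed.

(** If the class of w fixes p(v) for a generic v, then v w and v are in one G-orbit, and multiplying
    w by an element of G makes it fix v, hence L. This is the surjectivity of the canonical map. *)
Lemma point_stabilizer_quotient y :
  y \in P <-> exists2 w, w \in X & y = coset G w.
Proof.
rewrite inE; split=> [/andP[yQ /asboolP yP]|[w wX ->]]; last first.
  have wW := subsetP sXW _ wX; rewrite mem_quotient //; apply/asboolP => z /pLE[v vL ->].
  rewrite (quotient_reprE grW S wW) -quotient_pt_mx; last exact: repr_graded_normalizer.
  case/setIdP: wX => _ /eqP Lw; congr (quotient_pt S _).
  by case/submxP: vL => D ->; rewrite -mulmxA Lw.
have /morphimP[w nGw wW yE] := yQ; have [v [vL vX vXr _]] := generic_point.
have := yP (quotient_pt S v) (proj2 (pLE _) (ex_intro2 _ _ v vL erefl)).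
rewrite yE quotient_reprE // -quotient_pt_mx; last exact: repr_graded_normalizer.
move=> /(splitting_orbit char0 d_gt0 grW sGW rGE)[g gG vg].
have gW := subsetP sGW _ gG.
exists (w * g^-1)%g.
  by apply: vXr; rewrite ?groupM ?groupV // repr_mxM ?groupV // mulmxA vg repr_mxK.
by apply/esym/coset_kerr; rewrite groupV.
Qed.

Lemma canonical_isomorphism :
  [/\ reflection_group rQL, reflection_group rWpL & refl_isomorphism rQL rWpL f].
Proof.
have [faithW genW] := reflW; have [faithX genX] : reflection_group (stab_repr rW L).
  exact: fixator_reflection_group.
have QLP x : x \in (X / K)%g -> exists2 w, w \in X & x = coset K w.
  by case/morphimP=> w _ wX ->; exists w.
have fQ : {in (X / K)%g, forall x, f x \in P}.
  move=> x /QLP[w wX ->]; rewrite canonical_map_coset //.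
  by apply/point_stabilizer_quotient; exists w.
have nKX' := subsetP (normal_norm nKX).
have nGX w : w \in X -> w \in 'N(G)%g.
  by move=> /(subsetP sXW); exact: (subsetP (normal_norm nGW)).
have fM : {in (X / K)%g &, {morph f : x y / (x * y)%g}}.
  move=> _ _ /QLP[w wX ->] /QLP[w' wX' ->].
  by rewrite -morphM ?nKX' // !canonical_map_coset ?groupM // morphM ?nGX.
have f_onto : {in P, forall y, exists2 x, x \in (X / K)%g & f x = y}.
  move=> y /point_stabilizer_quotient[w wX ->]; exists (coset K w); first exact: mem_quotient.
  exact: canonical_map_coset.
have f_refl : {in (X / K)%g, forall x, is_reflection rWpL (f x) = is_reflection rQL x}.
  move=> x xQ; rewrite !is_reflectionE xQ (fQ x xQ); have [w wX ->] := QLP x xQ.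
  rewrite canonical_map_coset // (quotient_reprE (stab_graded L grW) SL wX).
  by rewrite -(fixator_reflection_rank wX) -(quotient_reprE grW S (subsetP sXW _ wX)).
have f_inj : {in (X / K)%g &, injective f}.
  move=> _ _ /QLP[w wX ->] /QLP[w' wX' ->]; rewrite !canonical_map_coset // => E.
  have /(rcoset_kercosetP (nGX w wX) (nGX w' wX')) := E; rewrite mem_rcoset => wG.
  have wK : (w * w'^-1)%g \in K.
    rewrite inE wG /=; have : (w * w'^-1)%g \in X by rewrite groupM ?groupV.
    by case/setIdP.
  by rewrite -[w](mulgKV w'); apply: coset_kerl.
(* The rank bound for reflections is proved on V, where the action on the conormal fibre is known to
   be trivial, and carried over by the equality of ranks. *)
have genQL : <<[set x | is_reflection rQL x]>>%g = (X / K)%g.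
  apply: (quotient_generated char0 d_gt0 faithX genX) => s /andP[sX s1].
  rewrite -(fixator_reflection_rank sX).
  apply: (reflection_image_rank char0 d_gt0 grW sGW gen_h gen_van gen_span gen_free gen_act
    W_trivial); by rewrite /is_reflection (subsetP sXW _ sX).
split.
- split=> //; exact: quotient_faithful.
- split; first exact: subg_mx_faithful (quotient_faithful char0 d_gt0 grW S faithW).
  apply: (reflections_generate_image fQ fM f_onto _ genQL) => x xR; right.
  by rewrite f_refl //; case/andP: xR.
exact: refl_isomorphism_bij.
Qed.

End PointImage.

End GoodFixator.

Theorem mainTheorem4
    (k : fieldType) (char0 : [pchar k] =i pred0)
    (n : nat) (d : 'I_n -> nat) (d_gt0 : forall i, (0 < d i)%N)
    (gT : finGroupType) (W : {group gT}) (rW : mx_representation k W n)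
    (grW : graded_repr d rW) (reflW : reflection_group rW)
    (G : {group gT}) (nGW : (G <| W)%g)
    (S : splitting d (subg_repr rW (normal_sub nGW)))
    (goodG : good grW S)
    (l : nat) (L : 'M[k]_(l, n))
    (SL : splitting d (subg_repr (stab_repr rW L)
                                 (normal_sub (stab_normal rW nGW L)))) :
  let pL (y : 'rV[k]_(sp_dim S)) :=
    exists2 v : 'rV[k]_n, (v <= L)%MS & y = quotient_pt S v in
  let rQ := quotient_repr grW S in
  let rQL := quotient_repr (stab_graded L grW) SL in
  let rWpL := subg_repr rQ (point_stabilizer_sub rQ pL) in
  good (stab_graded L grW) SL /\
  [/\ reflection_group rQL, reflection_group rWpL &
      refl_isomorphism rQL rWpL
        (@canonical_map gT (rstab_group (subg_repr rW (normal_sub nGW)) L) G)].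
Proof.
move=> pL rQ rQL rWpL; split; first exact: (good_fixator char0 d_gt0 reflW goodG SL).
by apply: (canonical_isomorphism char0 d_gt0 reflW goodG SL).
Qed.
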